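(* Let $N\ge 1$ be an integer, $\rho\in(0,1)$, $T>0$ and $a>\frac{N}{2}$. Let $\varphi$ be a continuous function on $\mathbb{T}^N$ with $\varphi\in L_2^a(\mathbb{T}^N)$, and let $f$ be a continuous function on $\mathbb{T}^N\times[0,T]$ such that $f(\cdot,t)\in L_2^a(\mathbb{T}^N)$ for every $t\in[0,T]$ and the function $t\mapsto \|f(\cdot,t)\|^2_{L_2^a(\mathbb{T}^N)}$ belongs to $C[0,T]$. Then there exists a (classical) solution of the initial-boundary value problem $$D_t^\rho u(x,t)+Au(x,t)=f(x,t),\quad x\in\mathbb{T}^N,\ 0<t\le T;\qquad u(x,0)=\varphi(x),\quad x\in\mathbb{T}^N,$$ and it has the form $$u(x,t)=\sum_{n\in\mathbb{Z}^N}\Big[\varphi_n E_{\rho,1}(-|n|^2t^\rho)+\int_0^t f_n(t-\xi)\,\xi^{\rho-1}E_{\rho,\rho}(-|n|^2\xi^\rho)\,d\xi\Big]e^{inx},$$ where $\varphi_n$ and $f_n(t)$ are the Fourier coefficients of $\varphi$ and $f(\cdot,t)$, and this series converges absolutely and uniformly in $x\in\mathbb{T}^N$ for each $t\in(0,T]$. Moreover, the series obtained by applying the operators $D_t^\rho$ and $A$ term by term also converge absolutely and uniformly in $x\in\mathbb{T}^N$ for each $t\in(0,T]$.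
   Context: $\mathbb{T}^N=(-\pi,\pi]^N$ is the $N$-dimensional torus. $C(\mathbb{T}^N)$ and $C^2(\mathbb{T}^N)$ denote the continuous, respectively twice continuously differentiable, functions that are $2\pi$-periodic in each variable $x_j$. The operator $A$ is defined on $C^2(\mathbb{T}^N)$ by $Av=-\Delta v$, where $\Delta$ is the Laplace operator (in $x$). The Caputo derivative of order $\rho\in(0,1)$ of a function $h$ of $t$ is $$D_t^\rho h(t)=\frac{1}{\Gamma(1-\rho)}\int_0^t\frac{\frac{d}{d\tau}h(\tau)}{(t-\tau)^\rho}\,d\tau,\quad t>0,$$ provided the right-hand side exists, where $\Gamma$ is Euler's gamma function. For $n\in\mathbb{Z}^N$, $nx=n_1x_1+\dots+n_Nx_N$ and $|n|^2=n_1^2+\dots+n_N^2$. The Fourier coefficients of $g$ are $g_n=(2\pi)^{-N}\int_{\mathbb{T}^N}g(x)e^{-inx}\,dx$; in particular $f_n(t)$ is the $n$-th Fourier coefficient of $x\mapsto f(x,t)$. For $a>0$, the Liouville space $L_2^a(\mathbb{T}^N)$ is the space of $g\in L_2(\mathbb{T}^N)$ with finite norm $\|g\|^2_{L_2^a(\mathbb{T}^N)}=\sum_{n\in\mathbb{Z}^N}(1+|n|^2)^a|g_n|^2$. The two-parameter Mittag-Leffler function is $E_{\rho,\mu}(t)=\sum_{k=0}^\infty\frac{t^k}{\Gamma(\rho k+\mu)}$. A classical solution of the problem is a function $u\in C(\mathbb{T}^N\times[0,T])$ such that $D_t^\rho u$ and $Au$ belong to $C(\mathbb{T}^N\times(0,T])$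 and $u$ satisfies the equation and the initial condition.
   Formalization: The Caputo derivative is taken in regularized form, d/dt of the fractional integral of order 1−ρ of h−h(0), instead of the fractional integral of dh/dt, because for merely continuous f the solution need not be differentiable in t (e.g. φ=0, f=g(t) of Weierstrass type). *)

(* Defs.v *)
From HB Require Import structures.
From mathcomp Require Import all_boot all_order all_algebra finmap.
From mathcomp Require Import all_classical all_reals all_analysis.
From mathcomp Require Import measurable_realfun complex lra.

Set Implicit Arguments.
Unset Strict Implicit.
Unset Printing Implicit Defensive.

Import Order.TTheory GRing.Theory Num.Theory.
Import numFieldNormedType.Exports ComplexField.Normc.

Local Open Scope classical_set_scope.
Local Open Scope ring_scope.
Local Open Scope complex_scope.

Section ComplexValued.
Context {R : realType}.
Local Notation mu := (@lebesgue_measure R).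

Definition expi (y : R) : R[i] := cos y +i* sin y.

Definition cintegral (D : set R) (F : R -> R[i]) : R[i] :=
  (\int[mu]_(s in D) complex.Re (F s)) +i* (\int[mu]_(s in D) complex.Im (F s)).

(* A restriction [{within A, continuous f}] is expressed by giving [X] the
   value [subspace A]. *)
Definition ccontinuous (X : topologicalType) (F : X -> R[i]) : Prop :=
  continuous (fun x => complex.Re (F x)) /\
  continuous (fun x => complex.Im (F x)).

End ComplexValued.

Section SpecialFunctions.
Context {R : realType}.
Local Notation mu := (@lebesgue_measure R).

Definition Gamma (x : R) : R :=
  \int[mu]_(s in `]0, +oo[) (s `^ (x - 1) * expR (- s)).

Definition mittag_leffler (rho m z : R) : R :=
  limn (series (fun k : nat => z ^+ k / Gamma (rho * k%:R + m))).

End SpecialFunctions.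

Section Caputo.
Context {R : realType}.
Local Notation mu := (@lebesgue_measure R).

Definition frac_integral (b : R) (h : R -> R) (t : R) : R :=
  (Gamma b)^-1 * \int[mu]_(s in `[0, t]) ((t - s) `^ (b - 1) * h s).

(* Difference quotient at [t] of the function
     s |-> 1 / Gamma (1 - rho) * \int_0^s (h r - h 0) / (s - r) ^ rho dr,
   used only on [0, T], so that the derivative at the endpoint T is one-sided. *)
Definition caputo_quotient (rho : R) (h : R -> R) (t s : R) : R :=
  let J := frac_integral (1 - rho) (fun r => h r - h 0) in
  (J s - J t) / (s - t).

(* The Caputo derivative in its regularized form
     D^rho h = d/dt I^(1 - rho) (h - h 0),
   that is, with the differentiation outside of the fractional integral.  For
   h in C^1 (and slightly more generally) it is equal to
     1 / Gamma (1 - rho) * \int_0^t h' s / (t - s) ^ rho ds,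
   see [caputo_C1].  That formula cannot be used on its own here, because a
   solution need not be differentiable in t when f is only continuous: for
   f x t = g t and phi = 0 the solution is the fractional integral I^rho g,
   which is nowhere differentiable for a suitable continuous g. *)
Definition caputo_derivable_real (rho T : R) (h : R -> R) (t : R) : Prop :=
  cvg (caputo_quotient rho h t @ within `[0, T] (t^')).

Definition caputo_real (rho T : R) (h : R -> R) (t : R) : R :=
  lim (caputo_quotient rho h t @ within `[0, T] (t^')).

Definition caputo_derivable (rho T : R) (h : R -> R[i]) (t : R) : Prop :=
  caputo_derivable_real rho T (fun s => complex.Re (h s)) t /\
  caputo_derivable_real rho T (fun s => complex.Im (h s)) t.

Definition caputo (rho T : R) (h : R -> R[i]) (t : R) : R[i] :=
  caputo_real rho T (fun s => complex.Re (h s)) t +i*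
  caputo_real rho T (fun s => complex.Im (h s)) t.

End Caputo.

Section CaputoC1.
Context {R : realType}.
Local Notation mu := (@lebesgue_measure R).

Lemma integrable_powR_itv (b T : R) : -1 < b -> 0 < T ->
  mu.-integrable `[0, T] (fun r => (r `^ b)%:E).
Proof.
move=> b1 T0; apply/integrableP; split.
  by apply/measurable_EFinP; apply: measurable_funTS; exact: measurable_powR.
under eq_integral do rewrite gee0_abs ?lee_fin ?powR_ge0//.
rewrite -integral_itv_obnd_cbnd; last first.
  by apply/measurable_EFinP; apply: measurable_funTS; exact: measurable_powR.
pose F n : set R := `[T / n.+2%:R, T]%classic.
have mF n : measurable (F n) by exact: measurable_itv.
have Tn0 n : 0 < T / n.+2%:R by rewrite divr_gt0.
have TnT n : T / n.+2%:R < T.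
  by rewrite ltr_pdivrMr// ltr_pMr// ltr1n.
have bU : \bigcup_n F n = `]0, T]%classic.
  apply/seteqP; split => [x [n _]|x].
    rewrite /F /= !in_itv/= => /andP[x1 ->]; rewrite andbT.
    exact: lt_le_trans x1.
  rewrite /= in_itv/= => /andP[x0 xT].
  exists (Num.truncn (T / x)).+1 => //; rewrite /F /= in_itv/= xT andbT.
  rewrite ler_pdivrMr// mulrC -ler_pdivrMr//.
  apply: (le_trans (ltW (truncnS_gt _))).
  rewrite ler_nat; exact/leqW/leqW.
have nd : nondecreasing_seq F.
  move=> m n mn; apply/subsetPset => x; rewrite /F /= !in_itv/=.
  move=> /andP[x1 ->]; rewrite andbT; apply: le_trans x1.
  by rewrite ler_pM2l// lef_pV2 ?posrE// ler_nat.
have b0 : 0 < b + 1 by lra.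
have key n : (\int[mu]_(x in F n) (x `^ b)%:E <= (T `^ (b + 1) / (b + 1))%:E)%E.
  pose G (x : R) := x `^ (b + 1) / (b + 1).
  have dG (x : R) : 0 < x -> is_derive x 1 G (x `^ b).
    move=> x0; have D := @is_derive1_powR R (b + 1) x x0.
    have -> : x `^ b = (b + 1)^-1 *: ((b + 1) * x `^ (b + 1 - 1)).
      by rewrite addrK scalerA mulVf ?scale1r// gt_eqF.
    have -> : G = (b + 1)^-1 *: (fun y : R => y `^ (b + 1)).
      by apply/funext => y; rewrite /G fctE mulrC.
    exact: is_deriveZ.
  have cG (x : R) : 0 < x -> {for x, continuous G}.
    move=> x0; apply: differentiable_continuous.
    by apply/derivable1_diffP; have [] := dG _ x0.
  rewrite (@continuous_FTC2 _ _ G).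
  - rewrite -EFinB lee_fin lerBlDr lerDl /G divr_ge0 ?powR_ge0//.
    exact: ltW.
  - exact: TnT.
  - apply: derivable_within_continuous => x; rewrite in_itv/= => /andP[x1 _].
    by apply: derivable_powR; rewrite in_itv/= andbT (lt_le_trans (Tn0 n)).
  - split.
    + move=> x; rewrite in_itv/= => /andP[x1 _].
      by have [] := dG x (lt_trans (Tn0 n) x1).
    + apply: cvg_at_right_filter; exact: (cG _ (Tn0 n)).
    + apply: cvg_at_left_filter; exact: (cG _ T0).
  - move=> x; rewrite in_itv/= => /andP[x1 _].
    have D := dG x (lt_trans (Tn0 n) x1).
    by rewrite derive1E derive_val.
have cv : (\int[mu]_(x in F i) (x `^ b)%:E @[i --> \oo] -->
    \int[mu]_(x in \bigcup_i F i) (x `^ b)%:E)%E.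
  apply: ge0_nondecreasing_set_cvg_integral => //.
  - by move=> i; apply/measurable_EFinP/measurable_funTS; exact: measurable_powR.
  - by move=> i x _; rewrite lee_fin powR_ge0.
apply: (@le_lt_trans _ _ (T `^ (b + 1) / (b + 1))%:E); last exact: ltry.
rewrite -bU -(cvg_lim _ cv)//; apply: lime_le; last by apply: nearW.
by apply/cvg_ex; eexists; exact: cv.
Qed.

Definition reflect_at (s : R) : R -> measurableTypeR R := fun x => s - x.

Lemma measurable_reflect_at s : measurable_fun [set: R] (reflect_at s).
Proof. by apply: measurable_funB. Qed.

Lemma lebesgue_measure_reflect (s : R) (A : set R) : measurable A ->
  pushforward mu (reflect_at s) A = mu A.
Proof.
move=> mA; apply/esym/lebesgue_measure_unique => //=.
  exact: measurable_reflect_at.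
move=> _ _ [[a b]] _ <-.
rewrite /pushforward/=.
have -> : reflect_at s @^-1` `]a, b] = `[s - b, s - a[%classic.
  apply/seteqP; split => x; rewrite /reflect_at /= !in_itv/= => /andP[? ?];
    apply/andP; split; lra.
rewrite !lebesgue_measure_itv/= !lte_fin ltrD2l ltrN2.
by case: ifP => // _; rewrite -!EFinB; congr EFin; lra.
Qed.

Lemma ge0_integral_reflect (s : R) (f : R -> \bar R) :
  measurable_fun [set: R] f -> (forall x, 0 <= f x)%E ->
  (\int[mu]_x f (s - x)%R = \int[mu]_x f x)%E.
Proof.
move=> mf f0.
transitivity (\int[pushforward mu (reflect_at s)]_y f y)%E.
  by rewrite ge0_integral_pushforward//; exact: measurable_reflect_at.
apply: eq_measure_integral; first exact: measurable_reflect_at.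
by move=> ? A mA _; exact: lebesgue_measure_reflect.
Qed.

Lemma Rintegral_reflect (s : R) (f : R -> R) : measurable_fun [set: R] f ->
  \int[mu]_x f (s - x) = \int[mu]_x f x.
Proof.
move=> mf; rewrite /Rintegral.
rewrite [X in fine X = _]integralE [X in _ = fine X]integralE.
have mf' : measurable_fun [set: R] (EFin \o f) by exact/measurable_EFinP.
congr (fine (_ - _)).
  transitivity (\int[mu]_x ((EFin \o f)^\+%E (s - x)%R))%E.
    by apply: eq_integral => x _; rewrite !funeposE.
  by rewrite ge0_integral_reflect//; exact: measurable_funepos.
transitivity (\int[mu]_x ((EFin \o f)^\-%E (s - x)%R))%E.
  by apply: eq_integral => x _; rewrite !funenegE.
by rewrite ge0_integral_reflect//; exact: measurable_funeneg.
Qed.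

Lemma Rintegral_conv_reflect (b T s : R) (g : R -> R) : 0 <= s <= T ->
  measurable_fun [set: R] g -> (forall y, y <= 0 -> g y = 0) ->
  \int[mu]_(r in `[0, s]) ((s - r) `^ b * g r) =
  \int[mu]_(r in `[0, T]) (r `^ b * g (s - r)).
Proof.
move=> /andP[s0 sT] mg g0.
rewrite [LHS]Rintegral_mkcond [RHS]Rintegral_mkcond.
rewrite -[RHS](Rintegral_reflect s).
  apply: eq_Rintegral => x _; rewrite !patchE !mem_setE !in_itv/=.
  have -> : s - (s - x) = x by lra.
  have [x0|x0] := leP x 0.
    by rewrite (g0 _ x0) !mulr0 !if_same.
  rewrite (ltW x0)/= subr_ge0; case: (leP x s) => //= xs.
  by have -> : s - x <= T by lra.
apply/(measurable_restrictT _ _).1; first exact: measurable_itv.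
apply: measurable_funTS; apply: measurable_funM; first exact: measurable_powR.
apply: measurableT_comp => //; exact: measurable_funB.
Qed.

Lemma cvg_within_dnbhs_seq (A : set R) (t l : R) (q : R -> R) :
  (forall x : R^nat, (forall n, A (x n)) -> (forall n, x n != t) ->
    x n @[n --> \oo] --> t -> q (x n) @[n --> \oo] --> l) ->
  q @ within A (t^') --> l.
Proof.
move=> H; apply/cvgrPdist_lt => e e0.
apply: contrapT => nH.
have P (n : nat) : exists s, [/\ A s, s != t, `|t - s| < n.+1%:R^-1
    & e <= `|l - q s|].
  apply: contrapT => nP; apply: nH.
  rewrite /within /= /dnbhs /=.
  exists (n.+1%:R^-1) => /=; first by rewrite invr_gt0.
  move=> s /= ts st As; rewrite ltNge; apply/negP => es.
  by apply: nP; exists s.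
have [x Px] := choice P.
have xt : x n @[n --> \oo] --> t.
  apply/cvgrPdist_lt => d d0.
  near=> n; have [_ _ + _] := Px n; move/lt_trans; apply.
  near: n; exact: near_infty_natSinv_lt (PosNum d0).
have := H x (fun n => let: And4 a _ _ _ := Px n in a)
            (fun n => let: And4 _ a _ _ := Px n in a) xt.
move/cvgrPdist_lt => /(_ _ e0) [n _ /(_ n (leqnn n))].
by have [_ _ _] := Px n; rewrite leNgt => /negP.
Unshelve. all: by end_near. Qed.

Lemma caputo_C1 (rho T t M : R) (h : R -> R) :
  0 < rho < 1 -> 0 < t <= T ->
  {within `[0, T], continuous h} ->
  (forall s, 0 < s < T -> derivable h s 1) ->
  {in `]0, T[, continuous (derive1 h)} ->
  (forall s, 0 < s < T -> `|(derive1 h) s| <= M) ->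
  caputo_derivable_real rho T h t /\
  caputo_real rho T h t =
    (Gamma (1 - rho))^-1 * \int[mu]_(s in `]0, t[) ((derive1 h) s / (t - s) `^ rho).
Proof.
move=> /andP[rho0 rho1] /andP[t0 tT] ch dh cdh Mh.
have T0 : 0 < T by exact: lt_le_trans tT.
have M0 : 0 <= M.
  have hT : 0 < T / 2 < T by lra.
  exact: le_trans (Mh _ hT).
pose cl (y : R) := Num.min (Num.max y 0) T.
have cl0T y : 0 <= cl y <= T.
  by rewrite /cl le_min ge_min le_max lexx orbT (ltW T0) lexx orbT.
have clE y : 0 <= y <= T -> cl y = y.
  by move=> /andP[y0 yT]; rewrite /cl max_l// min_l.
pose k y := h (cl y) - h 0.
pose dk (y : R) := if y \in `]0, T[ then (derive1 h) y else 0.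
have hLip x y : 0 <= x -> x <= y -> y <= T -> `|h y - h x| <= M * (y - x).
  move=> x0; rewrite le_eqVlt => /predU1P[<-|xy] yT.
    by rewrite !subrr normr0 mulr0.
  have dM z : z \in `]x, y[ -> is_derive z 1 h (derive1 h z).
    rewrite in_itv/= => /andP[xz zy].
    by rewrite derive1E; apply/derivableP/dh; lra.
  have cM : {within `[x, y], continuous h}.
    apply: continuous_subspaceW ch => z; rewrite /= !in_itv/= => /andP[? ?].
    lra.
  have [c + ->] := MVT xy dM cM.
  rewrite in_itv/= => /andP[xc cy].
  rewrite normrM [X in _ * X]gtr0_norm ?subr_gt0//.
  by apply: ler_wpM2r; [rewrite subr_ge0 ltW|apply: Mh; lra].
have kLip x y : `|k y - k x| <= M * `|y - x|.
  wlog xy : x y / x <= y => [W|].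
    have [|yx] := leP x y; first exact: W.
    by rewrite (distrC (k y)) (distrC y); apply: W; exact: ltW.
  have -> : k y - k x = h (cl y) - h (cl x) by rewrite /k; lra.
  have clm : cl x <= cl y.
    by rewrite /cl le_min2// le_max2.
  have /andP[x0 _] := cl0T x; have /andP[_ yT] := cl0T y.
  apply: (le_trans (hLip _ _ x0 clm yT)); apply: ler_wpM2l => //.
  rewrite ger0_norm ?subr_ge0// /cl.
  case: (leP x 0) => hx; case: (leP y 0) => hy.
  - by case: (leP 0 T) => ?; lra.
  - by case: (leP 0 T) => ?; case: (leP y T) => ?; lra.
  - by lra.
  - by case: (leP x T) => ?; case: (leP y T) => ?; lra.
have ck : continuous k.
  move=> x; apply/cvgrPdist_le => e e0.
  near=> y; rewrite (le_trans (kLip _ _))//.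
  apply: (@le_trans _ _ ((M + 1) * `|x - y|)).
    by apply: ler_wpM2r => //; lra.
  rewrite mulrC -ler_pdivlMr; last by lra.
  near: y; apply: cvgr_dist_le; first exact: cvg_id.
  by rewrite divr_gt0//; lra.
have mk : measurable_fun [set: R] k by exact: continuous_measurable_fun.
have k0 y : y <= 0 -> k y = 0.
  move=> y0; rewrite /k /cl max_r// min_l ?subrr//; exact: ltW.
have mdk : measurable_fun [set: R] dk.
  have : measurable_fun `]0, T[ (derive1 h).
    apply: open_continuous_measurable_fun ; first by apply: interval_open.
    by move=> x; rewrite inE/= => /cdh.
  move/(measurable_restrictT _ (measurable_itv _)).1.
  apply: eq_measurable_fun => x _.
  by rewrite patchE mem_setE.
have dk0 y : y <= 0 -> dk y = 0.
  by move=> y0; rewrite /dk in_itv/= ltNge y0.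
have dkd y : y < T -> y != 0 -> is_derive y 1 k (dk y).
  move=> yT; rewrite neq_lt => /orP[y0|y0].
    have -> : dk y = 0 by rewrite dk0// ltW.
    apply: (near_eq_is_derive (f := cst 0)) => //.
    near=> z; rewrite /= k0//; apply: ltW.
    by near: z; exact: lt_nbhsl.
  have -> : dk y = derive1 h y by rewrite /dk in_itv/= y0 yT.
  apply: (near_eq_is_derive (f := fun z => h z - h 0)) => //.
    near=> z; rewrite /k clE//; apply/andP; split; apply: ltW.
      by near: z; exact: lt_nbhsr.
    by near: z; exact: lt_nbhsl.
  have D : is_derive y 1 h (derive1 h y).
    by rewrite derive1E; apply/derivableP/dh; rewrite y0 yT.
  rewrite -[X in is_derive _ _ _ X]subr0.
  exact: is_deriveB.
have kM y : `|k y| <= M * T.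
  have /andP[c0 cT] := cl0T y.
  apply: (le_trans (hLip 0 (cl y) _ _ _)) => //.
  by rewrite subr0; apply: ler_wpM2l.
pose b := 1 - rho - 1.
have b1 : -1 < b by rewrite /b; lra.
have bn0 : b != 0 by rewrite /b; apply/eqP; lra.
have ib := integrable_powR_itv b1 T0.
have mkr s : measurable_fun [set: R] (fun r => k (s - r)).
  by apply: measurableT_comp => //; exact: measurable_funB.
have mdkr s : measurable_fun [set: R] (fun r => dk (s - r)).
  by apply: measurableT_comp => //; exact: measurable_funB.
have mb : measurable_fun [set: R] (fun r : R => r `^ b) by exact: measurable_powR.
have ik s : mu.-integrable `[0, T] (EFin \o (fun r => r `^ b * k (s - r))).
  have ib' : mu.-integrable `[0, T] (fun r => ((M * T)%:E * (r `^ b)%:E)%E).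
    exact: integrableZl.
  apply: le_integrable ib' => //.
    apply/measurable_EFinP; apply: measurable_funTS.
    by apply: measurable_funM => //; exact: mkr.
  move=> r _ /=; rewrite lee_fin !normrM mulrC.
  rewrite (ger0_norm (powR_ge0 _ _)); apply: ler_wpM2r; first exact: powR_ge0.
  by rewrite -normrM; apply: (le_trans (kM _)); exact: ler_norm.
pose c := (Gamma (1 - rho))^-1.
have JE s : 0 <= s <= T -> frac_integral (1 - rho) (fun r => h r - h 0) s =
    c * \int[mu]_(r in `[0, T]) (r `^ b * k (s - r)).
  move=> s0T; rewrite /frac_integral -/c -/b; congr (_ * _).
  rewrite -Rintegral_conv_reflect//; apply: eq_Rintegral => r.
  rewrite inE/= in_itv/= => /andP[r0 rs]; rewrite /k clE// r0/=.
  by case/andP: s0T => _; exact: le_trans.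
pose L := c * \int[mu]_(r in `[0, T]) (r `^ b * dk (t - r)).
have LE : c * \int[mu]_(s in `]0, t[) (derive1 h s / (t - s) `^ rho) = L.
  rewrite /L; congr (_ * _).
  rewrite -Rintegral_conv_reflect ?(ltW t0)//.
  rewrite [LHS]Rintegral_mkcond [RHS]Rintegral_mkcond.
  apply: eq_Rintegral => x _; rewrite !patchE !mem_setE !in_itv/=.
  have [x0|x0] := leP x 0; first by rewrite dk0//= mulr0 if_same.
  rewrite (ltW x0)/=; case: (ltgtP x t) => //= [xt|->].
    rewrite /dk in_itv/= x0 (lt_le_trans xt tT)/= mulrC -powRN; congr (_ `^ _ * _).
    by rewrite /b; lra.
  by rewrite subrr powR0// mul0r.
rewrite -/c LE.
have pf : ProperFilter (within `[0, T] (t^')).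
  apply: Build_ProperFilter; rewrite /within /dnbhs /= => -[e /= e0 He].
  have [s [s0 st se]] : exists s, [/\ 0 <= s, s < t & t - s < e].
    by exists (Num.max (t - e / 2) (t / 2)); case: (leP (t - e / 2) (t / 2)) => ?;
      split; lra.
  apply: (He s) => /=.
  - by rewrite gtr0_norm ?subr_gt0.
  - by rewrite lt_eqF.
  - by rewrite in_itv/= s0 ltW// (lt_le_trans st).
suff cvL : caputo_quotient rho h t @ within `[0, T] (t^') --> L.
  split; first by apply/cvg_ex; exists L.
  exact: cvg_lim cvL.
apply: cvg_within_dnbhs_seq => x xA xt xc.
pose g (n : nat) (r : R) := r `^ b * ((k (x n - r) - k (t - r)) / (x n - t)).
have x0T n : 0 <= x n <= T by have := xA n; rewrite /= in_itv.
have QE n : caputo_quotient rho h t (x n) =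
    c * \int[mu]_(r in `[0, T]) g n r.
  rewrite /caputo_quotient !JE ?(ltW t0)// -mulrBr -mulrA; congr (_ * _).
  rewrite -RintegralB//.
  rewrite -RintegralZr//; last first.
    have : mu.-integrable `[0, T] (fun r => ((r `^ b * k (x n - r))%:E -
        (r `^ b * k (t - r))%:E)%E).
      by apply: integrableB => //; exact: ik.
    by apply: eq_integrable.
  by apply: eq_Rintegral => r _; rewrite /g -mulrBr mulrA.
under eq_cvg do rewrite QE.
apply: cvgM; first exact: cvg_cst.
have ibM : mu.-integrable `[0, T] (fun r => (M%:E * (r `^ b)%:E)%E).
  exact: integrableZl.
have := @dominated_convergence _ _ R mu `[0, T]%classic _
  (fun n r => (g n r)%:E) (fun r => (r `^ b * dk (t - r))%:E)
  (fun r => (M%:E * (r `^ b)%:E)%E) _ _ _ ibM _.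
case => //.
- move=> n; apply/measurable_EFinP; apply: measurable_funTS.
  apply: measurable_funM => //; apply: measurable_funM => //.
  by apply: measurable_funB; exact: mkr.
- apply/measurable_EFinP; apply: measurable_funTS.
  by apply: measurable_funM => //; exact: mdkr.
- exists [set t]; split => //; first exact: lebesgue_measure_set1.
  move=> r /= nr; apply: contrapT => rt; apply: nr.
  rewrite in_itv/= => /andP[r0 rT].
  apply/cvg_EFin; first exact: nearW.
  rewrite /comp /g/=.
  have [->|rn0] := eqVneq r 0.
    rewrite powR0// mul0r; under eq_cvg do rewrite mul0r.
    exact: cvg_cst.
  apply: cvgM; first exact: cvg_cst.
  have rp : 0 < r by rewrite lt_neqAle eq_sym rn0.
  have D : is_derive (t - r) 1 k (dk (t - r)).
    apply: dkd; first by lra.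
    by apply/eqP => /subr0_eq tr; apply: rt.
  have [/cvg_ex[l]] := D; move=> cvl; rewrite /derive (cvg_lim _ cvl)// => <-.
  have yc : (x n - t) @[n --> \oo] --> (0 : R).
    by rewrite -(subrr t); apply: cvgB => //; exact: cvg_cst.
  have yn0 n : x n - t != 0 by rewrite subr_eq0.
  have /cvgr_dnbhsP /(_ _ (conj yn0 yc)) := cvl.
  apply: cvg_trans; apply: near_eq_cvg; apply: nearW => n /=.
  rewrite /= /shift/= mulrC; congr (_ * (k _ - _)).
  by rewrite [_ *: _]mulr1; lra.
- apply: aeW => r n _ /=; rewrite lee_fin /g normrM mulrC.
  rewrite (ger0_norm (powR_ge0 _ _)); apply: ler_wpM2r; first exact: powR_ge0.
  rewrite normrM normfV ler_pdivrMr ?normr_gt0 ?subr_eq0//.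
  apply: (le_trans (kLip _ _)); apply: ler_wpM2l => //.
  by have -> : x n - r - (t - r) = x n - t by lra.
move=> iL _ cv.
have /fine_cvg : (\int[mu]_(r in `[0%R, T]) (g n r)%:E @[n --> \oo] -->
    (\int[mu]_(r in `[0%R, T]) (r `^ b * dk (t - r)))%R%:E)%E.
  by rewrite /Rintegral fineK//; exact: integrable_fin_num.
exact.
Unshelve. all: by end_near. Qed.

End CaputoC1.

(* Functions on the torus are functions on R^N that are 2 pi-periodic in each
   variable. *)
Section Torus.
Context {R : realType} {N : nat}.
Local Notation mu := (@lebesgue_measure R).

Definition unit_vec (j : 'I_N) : 'rV[R]_N := delta_mx 0 j.

Definition periodic (g : 'rV[R]_N -> R[i]) : Prop :=
  forall x j, g (x + (2 * pi) *: unit_vec j) = g x.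

Definition torus_continuous (g : 'rV[R]_N -> R[i]) : Prop :=
  periodic g /\ ccontinuous g.

Definition torus_continuous_on (I : set R) (g : 'rV[R]_N -> R -> R[i]) : Prop :=
  (forall t, I t -> periodic (g ^~ t)) /\
  ccontinuous ((fun p => g p.1 p.2)
    : subspace ([set: 'rV[R]_N] `*` I) -> R[i]).

Definition is_C1 (g : 'rV[R]_N -> R) : Prop :=
  continuous g /\
  forall j, (forall x, derivable g x (unit_vec j)) /\
            continuous ('D_(unit_vec j) g).

Definition is_C2 (g : 'rV[R]_N -> R) : Prop :=
  is_C1 g /\ forall j, is_C1 ('D_(unit_vec j) g).

Definition torus_C2 (g : 'rV[R]_N -> R[i]) : Prop :=
  [/\ periodic g, is_C2 (fun x => complex.Re (g x))
    & is_C2 (fun x => complex.Im (g x))].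

Definition laplacian (g : 'rV[R]_N -> R) (x : 'rV[R]_N) : R :=
  \sum_(j < N) 'D_(unit_vec j) ('D_(unit_vec j) g) x.

Definition opA (g : 'rV[R]_N -> R[i]) (x : 'rV[R]_N) : R[i] :=
  - (laplacian (fun y => complex.Re (g y)) x +i*
     laplacian (fun y => complex.Im (g y)) x).

Definition dotn (n : 'rV[int]_N) (x : 'rV[R]_N) : R :=
  \sum_(j < N) (n 0 j)%:~R * x 0 j.

Definition sqnorm (n : 'rV[int]_N) : R := \sum_(j < N) (n 0 j)%:~R ^+ 2.

End Torus.

(* Iterated integral over (-pi, pi]^n; it is only applied to continuous
   functions. *)
Fixpoint torus_integral {R : realType} (n : nat) : ('rV[R]_n -> R) -> R :=
  match n with
  | 0 => fun g => g 0
  | m.+1 => fun g => \int[@lebesgue_measure R]_(s in `]- pi, pi])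
      torus_integral (fun y : 'rV[R]_m => g (row_mx (const_mx s : 'rV[R]_1) y))
  end.

Section Fourier.
Context {R : realType} {N : nat}.

Definition fourier_coef (g : 'rV[R]_N -> R[i]) (n : 'rV[int]_N) : R[i] :=
  let F x := g x * expi (- dotn n x) in
  (((2 * pi) ^- N)%:C) *
  (torus_integral (fun x => complex.Re (F x)) +i*
   torus_integral (fun x => complex.Im (F x))).

(* Squared norm of L_2^a, possibly +oo.  For a continuous periodic [g], which
   is automatically in L_2, membership in L_2^a is finiteness of this sum. *)
Definition liouville_norm2 (a : R) (g : 'rV[R]_N -> R[i]) : \bar R :=
  \esum_(n in [set: 'rV[int]_N])
    ((1 + sqnorm n) `^ a * normc (fourier_coef g n) ^+ 2)%:E.

Definition in_liouville (a : R) (g : 'rV[R]_N -> R[i]) : Prop :=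
  (liouville_norm2 a g < +oo)%E.

End Fourier.

Section Series.
Context {R : realType} {I : choiceType}.

Definition abs_summable (c : I -> R[i]) : Prop :=
  (\esum_(i in [set: I]) (normc (c i))%:E < +oo)%E.

Definition has_sum (c : I -> R[i]) (S : R[i]) : Prop :=
  forall e : R, 0 < e -> exists F0 : {fset I}, forall F : {fset I},
    (F0 `<=` F)%fset -> normc (\sum_(i <- F) c i - S) < e.

Definition has_sum_uniformly (X : Type) (c : I -> X -> R[i]) (S : X -> R[i])
    : Prop :=
  forall e : R, 0 < e -> exists F0 : {fset I}, forall F : {fset I},
    (F0 `<=` F)%fset -> forall x, normc (\sum_(i <- F) c i x - S x) < e.

Definition cvg_abs_unif_to (X : Type) (c : I -> X -> R[i]) (S : X -> R[i])
    : Prop :=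
  (forall x, abs_summable (fun i => c i x)) /\ has_sum_uniformly c S.

Definition cvg_abs_unif (X : Type) (c : I -> X -> R[i]) : Prop :=
  exists S, cvg_abs_unif_to c S.

End Series.

Section Problem.
Context {R : realType} {N : nat}.

Record classical_solution (rho T : R) (phi : 'rV[R]_N -> R[i])
    (f u : 'rV[R]_N -> R -> R[i]) : Prop := {
  sol_continuous : torus_continuous_on `[0, T] u;
  sol_derivable : forall x t, 0 < t <= T -> caputo_derivable rho T (u x) t;
  sol_C2 : forall t, 0 < t <= T -> torus_C2 (u ^~ t);
  sol_caputo_continuous :
    torus_continuous_on `]0, T] (fun x t => caputo rho T (u x) t);
  sol_opA_continuous :
    torus_continuous_on `]0, T] (fun x t => opA (u ^~ t) x);
  sol_equation : forall x t, 0 < t <= T ->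
    caputo rho T (u x) t + opA (u ^~ t) x = f x t;
  sol_initial : forall x, u x 0 = phi x }.

Definition series_term (rho : R) (phi : 'rV[R]_N -> R[i])
    (f : 'rV[R]_N -> R -> R[i]) (n : 'rV[int]_N) (x : 'rV[R]_N) (t : R)
    : R[i] :=
  (fourier_coef phi n *
     (mittag_leffler rho 1 (- sqnorm n * t `^ rho))%:C +
   cintegral `[0, t] (fun xi =>
     fourier_coef (f ^~ (t - xi)) n *
     (xi `^ (rho - 1) * mittag_leffler rho rho (- sqnorm n * xi `^ rho))%:C)) *
  expi (dotn n x).

End Problem.

(* Main.v *)
Require Import Defs.
From HB Require Import structures.
From mathcomp Require Import all_boot all_order all_algebra finmap.
From mathcomp Require Import all_classical all_reals all_analysis.
From mathcomp Require Import measurable_realfun complex lra ring.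

Set Implicit Arguments.
Unset Strict Implicit.
Unset Printing Implicit Defensive.

Import Order.TTheory GRing.Theory Num.Theory.
Import numFieldNormedType.Exports ComplexField.Normc.

Local Open Scope classical_set_scope.
Local Open Scope ring_scope.

(** The Fourier transform in [x] splits the problem into one scalar equation
    D^rho v + l v = g, v 0 = p, for each frequency [n], with l = |n|^2. Its
    solution [mode_sol] is p E_{rho,1}(-l t^rho) plus the convolution [kconv] of
    [g] with the kernel k_l(t) = t^(rho-1) E_{rho,rho}(-l t^rho). The real work is
    to sum over [n]: the series must survive D^rho and the Laplacian.

    The kernel is controlled through the resolvent equation
    k_l = a - l (a . k_l), where a(t) = t^(rho-1) / Gamma(rho) and the dot is
    convolution ([resolvent_eq], the recursion of the Mittag-Leffler series
    combined with the Beta integral). A first-zero argument gives k_l > 0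
    ([kern1_gt0]); the identity k_l - k_m = (m - l) (k_l . k_m) then makes
    k_l decreasing in [l] ([kern_antitone]), and both facts give the decay bounds
    l k_l(t) <= C l^e t^(e rho - 1) ([kern_decay]) and
    l E_{rho,1}(-l t^rho) <= C t^(-rho) ([ml1_decay_time]). The same equation,
    convolved with [g], shows I^(1-rho) (v - p) (t) = int_0^t (g - l v)
    ([mode_sol_balance]), which is the equation of the mode in integrated form.

    As a > N / 2, some e > 0 satisfies a - 2 e > N / 2. Since
    (1 + |n|^2)^(2 e - a) is summable over the lattice ([lattice_sum]) and the
    Liouville norms are bounded in time, the sums of (1 + |n|^2)^e |f_n(t)| have
    tails that are small uniformly in [t] ([liouville_tails]). The factor
    (1 + |n|^2)^e pays for l^e in the kernel bound, and what remains is integrable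
    at time 0. Hence the tails of the sum of l |v_n(t)| are small relative to the
    weight 1 + t^(-rho) ([lmode_tails]): integrable in time, and bounded away from
    t = 0. This gives continuity on (0, T] and, as termwise difference quotients
    are dominated by the amplitudes, two termwise derivatives in [x]
    ([wave_sum_derive]).

    For the Caputo derivative, I^(1-rho) (u - u 0) is the uniform limit of the
    integrals of the partial sums of the g_n - l v_n; these partial sums converge
    locally uniformly on (0, T], so the limit is differentiable there, with the
    termwise derivative ([caputo_msum]). Adding D^rho u and A u, the terms l v_n
    cancel and the Fourier series of [f] remains. It sums to [f], because a
    continuous periodic function whose Fourier coefficients vanish is 0
    ([torus_uniqueness], [Re_inversion]). The same holds for [phi] at t = 0.

    Real and imaginary parts are treated as two real problems: the imaginary part
    of the solution is the real part for the data - i phi and - i f. *)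

(** * Convolution of nonnegative functions on the line *)

Section Convolution.
Context {R : realType}.
Local Notation mu := (@lebesgue_measure R).
Implicit Types f g h : R -> \bar R.
Local Open Scope ereal_scope.

(** Valued in the extended reals, so that commutativity and associativity need
    no integrability hypothesis. *)
Definition econv f g (t : R) : \bar R :=
  \int[mu]_s (f (t - s)%R * g s).

Lemma measurable_fun_reflect f (t : R) : measurable_fun setT f ->
  measurable_fun [set: R] (fun s : R => f (t - s)%R).
Proof.
move=> mf; apply: measurableT_comp => //; exact: measurable_funB.
Qed.

Lemma ge0_integral_shift f (r : R) : measurable_fun setT f ->
  (forall x, 0 <= f x) -> \int[mu]_x f (x - r)%R = \int[mu]_x f x.
Proof.
move=> mf f0.
rewrite -[RHS](ge0_integral_reflect (- r)%R)//.
rewrite -[LHS](ge0_integral_reflect 0)//; last first.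
  by apply: measurableT_comp => //; exact: measurable_funB.
by apply: eq_integral => x _; congr f; ring.
Qed.

Lemma econvC f g : measurable_fun setT f -> measurable_fun setT g ->
  (forall x, 0 <= f x) -> (forall x, 0 <= g x) -> econv f g = econv g f.
Proof.
move=> mf mg f0 g0; apply/funext => t; rewrite /econv.
rewrite -(ge0_integral_reflect t); last 2 first.
- by apply: emeasurable_funM => //; exact: measurable_fun_reflect.
- by move=> x; exact: mule_ge0.
apply: eq_integral => x _; rewrite muleC; congr (g _ * f _); ring.
Qed.

Lemma econv_ge0 f g t : (forall x, 0 <= f x) -> (forall x, 0 <= g x) ->
  0 <= econv f g t.
Proof. by move=> f0 g0; apply: integral_ge0 => x _; exact: mule_ge0. Qed.

Lemma measurable_conv_kernel f g : measurable_fun setT f -> measurable_fun setT g ->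
  measurable_fun [set: measurableTypeR R * measurableTypeR R]
    (fun z => f (z.1 - z.2)%R * g z.2).
Proof.
move=> mf mg; apply: emeasurable_funM.
  apply: (measurableT_comp mf).
  by apply: measurable_funB; [exact: measurable_fst|exact: measurable_snd].
by apply: (measurableT_comp mg); exact: measurable_snd.
Qed.

Lemma measurable_econv f g : measurable_fun setT f -> measurable_fun setT g ->
  (forall x, 0 <= f x) -> (forall x, 0 <= g x) ->
  measurable_fun setT (econv f g).
Proof.
move=> mf mg f0 g0.
apply: (measurable_fun_fubini_tonelli_F (m2 := mu)
  (fun z : measurableTypeR R * measurableTypeR R =>
    f (z.1 - z.2)%R * g z.2)) => /=.
  exact: measurable_conv_kernel.
by move=> x; exact: mule_ge0.
Qed.

(** Tonelli, after a translation of the inner integral. *)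
Lemma econvA f g h : measurable_fun setT f -> measurable_fun setT g ->
  measurable_fun setT h ->
  (forall x, 0 <= f x) -> (forall x, 0 <= g x) -> (forall x, 0 <= h x) ->
  econv f (econv g h) = econv (econv f g) h.
Proof.
move=> mf mg mh f0 g0 h0; apply/funext => t; rewrite /econv.
transitivity (\int[mu]_s \int[mu]_r (f (t - s)%R * (g (s - r)%R * h r))).
  apply: eq_integral => s _; rewrite -ge0_integralZl//.
  - apply: emeasurable_funM => //; exact: measurable_fun_reflect.
  - by move=> x _; exact: mule_ge0.
rewrite (fubini_tonelli (fun z : measurableTypeR R * measurableTypeR R =>
    f (t - z.1)%R * (g (z.1 - z.2)%R * h z.2))); last 2 first.
- apply: emeasurable_funM; last exact: measurable_conv_kernel.
  apply: (measurableT_comp mf).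
  by apply: measurable_funB => //; exact: measurable_fst.
- by move=> x; apply: mule_ge0 => //; exact: mule_ge0.
apply: eq_integral => r _.
transitivity ((\int[mu]_s (f (t - s)%R * g (s - r)%R)) * h r).
  rewrite muleC -ge0_integralZl//.
  - by apply: eq_integral => s _ /=; rewrite muleA muleC.
  - apply: emeasurable_funM; first exact: measurable_fun_reflect.
    by apply: measurableT_comp => //; exact: measurable_funB.
  - by move=> x _; exact: mule_ge0.
congr (_ * _).
rewrite -[RHS](ge0_integral_shift r); last 2 first.
- apply: emeasurable_funM => //; exact: measurable_fun_reflect.
- by move=> x; exact: mule_ge0.
by apply: eq_integral => s _; congr (f _ * _); ring.
Qed.

Lemma integral_econv f g : measurable_fun setT f -> measurable_fun setT g ->
  (forall x, 0 <= f x) -> (forall x, 0 <= g x) ->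
  \int[mu]_t econv f g t = (\int[mu]_t f t) * \int[mu]_t g t.
Proof.
move=> mf mg f0 g0; rewrite /econv.
rewrite (fubini_tonelli (fun z : measurableTypeR R * measurableTypeR R =>
    f (z.1 - z.2)%R * g z.2)); last 2 first.
- exact: measurable_conv_kernel.
- by move=> x; exact: mule_ge0.
transitivity (\int[mu]_s ((\int[mu]_t f t) * g s)).
  apply: eq_integral => s _ /=.
  transitivity (g s * \int[mu]_t f (t - s)%R).
    rewrite -ge0_integralZl//; last first.
      by apply: measurableT_comp => //; exact: measurable_funB.
    by apply: eq_integral => t _; rewrite muleC.
  by rewrite ge0_integral_shift// muleC.
by rewrite ge0_integralZl//; exact: integral_ge0.
Qed.

Lemma econvDr f g h t : measurable_fun setT f -> measurable_fun setT g ->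
  measurable_fun setT h ->
  (forall x, 0 <= f x) -> (forall x, 0 <= g x) -> (forall x, 0 <= h x) ->
  econv f (g \+ h) t = econv f g t + econv f h t.
Proof.
move=> mf mg mh f0 g0 h0; rewrite /econv -ge0_integralD//.
- by apply: eq_integral => x _; rewrite ge0_muleDr.
- by move=> x _; exact: mule_ge0.
- apply: emeasurable_funM => //; exact: measurable_fun_reflect.
- by move=> x _; exact: mule_ge0.
- apply: emeasurable_funM => //; exact: measurable_fun_reflect.
Qed.

Lemma econvZr f g (c : \bar R) t : measurable_fun setT f ->
  measurable_fun setT g -> 0 <= c ->
  (forall x, 0 <= f x) -> (forall x, 0 <= g x) ->
  econv f (fun x => c * g x) t = c * econv f g t.
Proof.
move=> mf mg c0 f0 g0; rewrite /econv -ge0_integralZl//.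
- by apply: eq_integral => x _; rewrite muleCA.
- apply: emeasurable_funM => //; exact: measurable_fun_reflect.
- by move=> x _; exact: mule_ge0.
Qed.

End Convolution.

Section Scaling.
Context {R : realType}.
Local Notation mu := (@lebesgue_measure R).

Definition scale_by (c : R) : R -> measurableTypeR R := fun x => c * x.

Lemma measurable_scale_by c : measurable_fun [set: R] (scale_by c).
Proof. by apply: measurable_funM. Qed.

(** The image of Lebesgue measure under a dilation, multiplied by the ratio,
    gives intervals their length; hence it is Lebesgue measure. *)
Lemma ge0_integral_scale (c : R) (f : R -> \bar R) : 0 < c ->
  measurable_fun setT f -> (forall x, 0 <= f x)%E ->
  (c%:E * \int[mu]_x f (c * x)%R = \int[mu]_x f x)%E.
Proof.
move=> c0 mf f0.
have -> : (\int[mu]_x f (c * x)%R =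
    \int[pushforward mu (scale_by c)]_y f y)%E.
  by rewrite ge0_integral_pushforward//; exact: measurable_scale_by.
pose k := NngNum (ltW c0).
have [m mE] : exists m : {measure set (measurableTypeR R) -> \bar R},
    (m : set _ -> \bar R) = pushforward mu (scale_by c).
  unshelve refine (ex_intro _ _ (erefl (pushforward mu (scale_by c)))).
  exact: measurable_scale_by.
rewrite -mE; transitivity (\int[mscale k m]_y f y)%E.
  by rewrite ge0_integral_mscale.
apply: eq_measure_integral => A mA _; apply/esym/(@lebesgue_measure_unique R (mscale k m)) => //=.
move=> _ [[a b]] _ <-.
rewrite /mscale/= mE /pushforward/=.
have -> : scale_by c @^-1` `]a, b] = `]c^-1 * a, c^-1 * b]%classic.
  apply/seteqP; split => x; rewrite /scale_by /= !in_itv/=;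
    by rewrite (mulrC _ a) (mulrC _ b) ltr_pdivrMr// ler_pdivlMr// (mulrC c).
rewrite !lebesgue_measure_itv/= !lte_fin ltr_pM2l ?invr_gt0//.
case: ifP => // _; last by rewrite mule0.
by rewrite -!EFinB -EFinM; congr EFin; field; rewrite gt_eqF.
Qed.

End Scaling.

(** * The Gamma function and the Beta integral *)

Section Gamma.
Context {R : realType}.
Local Notation mu := (@lebesgue_measure R).

Lemma integrable_setU (A B : set R) (f : R -> R) :
  measurable A -> measurable B -> [disjoint A & B] ->
  mu.-integrable A (EFin \o f) -> mu.-integrable B (EFin \o f) ->
  mu.-integrable (A `|` B) (EFin \o f).
Proof.
move=> mA mB AB /integrableP[mfA iA] /integrableP[mfB iB].
have mf : measurable_fun (A `|` B) (EFin \o f) by exact/measurable_funU.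
apply/integrableP; split => //.
rewrite ge0_integral_setU//; first exact: lte_add_pinfty.
exact: measurableT_comp.
Qed.

Lemma measurable_powR_expRN (x : R) (D : set R) :
  measurable_fun D (fun s : R => s `^ (x - 1) * expR (- s)).
Proof.
apply: measurable_funTS; apply: measurable_funM; first exact: measurable_powR.
by apply: measurableT_comp => //; exact: measurable_funN.
Qed.

(** Half of the exponential absorbs the power, since 1 + y <= e^y for
    y = s / (2 m) with an integer m >= x; the other half is integrable. *)
Lemma powR_le_expR (x s : R) : 0 < x -> 1 <= s ->
  s `^ (x - 1) * expR (- s) <= (2 * (Num.truncn x).+1%:R) ^+ (Num.truncn x).+1 * expR (- (2^-1 * s)).
Proof.
move=> x0 s1; set m := (Num.truncn x).+1.
have xm : x <= m%:R by exact/ltW/truncnS_gt.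
have s0 : 0 <= s by exact: le_trans s1.
have -> : - s = - (2^-1 * s) + - (2^-1 * s) by lra.
rewrite expRD mulrA ler_wpM2r ?expR_ge0//.
apply: (@le_trans _ _ (s ^+ m * expR (- (2^-1 * s)))).
  rewrite ler_wpM2r ?expR_ge0// -powR_mulrn//.
  by apply: ler_powR => //; lra.
rewrite expRN ler_pdivrMr ?expR_gt0//.
have m0 : 0 < m%:R :> R by rewrite ltr0n.
have -> : 2^-1 * s = s / (2 * m%:R) * m%:R.
  by field; exact: lt0r_neq0.
rewrite expRM_natr -exprMn lerXn2r ?nnegrE ?mulr_ge0 ?expR_ge0// ?ler0n//.
rewrite mulrC -ler_pdivrMr ?mulr_gt0//.
by apply: le_trans (expR_ge1Dx _); rewrite lerDr.
Qed.

Lemma integrable_gamma (x : R) : 0 < x ->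
  mu.-integrable `]0, +oo[ (fun s => (s `^ (x - 1) * expR (- s))%:E).
Proof.
move=> x0.
have x1 : -1 < x - 1 by lra.
have i1 := integrable_powR_itv x1 ltr01.
have -> : `]0, +oo[%classic = `]0, 1] `|` `]1, +oo[%classic :> set R.
  by rewrite -itv_bndbnd_setU// bnd_simp.
have half0 : 0 < 2^-1 :> R by rewrite invr_gt0.
have iexp := integrable_exponential_pdf half0.
apply: (@integrable_setU _ _ (fun s => s `^ (x - 1) * expR (- s))) => //.
- apply/disj_setPS => s [/=]; rewrite !in_itv/= andbT => /andP[_ s1].
  by rewrite ltNge s1.
- apply: (le_integrable _ _ _ (integrableS _ _ _ i1)) => //.
  + by apply/measurable_EFinP; exact: measurable_powR_expRN.
  + move=> s; rewrite /= in_itv/= => /andP[s0 s1].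
    rewrite lee_fin normrM [X in _ * X]ger0_norm ?expR_ge0//.
    by rewrite ler_piMr// -[leRHS]expR0 ler_expR oppr_le0 ltW.
  + by apply: subset_itvr; rewrite bnd_simp.
- set C := (2 * (Num.truncn x).+1%:R) ^+ (Num.truncn x).+1 : R.
  have C0 : 0 <= C by rewrite exprn_ge0// mulr_ge0.
  have i2 : mu.-integrable `]1, +oo[
      (fun s => ((2 * C)%:E * (exponential_pdf 2^-1 s)%:E)%E).
    apply: integrableZl => //; apply: (integrableS _ _ _ iexp) => //.
  apply: le_integrable i2 => //.
  + by apply/measurable_EFinP; exact: measurable_powR_expRN.
  + move=> s; rewrite /= in_itv/= andbT => s1.
    have s0 : 0 <= s by rewrite ltW// (lt_trans _ s1).
    have h1 : 0 <= s `^ (x - 1) * expR (- s) by rewrite mulr_ge0 ?powR_ge0 ?expR_ge0.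
    have h2 : 0 <= 2 * C * exponential_pdf 2^-1 s.
      by apply: mulr_ge0; [exact: mulr_ge0|exact: exponential_pdf_ge0].
    rewrite [leRHS]/= lee_fin (ger0_norm h1) (ger0_norm h2).
    rewrite exponential_pdfE//.
    apply: le_trans (powR_le_expR x0 (ltW s1)) _; rewrite -/C.
    by rewrite mulNr; set e := expR _; lra.
Qed.

Lemma GammaE (x : R) : 0 < x ->
  (\int[mu]_(s in `]0%R, +oo[) (s `^ (x - 1) * expR (- s))%:E)%E =
  (Gamma x)%:E.
Proof.
by move=> x0; rewrite /Gamma /Rintegral fineK//; apply: integrable_fin_num => //;
  exact: integrable_gamma.
Qed.

(** The part of the integral over ]A, A + 1] alone shows that Gamma outgrows
    every geometric sequence; this is what makes the Mittag-Leffler series entire. *)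
Lemma Gamma_lower (A x : R) : 0 <= A -> 0 < x ->
  A `^ x / (A + 1) * expR (- (A + 1)) <= Gamma x.
Proof.
move=> A0 x0; rewrite -lee_fin -GammaE//.
apply: (@le_trans _ _ (\int[mu]_(s in `]A, (A + 1)%R])
    (A `^ x / (A + 1) * expR (- (A + 1)))%:E)%E).
  rewrite integral_cst//= lebesgue_measure_itv/= lte_fin ltrDl ltr01.
  by rewrite -EFinB addrAC subrr add0r mule1.
apply: (@le_trans _ _ (\int[mu]_(s in `]A, (A + 1)%R])
    (s `^ (x - 1) * expR (- s))%:E)%E).
  apply: ge0_le_integral => //.
  - move=> s _; rewrite lee_fin mulr_ge0 ?expR_ge0// divr_ge0 ?powR_ge0//.
    by rewrite addr_ge0.
  - by apply/measurable_EFinP; exact: measurable_powR_expRN.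
  - move=> s; rewrite /= in_itv/= => /andP[As sA].
    have s0 : 0 < s by exact: le_lt_trans As.
    rewrite lee_fin ler_pM ?expR_ge0//.
    + by rewrite divr_ge0 ?powR_ge0// addr_ge0.
    + rewrite powRB ?powRr1 ?(ltW s0)//; last by rewrite (gt_eqF s0) implybT.
      rewrite ler_pM ?powR_ge0 ?invr_ge0 ?addr_ge0//.
        by apply: ge0_ler_powR; rewrite ?nnegrE// ltW.
      by rewrite lef_pV2 ?posrE// (lt_le_trans s0).
    + by rewrite ler_expR lerN2.
apply: ge0_subset_integral => //.
- by apply/measurable_EFinP; exact: measurable_powR_expRN.
- by move=> s _; rewrite lee_fin mulr_ge0 ?powR_ge0 ?expR_ge0.
- by move=> s; rewrite /= !in_itv/= andbT => /andP[/(le_lt_trans A0)].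
Qed.

Lemma Gamma_gt0 (x : R) : 0 < x -> 0 < Gamma x.
Proof.
move=> x0; apply: lt_le_trans (Gamma_lower ler01 x0).
by rewrite powR1 mulr_gt0 ?expR_gt0.
Qed.

Lemma Gamma1 : Gamma 1 = 1 :> R.
Proof.
rewrite -[RHS]/(fine 1%E).
rewrite -(integral_exponential_pdf (@ltr01 R)) /Gamma /Rintegral.
rewrite integral_itv_obnd_cbnd; last first.
  by apply/measurable_EFinP; exact: measurable_powR_expRN.
rewrite integral_mkcond; congr fine; apply: eq_integral => s _.
rewrite /exponential_pdf !patchE; case: ifPn => //= _.
by rewrite subrr powRr0 mulN1r !mul1r.
Qed.

End Gamma.

Section Causal.
Context {R : realType}.
Local Notation mu := (@lebesgue_measure R).
Implicit Types g h : R -> R.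

(** Extension by zero to the half-line of nonpositive times; for such
    functions the convolution on the line is the Volterra convolution. *)
Definition causal h : R -> \bar R := fun s => if 0 < s then (h s)%:E else 0%E.

Lemma causal_ge0 h : (forall s, 0 < s -> 0 <= h s) ->
  forall s, (0 <= causal h s)%E.
Proof. by move=> h0 s; rewrite /causal; case: ifPn => // /h0; rewrite lee_fin. Qed.

Lemma measurable_causal h : measurable_fun (`]0, +oo[%classic : set R) h ->
  measurable_fun setT (causal h).
Proof.
move=> mh.
have : measurable_fun setT ((EFin \o h) \_ `]0, +oo[).
  apply/(measurable_restrictT _ _).1 => //.
  by apply: measurableT_comp.
apply: eq_measurable_fun => s _; rewrite patchE mem_setE in_itv/= andbT.
by [].
Qed.

Lemma econv_causal g h (t : R) :
  econv (causal g) (causal h) t =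
  (\int[mu]_(s in `]0%R, t[) (g (t - s) * h s)%:E)%E.
Proof.
rewrite /econv [RHS]integral_mkcond; apply: eq_integral => s _.
rewrite patchE mem_setE in_itv/= /causal subr_gt0.
by case: ifPn => _; case: ifPn => _ //=; rewrite ?mule0 ?mul0e.
Qed.

Lemma econv_causal_le0 g h (t : R) : t <= 0 ->
  econv (causal g) (causal h) t = 0%E.
Proof.
by move=> t0; rewrite econv_causal set_itv_ge ?integral_set0// bnd_simp -leNgt.
Qed.

Lemma integral_causal h :
  (\int[mu]_s causal h s = \int[mu]_(s in (`]0%R, +oo[%classic : set R)) (h s)%:E)%E.
Proof.
rewrite [RHS]integral_mkcond; apply: eq_integral => s _.
by rewrite patchE mem_setE in_itv/= andbT /causal.
Qed.

End Causal.

Section Beta.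
Context {R : realType}.
Local Notation mu := (@lebesgue_measure R).
Implicit Types al be t : R.

Let pw al : R -> \bar R := causal (fun s => s `^ (al - 1)).
Let gm al : R -> \bar R := causal (fun s => s `^ (al - 1) * expR (- s)).

Let pw0 al s : (0 <= pw al s)%E.
Proof. by apply: causal_ge0 => ? _; exact: powR_ge0. Qed.

Let mpw al : measurable_fun setT (pw al).
Proof. by apply: measurable_causal; apply: measurable_funTS; exact: measurable_powR. Qed.

Let mgm al : measurable_fun setT (gm al).
Proof. by apply: measurable_causal; exact: measurable_powR_expRN. Qed.

Let gm0 al s : (0 <= gm al s)%E.
Proof. by apply: causal_ge0 => ? _; rewrite mulr_ge0 ?powR_ge0 ?expR_ge0. Qed.

Let econv_gm al be t :
  econv (gm al) (gm be) t = ((expR (- t))%:E * econv (pw al) (pw be) t)%E.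
Proof.
rewrite /econv -ge0_integralZl//; last 2 first.
- by apply: emeasurable_funM; [exact: (measurable_fun_reflect _ (mpw al))|exact: mpw].
- by move=> s _; exact: mule_ge0.
apply: eq_integral => s _; rewrite /gm /pw /causal.
case: ifPn => _; case: ifPn => _; rewrite ?mule0 ?mul0e ?mule0//.
rewrite -!EFinM; congr EFin.
have -> : - t = - (t - s) + - s by lra.
by rewrite expRD; ring.
Qed.

Let econv_pw_scale al be t : 0 < t ->
  econv (pw al) (pw be) t = ((t `^ (al + be - 1))%:E * econv (pw al) (pw be) 1)%E.
Proof.
move=> t0; rewrite {1}/econv -(ge0_integral_scale t0); last 2 first.
- by apply: emeasurable_funM; [exact: (measurable_fun_reflect _ (mpw al))|exact: mpw].
- by move=> s; exact: mule_ge0.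
have -> : (t `^ (al + be - 1))%:E = (t%:E * (t `^ (al + be - 2))%:E)%E :> \bar R.
  rewrite -EFinM; congr EFin; rewrite -{2}(powRr1 (ltW t0)) -powRD; last first.
    by rewrite (gt_eqF t0) implybT.
  by congr (_ `^ _); lra.
rewrite -muleA; congr (_ * _)%E; rewrite /econv -ge0_integralZl ?lee_fin ?powR_ge0//; last 2 first.
- by apply: emeasurable_funM; [exact: (measurable_fun_reflect _ (mpw al))|exact: mpw].
- by move=> s _; exact: mule_ge0.
apply: eq_integral => s _; rewrite /pw /causal.
have -> : (0 < t - t * s) = (0 < 1 - s).
  by rewrite -{1}[t]mulr1 -mulrBr pmulr_rgt0.
rewrite pmulr_rgt0//.
case: ifPn => h1; case: ifPn => h2; rewrite ?mule0 ?mul0e ?mule0//.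
rewrite -!EFinM; congr EFin.
have -> : t - t * s = t * (1 - s) by ring.
have -> : al + be - 2 = (al - 1) + (be - 1) by lra.
rewrite !powRM ?(ltW t0) ?(ltW h1) ?(ltW h2)// (@powRD _ t (al - 1)); last first.
  by rewrite (gt_eqF t0) implybT.
by ring.
Qed.

(** The functions s^(al-1) e^(-s) convolve to e^(-t) times the convolution of the
    powers, which is homogeneous in [t]; integrating over [t] identifies the
    constant of homogeneity as a quotient of Gamma values. *)
Lemma econv_powR al be t : 0 < al -> 0 < be -> 0 < t ->
  econv (causal (fun s => s `^ (al - 1))) (causal (fun s => s `^ (be - 1))) t =
  (Gamma al * Gamma be / Gamma (al + be) * t `^ (al + be - 1))%:E.
Proof.
move=> al0 be0 t0; rewrite -/(pw al) -/(pw be) econv_pw_scale//.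
set B := econv _ _ _.
have B0 : (0 <= B)%E by exact: econv_ge0.
have G0 : 0 < Gamma (al + be) by rewrite Gamma_gt0// addr_gt0.
have H : (\int[mu]_t econv (gm al) (gm be) t = (Gamma (al + be))%:E * B)%E.
  transitivity (\int[mu]_t (gm (al + be) t * B))%E.
    apply: eq_integral => s _; rewrite econv_gm /gm /causal.
    case: ifPn => [s0|]; first by rewrite econv_pw_scale// muleA -EFinM mulrC.
    rewrite -leNgt => s0; rewrite mul0e econv_causal set_itv_ge ?integral_set0 ?mule0//.
    by rewrite bnd_simp -leNgt.
  rewrite -GammaE ?addr_gt0// -integral_causal muleC -ge0_integralZl//.
  - by apply: eq_integral => s _; rewrite muleC.
  - exact: mgm.
  - by move=> s _; exact: gm0.
move: H; rewrite (integral_econv (mgm al) (mgm be) (gm0 al) (gm0 be)) /gm !integral_causal !GammaE// => H.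
have : B \is a fin_num.
  rewrite ge0_fin_numE// ltey; apply/eqP => BE; move: H.
  by rewrite BE mulry gtr0_sg// mul1e -EFinM.
move=> /fineK BE; move: H; rewrite -BE -!EFinM => -[->].
congr EFin; rewrite mulrC; congr (_ * _).
by rewrite mulrC mulKf// gt_eqF.
Qed.

End Beta.

(** * Volterra integrals and Mittag-Leffler functions *)

Section RealIntegrable.
Context {R : realType}.
Local Notation mu := (@lebesgue_measure R).
Variable D : set R.
Hypothesis mD : measurable D.
Implicit Types f g : R -> R.

Lemma rintegrableD f g : mu.-integrable D (EFin \o f) ->
  mu.-integrable D (EFin \o g) -> mu.-integrable D (EFin \o (fun x => f x + g x)).
Proof. by move=> fi gi; exact: (integrableD _ fi gi). Qed.

Lemma rintegrableB f g : mu.-integrable D (EFin \o f) ->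
  mu.-integrable D (EFin \o g) -> mu.-integrable D (EFin \o (fun x => f x - g x)).
Proof. by move=> fi gi; exact: (integrableB _ fi gi). Qed.

Lemma rintegrableZ (c : R) f : mu.-integrable D (EFin \o f) ->
  mu.-integrable D (EFin \o (fun x => c * f x)).
Proof. by move=> fi; exact: (integrableZl _ c fi). Qed.

Lemma rintegrable_norm f : mu.-integrable D (EFin \o f) ->
  mu.-integrable D (EFin \o (fun x => `|f x|)).
Proof. by move=> fi; exact: (integrable_norm fi). Qed.

Lemma rintegrable_le f g : measurable_fun D f ->
  mu.-integrable D (EFin \o g) -> (forall x, D x -> `|f x| <= g x) ->
  mu.-integrable D (EFin \o f).
Proof.
move=> mf gi fg; apply: le_integrable gi => //; first exact/measurable_EFinP.
by move=> x Dx; rewrite lee_fin; apply: (le_trans (fg _ Dx)); exact: ler_norm.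
Qed.

End RealIntegrable.

Section Volterra.
Context {R : realType}.
Local Notation mu := (@lebesgue_measure R).
Implicit Types g h : R -> R.

Lemma measurable_volterra g h (t : R) (D : set R) :
  measurable_fun [set: R] g -> measurable_fun [set: R] h ->
  measurable_fun D (fun s : R => g (t - s) * h s).
Proof.
move=> mg mh; apply: measurable_funTS; apply: measurable_funM => //.
by apply: measurableT_comp => //; exact: measurable_funB.
Qed.

Lemma volterra_econv g h (t : R) :
  measurable_fun [set: R] g -> measurable_fun [set: R] h ->
  (\int[mu]_(s in `[0%R, t]) (g (t - s) * h s)%:E =
   econv (causal g) (causal h) t)%E.
Proof.
move=> mg mh; rewrite econv_causal.
rewrite -integral_itv_obnd_cbnd; last first.
  by apply/measurable_EFinP; exact: measurable_volterra.
rewrite -integral_itv_bndo_bndc//.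
by apply/measurable_EFinP; exact: measurable_volterra.
Qed.

Lemma volterra_integrable g h (t : R) :
  measurable_fun [set: R] g -> measurable_fun [set: R] h ->
  (forall s, 0 <= s -> 0 <= g s) -> (forall s, 0 <= s -> 0 <= h s) ->
  (econv (causal g) (causal h) t < +oo)%E ->
  mu.-integrable `[0, t] (EFin \o (fun s => g (t - s) * h s)).
Proof.
move=> mg mh g0 h0 fin; apply/integrableP; split.
  by apply/measurable_EFinP; exact: measurable_volterra.
apply: le_lt_trans fin; rewrite -volterra_econv//.
rewrite (@eq_integral _ _ _ mu _ (fun s => (g (t - s) * h s)%:E))//.
move=> s; rewrite inE/= in_itv/= => /andP[s0 st].
by rewrite ger0_norm// mulr_ge0 ?g0 ?h0// subr_ge0.
Qed.

Lemma volterra_Rintegral g h (t : R) :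
  measurable_fun [set: R] g -> measurable_fun [set: R] h ->
  \int[mu]_(s in `[0, t]) (g (t - s) * h s) =
  fine (econv (causal g) (causal h) t).
Proof. by move=> mg mh; rewrite -volterra_econv. Qed.

Lemma integrable_volterra_powR (al be t : R) : 0 < al -> 0 < be -> 0 < t ->
  mu.-integrable `[0, t]
    (EFin \o (fun s => (t - s) `^ (al - 1) * s `^ (be - 1))).
Proof.
move=> al0 be0 t0.
apply: (@volterra_integrable (fun s => s `^ (al - 1)) (fun s => s `^ (be - 1))).
- exact: measurable_powR.
- exact: measurable_powR.
- by move=> s _; exact: powR_ge0.
- by move=> s _; exact: powR_ge0.
- by rewrite econv_powR// ltry.
Qed.

Lemma volterra_powR (al be t : R) : 0 < al -> 0 < be -> 0 < t ->
  \int[mu]_(s in `[0, t]) ((t - s) `^ (al - 1) * s `^ (be - 1)) =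
  Gamma al * Gamma be / Gamma (al + be) * t `^ (al + be - 1).
Proof.
move=> al0 be0 t0.
rewrite (@volterra_Rintegral (fun s => s `^ (al - 1)) (fun s => s `^ (be - 1))).
- by rewrite econv_powR.
- exact: measurable_powR.
- exact: measurable_powR.
Qed.

Lemma integrable_itv0c (t : R) h :
  mu.-integrable `[0, t] (EFin \o h) -> mu.-integrable `]0, t] (EFin \o h).
Proof.
by apply: integrableS => //; apply: subset_itvr; rewrite bnd_simp.
Qed.

Lemma le_Rintegral_itv0c (t : R) g h :
  mu.-integrable `[0, t] (EFin \o g) -> mu.-integrable `[0, t] (EFin \o h) ->
  (forall s, 0 < s <= t -> g s <= h s) ->
  \int[mu]_(s in `[0, t]) g s <= \int[mu]_(s in `[0, t]) h s.
Proof.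
move=> ig ih gh; have ig' := integrable_itv0c ig; have ih' := integrable_itv0c ih.
rewrite -(Rintegral_itv_obnd_cbnd ig') -(Rintegral_itv_obnd_cbnd ih').
by apply: le_Rintegral => // s; rewrite /= in_itv/= => /gh.
Qed.

End Volterra.

Section GeometricTail.
Context {R : realType}.

Lemma geometric_tail (u : R^nat) (C : R) :
  (forall k, `|u k| <= C * 2^-1 ^+ k) ->
  cvgn (series u) /\ forall n, `|limn (series u) - series u n| <= 2 * C * 2^-1 ^+ n.
Proof.
move=> uC.
have C0 : 0 <= C by have := uC 0%N; rewrite expr0 mulr1; apply: le_trans.
have dist n m : (n <= m)%N -> `|series u m - series u n| <= 2 * C * 2^-1 ^+ n.
  move=> nm; rewrite sub_series_geq//.
  apply: (le_trans (ler_norm_sum _ _ _)).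
  apply: (@le_trans _ _ (2 * C * (2^-1 ^+ n - 2^-1 ^+ m))); last first.
    by rewrite ler_wpM2l ?mulr_ge0// lerBlDr lerDl exprn_ge0.
  rewrite -(subnKC nm); elim: (m - n)%N => [|k ih].
    by rewrite addn0 big_geq// subrr mulr0.
  rewrite addnS big_nat_recr ?leq_addr//=.
  apply: (le_trans (lerD ih (uC _))).
  by rewrite exprS; lra.
have cu : cvgn (series u).
  apply: normed_cvg; apply: (@series_le_cvg _ _ (fun k => C * 2^-1 ^+ k)).
  - by move=> k; exact: normr_ge0.
  - by move=> k; rewrite mulr_ge0// exprn_ge0.
  - exact: uC.
  - by apply: is_cvg_geometric_series; rewrite ger0_norm; lra.
split => // n.
have cv : `|series u m - series u n| @[m --> \oo] --> `|limn (series u) - series u n|.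
  by apply: cvg_norm; apply: cvgB => //; exact: cvg_cst.
rewrite -(cvg_lim _ cv)//; apply: limr_le; first by apply/cvg_ex; eexists; exact: cv.
by exists n => // m /= nm; exact: dist.
Qed.

End GeometricTail.

Section MittagLeffler.
Context {R : realType}.
Local Notation mu := (@lebesgue_measure R).
Variable rho : R.
Hypothesis rho0 : 0 < rho.
Local Notation E := (mittag_leffler rho).

Definition ml_term (m z : R) (k : nat) : R := z ^+ k / Gamma (rho * k%:R + m).

Let pos_arg m k : 0 < m -> 0 < rho * k%:R + m.
Proof. by move=> m0; rewrite ltr_wpDl// mulr_ge0// ltW. Qed.

(** [Gamma_lower] with A^rho = 2 Z, for Z >= 1. *)
Lemma ml_term_bound (m Z : R) : 0 < m -> exists C, forall z, `|z| <= Z -> forall k,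
  `|ml_term m z k| <= C * 2^-1 ^+ k.
Proof.
move=> m0; pose Y := Num.max Z 1; have Y0 : 0 < Y by rewrite lt_max ltr01 orbT.
pose A := (2 * Y) `^ rho^-1.
have A0 : 0 < A by rewrite powR_gt0// mulr_gt0.
have Arho : A `^ rho = 2 * Y.
  by rewrite -powRrM mulVf ?gt_eqF// powRr1// mulr_ge0// ltW.
have A10 : 0 < A + 1 by exact: addr_gt0.
pose c := A `^ m / (A + 1) * expR (- (A + 1)).
have c0 : 0 < c.
  rewrite /c; apply: mulr_gt0; last exact: expR_gt0.
  by apply: divr_gt0 => //; exact: powR_gt0.
exists c^-1 => z zZ k.
rewrite /ml_term normrM normrX normfV (gtr0_norm (Gamma_gt0 (pos_arg k m0))).
rewrite ler_pdivrMr ?Gamma_gt0 ?pos_arg//.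
rewrite -mulrA ler_pdivlMl// mulrC.
apply: (@le_trans _ _ (2^-1 ^+ k * ((2 * Y) ^+ k * c))); last first.
  rewrite ler_wpM2l ?exprn_ge0//; apply: le_trans (Gamma_lower (ltW A0) (pos_arg k m0)).
  rewrite powRD; last by rewrite (gt_eqF A0) implybT.
  by rewrite powRrM Arho powR_mulrn ?mulr_ge0 ?(ltW Y0)// /c !mulrA.
have -> : 2^-1 ^+ k * ((2 * Y) ^+ k * c) = Y ^+ k * c.
  by rewrite mulrA -exprMn; congr (_ ^+ _ * _); field.
rewrite ler_wpM2r ?(ltW c0)//.
by rewrite lerXn2r ?nnegrE// ?(ltW Y0)// (le_trans zZ)// le_max lexx.
Qed.

Lemma ml_cvg (m z : R) : 0 < m -> series (ml_term m z) @ \oo --> E m z.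
Proof.
move=> m0; have [C HC] := ml_term_bound `|z| m0.
by have [] := geometric_tail (HC z (lexx _)).
Qed.

Lemma ml_unif (m Z : R) : 0 < m -> exists C, forall z, `|z| <= Z -> forall n,
  `|E m z - series (ml_term m z) n| <= C * 2^-1 ^+ n.
Proof.
move=> m0; have [C HC] := ml_term_bound Z m0; exists (2 * C) => z zZ n.
by have [_] := geometric_tail (HC z zZ); exact.
Qed.

Lemma cvg_geometric_half (C : R) : C * 2^-1 ^+ n @[n --> \oo] --> (0 : R).
Proof. by apply: cvg_geometric; rewrite ger0_norm; lra. Qed.

Lemma continuous_ml (m : R) : 0 < m -> continuous (E m).
Proof.
move=> m0 z; have [C HC] := ml_unif (`|z| + 1) m0.
apply/cvgrPdist_lt => e e0.
have e3 : 0 < e / 3 by lra.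
have [n Hn] : exists n, C * 2^-1 ^+ n < e / 3.
  have /cvgrPdist_lt /(_ _ e3) [n _ /(_ n (leqnn n))] := cvg_geometric_half C.
  by rewrite sub0r normrN => /ltr_normlW ?; exists n.
have cS : {for z, continuous (fun z => series (ml_term m z) n)}.
  rewrite /series/=; apply: cvg_big => [|k _]; first exact: add_continuous.
  by apply: cvgM; [exact: exprn_continuous|exact: cvg_cst].
move/cvgrPdist_lt : cS => /(_ _ e3) cS.
near=> y.
have hy : `|y| <= `|z| + 1.
  rewrite -[y](subrK z) (le_trans (ler_normD _ _))// addrC lerD2l.
  rewrite distrC ltW//; near: y; exact: cvgr_dist_lt.
have hz : `|z| <= `|z| + 1 by rewrite lerDl.
have h1 := le_lt_trans (HC _ hy n) Hn.
have h2 := le_lt_trans (HC _ hz n) Hn.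
have h3 : `|series (ml_term m z) n - series (ml_term m y) n| < e / 3 by near: y.
move: h1 h2 h3; rewrite !ltr_norml => /andP[? ?] /andP[? ?] /andP[? ?].
by apply/andP; split; lra.
Unshelve. all: by end_near. Qed.

Lemma ml_rec (m z : R) : 0 < m -> E m z = (Gamma m)^-1 + z * E (m + rho) z.
Proof.
move=> m0; have mr0 : 0 < m + rho by exact: addr_gt0.
have h1 := @ml_cvg m z m0.
have h2 : (Gamma m)^-1 + z * series (ml_term (m + rho) z) n @[n --> \oo] -->
    (Gamma m)^-1 + z * E (m + rho) z.
  apply: cvgD; first exact: cvg_cst.
  by apply: cvgM; [exact: cvg_cst|exact: ml_cvg].
rewrite -(cvg_lim _ h2)//.
move: h1; rewrite -(cvg_shiftn 1) => h1; rewrite -(cvg_lim _ h1)//.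
congr (lim (_ @ \oo)); apply/funext => n /=; rewrite addn1.
rewrite /series/= big_nat_recl//= mulr_sumr; congr (_ + _).
  by rewrite /ml_term expr0 mulr0 add0r div1r.
apply: eq_bigr => k _; rewrite /ml_term exprS -!mulrA; congr (_ * (_ * _^-1)).
by congr Gamma; rewrite -natr1; ring.
Qed.

Lemma ml0 (m : R) : 0 < m -> E m 0 = (Gamma m)^-1.
Proof. by move=> m0; rewrite ml_rec// mul0r addr0. Qed.

(** [ml_kernel m l] is the inverse Laplace transform of
    x ^ (rho - m) / (x ^ rho + l). *)
Definition ml_kernel (m l t : R) : R := t `^ (m - 1) * E m (- l * t `^ rho).

Lemma measurable_ml_kernel (m l : R) : 0 < m ->
  measurable_fun [set: R] (ml_kernel m l).
Proof.
move=> m0; apply: measurable_funM; first exact: measurable_powR.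
apply: (measurableT_comp (f := E m)).
  by apply: continuous_measurable_fun; exact: continuous_ml.
by apply: measurable_funM => //; exact: measurable_powR.
Qed.

(** Term by term this is the Beta integral; the geometric bound on the tails,
    uniform on [0, t], lets the sum pass through the integral. *)
Lemma ml_kernel_conv (al m l t : R) : 0 < al -> 0 < m -> 0 < t ->
  mu.-integrable `[0, t] (EFin \o (fun s => (t - s) `^ (al - 1) * ml_kernel m l s))
  /\ frac_integral al (ml_kernel m l) t = ml_kernel (al + m) l t.
Proof.
move=> al0 m0 t0; have am0 : 0 < al + m by exact: addr_gt0.
pose c m' k := (- l) ^+ k / Gamma (rho * k%:R + m').
pose P n s := \sum_(0 <= k < n) c m k * s `^ (rho * k%:R + m - 1).
have pwS m' k s : 0 < s ->
    c m' k * s `^ (rho * k%:R + m' - 1) = s `^ (m' - 1) * ml_term m' (- l * s `^ rho) k.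
  move=> s0; rewrite /ml_term exprMn /c -(powR_mulrn _ (powR_ge0 _ _)) -powRrM.
  rewrite -addrA (@powRD _ s (rho * k%:R)); last by rewrite (gt_eqF s0) implybT.
  by ring.
have PE n s : 0 < s -> P n s = s `^ (m - 1) * series (ml_term m (- l * s `^ rho)) n.
  by move=> s0; rewrite /series/= mulr_sumr; apply: eq_bigr => k _; exact: pwS.
have Pn n : mu.-integrable `[0, t] (EFin \o (fun s => (t - s) `^ (al - 1) * P n s))
    /\ frac_integral al (P n) t =
       t `^ (al + m - 1) * series (ml_term (al + m) (- l * t `^ rho)) n.
  rewrite /frac_integral; elim: n => [|n [ih1 ih2]].
    have P0 s : (t - s) `^ (al - 1) * P 0%N s = 0 by rewrite /P big_geq// mulr0.
    split.
      apply: (@eq_integrable _ _ _ _ _ _ (cst 0)%E) => //.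
        by move=> s _ /=; rewrite P0.
      exact: integrable0.
    under eq_Rintegral do rewrite P0.
    by rewrite Rintegral_cst//= mul0r mulr0 /series/= big_geq// mulr0.
  pose Q s := c m n * ((t - s) `^ (al - 1) * s `^ (rho * n%:R + m - 1)).
  have PS : (fun s => (t - s) `^ (al - 1) * P n.+1 s) =
      (fun s => (t - s) `^ (al - 1) * P n s + Q s).
    by apply/funext => s; rewrite /P big_nat_recr//= mulrDr; congr (_ + _); rewrite /Q; ring.
  have iQ0 := integrable_volterra_powR al0 (pos_arg n m0) t0.
  have iQ : mu.-integrable `[0, t] (EFin \o Q) by exact: (integrableZl _ (c m n) iQ0).
  split; first by rewrite PS; exact: (integrableD _ ih1 iQ).
  rewrite PS RintegralD// mulrDr ih2 RintegralZl//.
  rewrite volterra_powR ?pos_arg// /series/= big_nat_recr//= mulrDr; congr (_ + _).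
  rewrite -pwS// /c.
  have -> : al + (rho * n%:R + m) = rho * n%:R + (al + m) by ring.
  have g1 := Gamma_gt0 al0; have g2 := Gamma_gt0 (pos_arg n m0).
  have g3 := Gamma_gt0 (pos_arg n am0).
  move: g1 g2 g3; move: (Gamma al) (Gamma (_ + m)) (Gamma _) ((- l) ^+ n) (t `^ _).
  by move=> G1 G2 G3 u v *; field; rewrite !gt_eqF.
have [C HC] := ml_unif (`|l| * t `^ rho) m0.
have zb s : 0 <= s <= t -> `|- l * s `^ rho| <= `|l| * t `^ rho.
  move=> /andP[s0 st]; rewrite normrM normrN ler_wpM2l// ger0_norm ?powR_ge0//.
  by apply: ge0_ler_powR; rewrite ?nnegrE// ltW.
have ipw := integrable_volterra_powR al0 m0 t0.
have iK : mu.-integrable `[0, t]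
    (EFin \o (fun s => (t - s) `^ (al - 1) * ml_kernel m l s)).
  have iC : mu.-integrable `[0, t]
      (EFin \o (fun s => C * ((t - s) `^ (al - 1) * s `^ (m - 1)))).
    exact: (integrableZl _ C ipw).
  apply: le_integrable iC => //.
    apply/measurable_EFinP; apply: (measurable_volterra (g := fun s => s `^ (al - 1))).
      exact: measurable_powR.
    exact: measurable_ml_kernel.
  move=> s; rewrite /= in_itv/= => st; rewrite lee_fin /ml_kernel.
  apply: le_trans (ler_norm _).
  rewrite !normrM !(ger0_norm (powR_ge0 _ _)) mulrA mulrC.
  rewrite ler_wpM2r ?mulr_ge0 ?powR_ge0//.
  by have := HC _ (zb _ st) 0%N; rewrite /series/= big_geq// subr0 expr0 mulr1.
split => //.
have cv1 : t `^ (al + m - 1) * series (ml_term (al + m) (- l * t `^ rho)) n @[n --> \oo]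
    --> ml_kernel (al + m) l t.
  by apply: cvgM; [exact: cvg_cst|exact: ml_cvg].
rewrite -(cvg_lim _ cv1)//; apply/esym/cvg_lim => //.
pose D := (Gamma al)^-1 * \int[mu]_(s in `[0, t]) ((t - s) `^ (al - 1) * s `^ (m - 1)).
apply/cvgrPdist_le => e e0.
have := cvg_geometric_half (C * D).
move/cvgrPdist_le => /(_ _ e0); apply: filterS => n.
rewrite sub0r normrN => /(le_trans (ler_norm _)); apply: le_trans.
have [iPn <-] := Pn n.
rewrite /frac_integral -mulrBr -RintegralB// normrM gtr0_norm ?invr_gt0 ?Gamma_gt0//.
pose Y s := C * 2^-1 ^+ n * ((t - s) `^ (al - 1) * s `^ (m - 1)).
have iY : mu.-integrable `[0, t] (EFin \o Y) by exact: (integrableZl _ _ ipw).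
have -> : C * D * 2^-1 ^+ n = (Gamma al)^-1 * \int[mu]_(s in `[0, t]) Y s.
  by rewrite RintegralZl// /D; ring.
rewrite ler_wpM2l ?invr_ge0 ?(ltW (Gamma_gt0 _))//.
have iB := rintegrableB (measurable_itv _) iK iPn.
apply: (le_trans (le_normr_Rintegral _ iB)) => //=.
apply: le_Rintegral_itv0c => //; first exact: rintegrable_norm iB.
move=> s /andP[s0 st].
rewrite -mulrBr normrM (ger0_norm (powR_ge0 _ _)) /Y mulrCA ler_wpM2l ?powR_ge0//.
rewrite /ml_kernel PE// -mulrBr normrM (ger0_norm (powR_ge0 _ _)) mulrC.
by rewrite ler_wpM2r ?powR_ge0// HC// zb// (ltW s0).
Qed.

End MittagLeffler.

(** * Positivity of the Mittag-Leffler kernel *)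


Section VolterraMore.
Local Opaque mittag_leffler Gamma powR integral.
Context {R : realType}.
Local Notation mu := (@lebesgue_measure R).
Implicit Types g h : R -> R.

Lemma le_Rintegral_itv0 (t : R) g h :
  mu.-integrable `[0, t] (EFin \o g) -> mu.-integrable `[0, t] (EFin \o h) ->
  (forall s, 0 < s < t -> g s <= h s) ->
  \int[mu]_(s in `[0, t]) g s <= \int[mu]_(s in `[0, t]) h s.
Proof.
move=> ig ih gh; have ig' := integrable_itv0c ig; have ih' := integrable_itv0c ih.
rewrite -(Rintegral_itv_obnd_cbnd ig') -(Rintegral_itv_obnd_cbnd ih').
have sub : (`]0, t[%classic : set R) `<=` `]0, t]%classic.
  by apply: subset_itvl; rewrite bnd_simp.
have ig2 : mu.-integrable `]0, t[ (EFin \o g) by exact: integrableS ig'.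
have ih2 : mu.-integrable `]0, t[ (EFin \o h) by exact: integrableS ih'.
rewrite -(Rintegral_itv_bndo_bndc ig2) -(Rintegral_itv_bndo_bndc ih2).
by apply: le_Rintegral => // s; rewrite /= in_itv/= => /gh.
Qed.

Lemma continuous_powR (p x : R) : 0 < x -> {for x, continuous (fun t : R => t `^ p)}.
Proof.
move=> x0; apply: differentiable_continuous; apply/derivable1_diffP.
by apply: derivable_powR; rewrite in_itv/= andbT.
Qed.

Lemma le_powR_neg (p x y : R) : p <= 0 -> 0 < x -> x <= y -> y `^ p <= x `^ p.
Proof.
move=> p0 x0 xy; have y0 := lt_le_trans x0 xy.
rewrite -[p]opprK !(powRN _ (- p)) lef_pV2 ?posrE ?powR_gt0//.
by apply: ge0_ler_powR; rewrite ?nnegrE ?oppr_ge0// ltW.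
Qed.

Lemma Rintegral_powR0 (al d : R) : 0 < al -> 0 < d ->
  \int[mu]_(r in `[0, d]) (r `^ (al - 1)) = Gamma al / Gamma (al + 1) * d `^ al.
Proof.
move=> al0 d0.
have := @volterra_powR R 1 al d ltr01 al0 d0.
under eq_Rintegral do rewrite subrr powRr0 mul1r.
by rewrite Gamma1 mul1r (addrC 1) addrK.
Qed.

Lemma Rintegral_powR_end (al t t0 : R) : 0 < al -> 0 <= t < t0 ->
  \int[mu]_(s in `]t, t0]) ((t0 - s) `^ (al - 1)) =
  Gamma al / Gamma (al + 1) * (t0 - t) `^ al.
Proof.
move=> al0 /andP[tge0 tt0].
have d0 : 0 < t0 - t by lra.
rewrite -(Rintegral_powR0 al0 d0).
have ip : mu.-integrable `[0, t0 - t] (EFin \o (fun r => r `^ (al - 1))).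
  by apply: integrable_powR_itv => //; lra.
have ip' : mu.-integrable `[0, t0 - t[ (EFin \o (fun r => r `^ (al - 1))).
  by apply: integrableS ip => //; apply: subset_itvl; rewrite bnd_simp.
rewrite -(Rintegral_itv_bndo_bndc ip').
rewrite [LHS]Rintegral_mkcond [RHS]Rintegral_mkcond -[RHS](Rintegral_reflect t0).
  apply: eq_Rintegral => s _; rewrite !patchE !mem_setE !in_itv/= subr_ge0.
  rewrite ltrD2l ltrN2.
  by rewrite andbC.
apply/(measurable_restrictT _ _).1; first exact: measurable_itv.
by apply: measurable_funTS; exact: measurable_powR.
Qed.

End VolterraMore.

Section Resolvent.
Local Opaque mittag_leffler Gamma powR integral.
Context {R : realType}.
Local Notation mu := (@lebesgue_measure R).
Variable rho : R.
Hypothesis rho01 : 0 < rho < 1.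
Let rho0 : 0 < rho. Proof. by case/andP: rho01. Qed.
Let rho1 : rho < 1. Proof. by case/andP: rho01. Qed.
Local Notation E := (mittag_leffler rho).
Local Notation kern := (ml_kernel rho rho).

(** The recursion [ml_rec] multiplied by t^(rho-1): by [ml_kernel_conv] its
    second term is a fractional integral of the kernel. *)
Lemma resolvent_eq (l t : R) : 0 < t ->
  kern l t = t `^ (rho - 1) / Gamma rho - l * frac_integral rho (kern l) t.
Proof.
move=> t0; have [_ ->] := ml_kernel_conv rho0 l rho0 rho0 t0.
rewrite /ml_kernel (ml_rec rho0 _ rho0).
have -> : rho + rho - 1 = rho + (rho - 1) by lra.
rewrite (@powRD _ t rho (rho - 1)); last by rewrite (gt_eqF t0) implybT.
by ring.
Qed.

Lemma continuous_ml_kernel (m l t : R) : 0 < m -> 0 < t ->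
  {for t, continuous (ml_kernel rho m l)}.
Proof.
move=> m0 t0; apply: cvgM; first exact: continuous_powR.
apply: (@cvg_comp _ _ _ (fun s : R => - l * s `^ rho) (E m)); last first.
  exact: continuous_ml.
apply: cvgM; first exact: cvg_cst.
exact: continuous_powR.
Qed.

(** E_{rho,m} is continuous and equals 1 / Gamma m > 0 at 0. *)
Lemma ml_kernel_pos_near0 (m l : R) : 0 < m ->
  exists2 d, 0 < d & forall t, 0 < t < d -> 0 < ml_kernel rho m l t.
Proof.
move=> m0.
have E0 : 0 < E m 0 by rewrite ml0// invr_gt0 Gamma_gt0.
have := cvgr_gt _ (continuous_ml rho0 m0 (x := 0)) _ E0.
move=> [e /= e0 He].
pose c := `|l| + 1; have c0 : 0 < c by rewrite ltr_wpDl.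
exists ((e / c) `^ rho^-1); first by rewrite powR_gt0// divr_gt0.
move=> t /andP[t0 td]; rewrite mulr_gt0 ?powR_gt0//; apply: He => /=.
rewrite sub0r normrN normrM normrN (ger0_norm (powR_ge0 _ _)).
apply: (@le_lt_trans _ _ (c * t `^ rho)).
  by rewrite ler_wpM2r ?powR_ge0// /c lerDl.
rewrite -ltr_pdivlMl// mulrC.
have <- : ((e / c) `^ rho^-1) `^ rho = e / c.
  by rewrite -powRrM mulVf ?gt_eqF// powRr1// divr_ge0 ?ltW.
  apply: gt0_ltr_powR; rewrite ?nnegrE ?powR_ge0 ?(ltW t0)//.
Qed.

Let G := Gamma rho.
Let G0 : 0 < G. Proof. exact: Gamma_gt0. Qed.

(** At a first zero [t0] the equation would express [kern 1 t0] through earlier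
    values; since the Abel kernel is log-convex, the history up to a time [t1]
    weighs at [t0] at most [c] times what it weighs at [t1], and what happens
    after [t1] is small when [t1] maximises the kernel on a short interval
    ending at [t0]. *)
Lemma kern1_no_first_zero (t0 : R) : 0 < t0 ->
  (forall s, 0 < s < t0 -> 0 < kern 1 s) -> 0 < kern 1 t0.
Proof.
move=> t0p pos; rewrite ltNge; apply/negP => kt0.
have G1 : 0 < Gamma (rho + 1) by rewrite Gamma_gt0// addr_gt0.
(* over a time dl the Abel kernel has mass at most a quarter *)
pose q := Gamma (rho + 1) / 4; have q0 : 0 < q by rewrite divr_gt0.
pose dl := Num.min (t0 / 2) (q `^ rho^-1).
have dl0 : 0 < dl by rewrite lt_min powR_gt0// andbT; lra.
have dlt : dl <= t0 / 2 by rewrite ge_min lexx.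
have dlq : dl `^ rho <= Gamma (rho + 1) / 4.
  rewrite -/q.
  have qE : (q `^ rho^-1) `^ rho = q by rewrite -powRrM mulVf ?gt_eqF// powRr1// ltW.
  rewrite -[leRHS]qE; apply: ge0_ler_powR; rewrite ?nnegrE ?powR_ge0 ?(ltW rho0) ?(ltW dl0)//.
  by rewrite ge_min lexx orbT.
clearbody q dl.
have ab : t0 - dl <= t0 by lra.
have cw : {within `[t0 - dl, t0], continuous (kern 1)}.
  apply: continuous_in_subspaceT => s; rewrite inE/= in_itv/= => /andP[s1 _].
  by apply: continuous_ml_kernel => //; lra.
have [t1 + t1max] := EVT_max ab cw.
rewrite in_itv/= => /andP[t1l t1r].
have kt1 : 0 < kern 1 t1.
  apply: (@lt_le_trans _ _ (kern 1 (t0 - dl))); first by apply: pos; lra.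
  by apply: t1max; rewrite in_itv/=; lra.
have t1t0 : t1 < t0.
  rewrite lt_neqAle t1r andbT; apply/eqP => t1E; move: kt1.
  by rewrite t1E ltNge kt0.
have t10 : 0 < t1 by lra.
pose I s := \int[mu]_(r in `[0, s]) ((s - r) `^ (rho - 1) * kern 1 r).
have kI s : 0 < s -> kern 1 s * G = s `^ (rho - 1) - I s.
  move=> s0; rewrite {1}resolvent_eq// /frac_integral -/G -/(I s).
  by field; rewrite gt_eqF.
have int1 s : 0 < s -> mu.-integrable `[0, s]
    (EFin \o (fun r => (s - r) `^ (rho - 1) * kern 1 r)).
  by move=> s0; have [] := ml_kernel_conv rho0 1 rho0 rho0 s0.
pose c := (t0 / t1) `^ (rho - 1).
(* t1 is at least t0 / 2 and the exponent is above -1 *)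
have c2 : 1 / 2 <= c.
  have h1 : 1 <= t0 / t1 by rewrite ler_pdivlMr// mul1r.
  apply: (@le_trans _ _ ((t0 / t1) `^ (-1))); last by apply: ler_powR => //; move: rho0; rewrite lerBrDr addNr => /ltW.
  rewrite powR_inv1; last by lra.
  by rewrite invf_div ler_pdivlMr//; lra.
have i0 := int1 t0 t0p.
have sub1 : (`[0, t1]%classic : set R) `<=` `[0, t0]%classic.
  by apply: subset_itvl; rewrite bnd_simp.
have i01 : mu.-integrable `[0, t1] (EFin \o (fun r => (t0 - r) `^ (rho - 1) * kern 1 r)).
  exact: integrableS i0.
(* the history up to t1 and the history after it *)
have IE : I t0 = \int[mu]_(r in `[0, t1]) ((t0 - r) `^ (rho - 1) * kern 1 r) +
    \int[mu]_(r in `]t1, t0]) ((t0 - r) `^ (rho - 1) * kern 1 r).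
  have e := @Rintegral_itvB _ _ _ _ t1 i0.
  by rewrite -e ?bnd_simp ?(ltW t10)// -/(I t0); lra.
have ct : c * t1 `^ (rho - 1) = t0 `^ (rho - 1).
  by rewrite /c -powRM ?divfK ?gt_eqF// ?divr_ge0 ?ltW.
have B1 : \int[mu]_(r in `[0, t1]) ((t0 - r) `^ (rho - 1) * kern 1 r) <= c * I t1.
  rewrite /I -RintegralZl//; last exact: int1.
  apply: le_Rintegral_itv0 => //; first exact: (rintegrableZ _ _ (int1 _ t10)).
  move=> r /andP[r0 rt1].
  have kr : 0 <= kern 1 r by apply/ltW/pos; rewrite r0 (lt_trans rt1).
  rewrite mulrA ler_wpM2r//.
  rewrite /c -powRM; [|by rewrite divr_ge0 ?ltW|by rewrite subr_ge0 ltW].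
  apply: le_powR_neg; first by rewrite subr_le0 ltW.
    by rewrite mulr_gt0 ?divr_gt0// subr_gt0.
  rewrite mulrBr divfK ?gt_eqF// lerD2l lerN2 ler_peMl ?ltW//.
  by rewrite ltr_pdivlMr// mul1r.
have B2 : \int[mu]_(r in `]t1, t0]) ((t0 - r) `^ (rho - 1) * kern 1 r) <=
    kern 1 t1 * (G / Gamma (rho + 1) * (t0 - t1) `^ rho).
  rewrite -Rintegral_powR_end ?(ltW t10)//.
  have ip : mu.-integrable `]t1, t0] (EFin \o (fun r => (t0 - r) `^ (rho - 1))).
    have ip0 := integrable_volterra_powR rho0 (@ltr01 R) t0p.
    apply: (@eq_integrable _ _ _ _ _ _ _ _ _ (integrableS _ _ _ ip0)) => //.
      by move=> r _ /=; rewrite subrr powRr0 mulr1.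
    by apply: subset_itvr; rewrite bnd_simp ltW.
  rewrite -RintegralZl//; apply: le_Rintegral => //.
  - by apply: integrableS i0 => //; apply: subset_itvr; rewrite bnd_simp ltW.
  - exact: rintegrableZ.
  - move=> r; rewrite /= in_itv/= => /andP[r1 r2].
    rewrite mulrC ler_wpM2r ?powR_ge0// t1max// in_itv/= r2 andbT.
    by rewrite (le_trans t1l)// ltW.
have : 0 < kern 1 t0 * G.
  rewrite kI// IE; set A := Rintegral _ _ _ in B1 *; set B := Rintegral _ _ _ in B2 *.
  clearbody A B I c.
  have := kI _ t10; move KE : (kern 1 t1 * G) => K KI.
  have K0 : 0 < K by rewrite -KE; exact: mulr_gt0.
  have IK : I t1 = t1 `^ (rho - 1) - K by lra.
  have wq : (t0 - t1) `^ rho / Gamma (rho + 1) <= 1 / 4.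
    rewrite ler_pdivrMr// mul1r mulrC; apply: le_trans dlq.
    by apply: ge0_ler_powR; rewrite ?nnegrE ?(ltW rho0) ?(ltW dl0)//; lra.
  have B3 : kern 1 t1 * (G / Gamma (rho + 1) * (t0 - t1) `^ rho) <= K * (1 / 4).
    rewrite (_ : _ * (_ * _) = K * ((t0 - t1) `^ rho / Gamma (rho + 1))).
      by rewrite ler_wpM2l// ltW.
    by rewrite -KE; ring.
  have cK : 1 / 2 * K <= c * K by rewrite ler_wpM2r// ltW.
  rewrite IK mulrBr ct in B1.
  lra.
by rewrite pmulr_lgt0// ltNge kt0.
Qed.

(** Otherwise the infimum of the times where the kernel is not positive is a
    first zero; it is not 0 because the kernel is positive near 0. *)
Lemma kern1_gt0 (t : R) : 0 < t -> 0 < kern 1 t.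
Proof.
move=> tp; rewrite ltNge; apply/negP => kt.
pose S := [set s : R | 0 < s /\ kern 1 s <= 0].
have St : S t by [].
have [d d0 Hd] := ml_kernel_pos_near0 1 rho0.
have lbS : lbound S d.
  by move=> s [s0 ks]; rewrite leNgt; apply/negP => sd; move: ks; rewrite leNgt Hd// s0 sd.
have hlS : has_lbound S by exists d.
pose t0 := inf S.
have dt0 : d <= t0 by apply: lb_le_inf => //; exists t.
have t0p : 0 < t0 by exact: lt_le_trans dt0.
have pos s : 0 < s < t0 -> 0 < kern 1 s.
  move=> /andP[s0 st0]; rewrite ltNge; apply/negP => ks.
  by have := ge_inf hlS (conj s0 ks : S s); rewrite leNgt st0.
have kt0 := kern1_no_first_zero t0p pos.
have := cvgr_gt _ (continuous_ml_kernel (l := 1) rho0 t0p) _ kt0.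
move=> [e /= e0 He].
have [s [s0 ks] se] := inf_adherent e0 (conj (ex_intro _ t St) hlS : has_inf S).
have st0 : t0 <= s by exact: (ge_inf hlS (conj s0 ks : S s)).
have : 0 < kern 1 s.
  by apply: He; rewrite /= ler0_norm ?subr_le0// opprB ltrBlDl.
by rewrite ltNge ks.
Qed.

End Resolvent.

(** * Monotonicity and decay in the spectral parameter *)

Lemma powR_le1 (R : realType) (s r : R) : 0 < r -> 0 <= s <= 1 -> s `^ r <= 1.
Proof.
move=> r0 /andP[s0 s1]; have <- := congr1 (fun f => f r) (powR1 R).
by apply: ge0_ler_powR s1; rewrite ?nnegrE// ltW.
Qed.

Lemma le_Rintegral_itvr (R : realType) (s t : R) (h : R -> R) : 0 <= s <= t ->
  (forall x, 0 <= h x) ->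
  (@lebesgue_measure R).-integrable `[0, t] (EFin \o h) ->
  \int[@lebesgue_measure R]_(x in `[0, s]) h x <=
  \int[@lebesgue_measure R]_(x in `[0, t]) h x.
Proof.
move=> /andP[s0 st] h0 ih; rewrite -subr_ge0.
rewrite (Rintegral_itvB ih) ?bnd_simp//.
by apply: Rintegral_ge0.
Qed.

Section FracEconv.
Context {R : realType}.
Local Notation mu := (@lebesgue_measure R).

(** The kernel of the Riemann-Liouville integral of order [al]. *)
Definition rl_kernel (al s : R) : R := s `^ (al - 1) / Gamma al.

Lemma measurable_rl_kernel al : measurable_fun [set: R] (rl_kernel al).
Proof. by apply: measurable_funM => //; exact: measurable_powR. Qed.

Lemma rl_kernel_ge0 al s : 0 < al -> 0 <= rl_kernel al s.
Proof. by move=> al0; rewrite divr_ge0 ?powR_ge0// ltW// Gamma_gt0. Qed.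

Lemma rl_kernel1 s : rl_kernel 1 s = 1.
Proof. by rewrite /rl_kernel subrr powRr0 Gamma1 divr1. Qed.

Lemma frac_integral1 (h : R -> R) t :
  frac_integral 1 h t = \int[mu]_(s in `[0, t]) h s.
Proof.
rewrite /frac_integral Gamma1 invr1 mul1r.
by under eq_Rintegral do rewrite subrr powRr0 mul1r.
Qed.

Lemma econv_frac_integral (al t : R) (h : R -> R) : 0 < al ->
  measurable_fun [set: R] h ->
  mu.-integrable `[0, t] (EFin \o (fun s => (t - s) `^ (al - 1) * h s)) ->
  econv (causal (rl_kernel al)) (causal h) t = (frac_integral al h t)%:E.
Proof.
move=> al0 mh ih; rewrite -volterra_econv//; last exact: measurable_rl_kernel.
have ih' := rintegrableZ (measurable_itv _) (Gamma al)^-1 ih.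
rewrite /frac_integral -RintegralZl// /Rintegral fineK; last first.
  exact: integrable_fin_num.
by apply: eq_integral => s _; rewrite /rl_kernel; congr EFin; ring.
Qed.

Lemma frac_integral_ge0 (al t : R) (h : R -> R) : 0 < al ->
  (forall s, 0 <= s -> 0 <= h s) -> 0 <= frac_integral al h t.
Proof.
move=> al0 h0; apply: mulr_ge0; first by rewrite invr_ge0 ltW// Gamma_gt0.
apply: Rintegral_ge0 => s; rewrite /= in_itv/= => /andP[s0 st].
by rewrite mulr_ge0 ?powR_ge0 ?h0.
Qed.

End FracEconv.

Section ResolventIdentity.
Context {R : realType}.
Local Open Scope ereal_scope.
Variables A K L : R -> \bar R.
Variables l m : R.
Hypotheses (l0 : (0 <= l)%R) (m0 : (0 <= m)%R).
Hypotheses (mA : measurable_fun setT A) (mK : measurable_fun setT K)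
  (mL : measurable_fun setT L).
Hypotheses (A0 : forall s, 0 <= A s) (K0 : forall s, 0 <= K s)
  (L0 : forall s, 0 <= L s).
Hypothesis eqK : A = K \+ (fun s => l%:E * econv A K s).
Hypothesis eqL : A = L \+ (fun s => m%:E * econv A L s).

Let half (p : R) (P Q : R -> \bar R) t : (0 <= p)%R ->
  measurable_fun setT P -> measurable_fun setT Q ->
  (forall s, 0 <= P s) -> (forall s, 0 <= Q s) ->
  A = P \+ (fun s => p%:E * econv A P s) ->
  econv A Q t = econv Q P t + p%:E * econv Q (econv A P) t.
Proof.
move=> p0 mP mQ P0 Q0 AE.
have AP0 s : 0 <= econv A P s by exact: econv_ge0.
have mAP : measurable_fun setT (econv A P) by exact: measurable_econv.
have mp : measurable_fun setT (fun s => p%:E * econv A P s).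
  exact: measurable_funeM.
have p0' s : 0 <= p%:E * econv A P s by rewrite mule_ge0.
rewrite (econvC mA mQ A0 Q0) {1}AE (econvDr _ mQ mP mp Q0 P0 p0').
by rewrite (econvZr _ mQ mAP _ Q0 AP0)// lee_fin.
Qed.

(** Both equations are convolved with the other kernel; associativity and
    commutativity identify the terms quadratic in the kernels. *)
Lemma resolvent_identity t : A t \is a fin_num ->
  econv A K t \is a fin_num -> econv A L t \is a fin_num -> (l <= m)%R ->
  L t <= K t.
Proof.
move=> Af AKf ALf lm.
pose X := econv K L t.
pose Y := econv (econv A K) L t.
have AK0 s : 0 <= econv A K s by exact: econv_ge0.
have AL0 s : 0 <= econv A L s by exact: econv_ge0.
have mAK : measurable_fun setT (econv A K) by exact: measurable_econv.
have mAL : measurable_fun setT (econv A L) by exact: measurable_econv.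
have eqm : econv A L t = X + l%:E * Y.
  rewrite (half _ l0 mK mL K0 L0 eqK) (econvC mL mK L0 K0).
  by rewrite (econvC mL mAK L0 AK0).
have eql : econv A K t = X + m%:E * Y.
  rewrite (half _ m0 mL mK L0 K0 eqL) (econvC mK mAL K0 AL0) /Y.
  rewrite -(econvA mA mK mL A0 K0 L0) -(econvA mA mL mK A0 L0 K0).
  by rewrite (econvC mL mK L0 K0).
have X0 : 0 <= X by exact: econv_ge0.
have Y0 : 0 <= Y by exact: econv_ge0.
have Xf : X \is a fin_num.
  rewrite ge0_fin_numE// (@le_lt_trans _ _ (econv A L t))//.
    by rewrite eqm leeDl// mule_ge0.
  by rewrite -ge0_fin_numE.
have Kf : K t \is a fin_num.
  rewrite ge0_fin_numE// (@le_lt_trans _ _ (A t))//.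
    by rewrite {1}eqK leeDl// mule_ge0.
  by rewrite -ge0_fin_numE.
have Lf : L t \is a fin_num.
  rewrite ge0_fin_numE// (@le_lt_trans _ _ (A t))//.
    by rewrite {1}eqL leeDl// mule_ge0.
  by rewrite -ge0_fin_numE.
have [m00|m00] := eqVneq m 0%R.
  have l00 : l = 0%R by apply/eqP; rewrite eq_le l0 -m00 lm.
  have <- : A t = K t by rewrite {1}eqK l00/= mul0e adde0.
  by rewrite {1}eqL leeDl// mule_ge0.
have mp : (0 < m)%R by rewrite lt_neqAle eq_sym m00.
have Yf : Y \is a fin_num.
  rewrite ge0_fin_numE// ltey; apply/eqP => Yy.
  by move: AKf; rewrite eql Yy mulry gtr0_sg// mul1e -(fineK Xf).
have h1 := congr1 (fun f => f t) eqK; have h2 := congr1 (fun f => f t) eqL.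
rewrite /= eql -(fineK Xf) -(fineK Yf) -(fineK Kf) -(fineK Af) -!EFinM -!EFinD in h1.
rewrite /= eqm -(fineK Xf) -(fineK Yf) -(fineK Lf) -(fineK Af) -!EFinM -!EFinD in h2.
rewrite -(fineK Kf) -(fineK Lf) lee_fin.
have x0 : (0 <= fine X)%R by rewrite fine_ge0.
have lmx : (l * fine X <= m * fine X)%R by rewrite ler_wpM2r.
move: h1 h2 => [->] []; rewrite !mulrDr (mulrCA l m); lra.
Qed.

End ResolventIdentity.


Section Decay.
Local Opaque mittag_leffler Gamma powR integral.
Context {R : realType}.
Local Notation mu := (@lebesgue_measure R).
Variable rho : R.
Hypothesis rho01 : 0 < rho < 1.
Let rho0 : 0 < rho. Proof. by case/andP: rho01. Qed.
Let rho1 : rho < 1. Proof. by case/andP: rho01. Qed.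
Let rho10 : 0 < 1 - rho. Proof. by rewrite subr_gt0. Qed.
Local Notation E := (mittag_leffler rho).
Local Notation kern := (ml_kernel rho rho).

Lemma powR_rhoK (z : R) : 0 <= z -> (z `^ rho^-1) `^ rho = z.
Proof. by move=> z0; rewrite -powRrM mulVf ?gt_eqF// powRr1. Qed.

Lemma ml_rho_gt0 (z : R) : 0 <= z -> 0 < E rho (- z).
Proof.
rewrite le_eqVlt => /predU1P[<-|z0].
  by rewrite oppr0 ml0// invr_gt0 Gamma_gt0.
have t0 : 0 < z `^ rho^-1 by exact: powR_gt0.
have := kern1_gt0 rho01 t0; rewrite /ml_kernel pmulr_rgt0 ?powR_gt0//.
by rewrite powR_rhoK ?ltW// mulN1r.
Qed.

Lemma kern_ge0 (l s : R) : 0 <= l -> 0 <= kern l s.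
Proof.
move=> l0; rewrite mulr_ge0 ?powR_ge0// mulNr ltW// ml_rho_gt0//.
by rewrite mulr_ge0 ?powR_ge0.
Qed.

Lemma measurable_kern l : measurable_fun [set: R] (kern l).
Proof. exact: measurable_ml_kernel. Qed.

Lemma kern_integrable (al l t : R) : 0 < al -> 0 < t -> mu.-integrable `[0, t]
  (EFin \o (fun s => (t - s) `^ (al - 1) * kern l s)).
Proof. by move=> al0 t0; have [] := ml_kernel_conv rho0 l al0 rho0 t0. Qed.

Let A := causal (rl_kernel rho).
Let K l := causal (kern l).

Let mA : measurable_fun setT A.
Proof. by apply: measurable_causal; apply: measurable_funTS; exact: measurable_rl_kernel. Qed.
Let mK l : measurable_fun setT (K l).
Proof. by apply: measurable_causal; apply: measurable_funTS; exact: measurable_kern. Qed.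
Let A0 s : (0 <= A s)%E.
Proof. by apply: causal_ge0 => ? _; exact: rl_kernel_ge0. Qed.
Let K0 l : 0 <= l -> forall s, (0 <= K l s)%E.
Proof. by move=> l0; apply: causal_ge0 => ? _; exact: kern_ge0. Qed.

Lemma resolvent_econv (l : R) : 0 <= l ->
  causal (rl_kernel rho) = (K l \+ (fun s => l%:E * econv A (K l) s))%E.
Proof.
move=> l0; apply/funext => t /=; have [t0|t0] := leP t 0.
  rewrite /K econv_causal_le0// mule0 adde0.
  by rewrite /causal ltNge t0.
rewrite /K econv_frac_integral//; last 2 first.
- exact: measurable_kern.
- exact: kern_integrable.
rewrite /causal t0 -EFinM -EFinD; congr EFin.
by rewrite (resolvent_eq rho01 l t0) subrK.
Qed.

(** By [resolvent_identity], k_l - k_m = (m - l) (k_l . k_m), a nonnegative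
    function. *)
Lemma kern_antitone (l m t : R) : 0 <= l -> l <= m -> 0 < t ->
  kern m t <= kern l t.
Proof.
move=> l0 lm t0; have m0 := le_trans l0 lm.
have fin p : econv A (K p) t \is a fin_num.
  rewrite econv_frac_integral//; first exact: measurable_kern.
  exact: kern_integrable.
have := @resolvent_identity _ A (K l) (K m) l m l0 m0 mA (mK l) (mK m) A0
  (K0 l0) (K0 m0) (resolvent_econv l0) (resolvent_econv m0) t _ (fin l) (fin m) lm.
by rewrite /A /K /causal t0 lee_fin; exact.
Qed.

Lemma ml_rho_antitone (z w : R) : 0 <= z <= w -> E rho (- w) <= E rho (- z).
Proof.
move=> /andP[z0 zw]; have := kern_antitone z0 zw ltr01.
by rewrite /ml_kernel !powR1 !mul1r !mulr1.
Qed.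

Lemma ml1_kern (l t : R) : 0 < t ->
  E 1 (- l * t `^ rho) = 1 - l * \int[mu]_(s in `[0, t]) kern l s.
Proof.
move=> t0; rewrite ml_rec// Gamma1 invr1 -frac_integral1.
have [_ ->] := ml_kernel_conv rho0 l ltr01 rho0 t0.
by rewrite /ml_kernel (_ : 1 + rho - 1 = rho); [ring|lra].
Qed.

Lemma ml1_kern1 (z : R) : 0 < z ->
  E 1 (- z) = 1 - \int[mu]_(s in `[0, z `^ rho^-1]) kern 1 s.
Proof.
move=> z0; have e : - z = -1 * (z `^ rho^-1) `^ rho.
  by rewrite powR_rhoK ?mulN1r// ltW.
by rewrite {1}e ml1_kern ?powR_gt0// mul1r.
Qed.

Lemma ml1_frac_integral (l t : R) : 0 < t ->
  E 1 (- l * t `^ rho) = frac_integral (1 - rho) (kern l) t.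
Proof.
move=> t0; have [_ ->] := ml_kernel_conv rho0 l rho10 rho0 t0.
by rewrite subrK /ml_kernel subrr powRr0 mul1r.
Qed.

(** By [ml1_frac_integral] it is a fractional integral of a positive kernel. *)
Lemma ml1_ge0 (z : R) : 0 <= z -> 0 <= E 1 (- z).
Proof.
move=> z0; have := ml1_frac_integral z ltr01.
rewrite powR1 mulr1 => ->; apply: frac_integral_ge0 => // s _.
exact: kern_ge0.
Qed.

Lemma kern_integrable0 (l t : R) : 0 < t ->
  mu.-integrable `[0, t] (EFin \o kern l).
Proof.
move=> t0; have := kern_integrable l ltr01 t0.
by apply: eq_integrable => // s _ /=; rewrite subrr powRr0 mul1r.
Qed.

(** The integral in [ml1_kern1] grows with its upper limit. *)
Lemma ml1_antitone (z w : R) : 0 <= z <= w -> E 1 (- w) <= E 1 (- z).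
Proof.
move=> /andP[]; rewrite le_eqVlt => /predU1P[<-|z0] zw.
  have [->//|w0] := eqVneq w 0.
  have wp : 0 < w by rewrite lt_neqAle eq_sym w0.
  have := ml1_kern w ltr01; rewrite powR1 mulr1 oppr0 => ->.
  rewrite ml0// Gamma1 invr1 gerBl mulr_ge0//.
  by apply: Rintegral_ge0 => s _; exact: kern_ge0.
have w0 : 0 < w by exact: lt_le_trans zw.
have tz : 0 < z `^ rho^-1 by exact: powR_gt0.
have tw : 0 < w `^ rho^-1 by exact: powR_gt0.
rewrite (ml1_kern1 w0) (ml1_kern1 z0).
rewrite lerD2l lerN2; apply: le_Rintegral_itvr; last exact: kern_integrable0.
  rewrite powR_ge0/=; apply: ge0_ler_powR zw; rewrite ?nnegrE ?invr_ge0; exact: ltW.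
by move=> s; apply: kern_ge0; exact: ler01.
Qed.

Lemma ml1_le1 (z : R) : 0 <= z -> E 1 (- z) <= 1.
Proof.
move=> z0; have := @ml1_antitone 0 z; rewrite lexx z0 oppr0 => /(_ isT).
by rewrite ml0// Gamma1 invr1.
Qed.

Let g (l : R) := Gamma l.
Let grho : 0 < g rho. Proof. exact: Gamma_gt0. Qed.
Let grho1 : 0 < g (rho + 1). Proof. by apply: Gamma_gt0; rewrite addr_gt0. Qed.

(** By [ml1_kern] at t = 1, [z] times the integral of the kernel over [0, 1] is at
    most 1, while by monotonicity the integrand is at least s^(rho-1) E(-z). *)
Lemma ml_rho_decay (z : R) : 0 <= z -> z * E rho (- z) <= Gamma (rho + 1) / Gamma rho.
Proof.
move=> z0; have := ml1_kern z ltr01; rewrite powR1 mulr1 => e1.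
have h1 := ml1_ge0 z0.
have : E rho (- z) * (Gamma rho / Gamma (rho + 1)) <= \int[mu]_(s in `[0, 1]) kern z s.
  have <- : \int[mu]_(s in `[0, 1]) (s `^ (rho - 1)) = Gamma rho / Gamma (rho + 1).
    by rewrite Rintegral_powR0// powR1 mulr1.
  have ip : mu.-integrable `[0, 1] (EFin \o (fun s => s `^ (rho - 1))).
    by apply: integrable_powR_itv => //; have := rho0; lra.
  rewrite -RintegralZl//; apply: le_Rintegral.
  - by [].
  - exact: rintegrableZ.
  - exact: kern_integrable0.
  move=> s; rewrite /= in_itv/= => /andP[s0 s1].
  rewrite /ml_kernel [leLHS]mulrC; apply: ler_wpM2l; first exact: powR_ge0.
  rewrite mulNr; apply: ml_rho_antitone; apply/andP; split.
    by apply: mulr_ge0 => //; exact: powR_ge0.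
  by apply: ler_piMr => //; apply: powR_le1; rewrite ?s0.
move=> /(ler_wpM2l z0) h2.
have h3 : z * \int[mu]_(s in `[0, 1]) kern z s <= 1.
  by move: e1 h1; move: (E 1 (- z)) (Rintegral _ _ _) => u v -> ?; lra.
have := le_trans h2 h3.
move: grho grho1; rewrite /g; move: (Gamma rho) (Gamma _) (E rho (- z)) => p q u p0 q0.
by rewrite !mulrA ler_pdivrMr// mul1r ler_pdivlMr.
Qed.

(** As for [ml_rho_decay], from the recursion
    E_{rho,1}(-z) = 1 - z I^rho (E_{rho,1}(-z s^rho)) (1). *)
Lemma ml1_decay (z : R) : 0 <= z -> z * E 1 (- z) <= Gamma (rho + 1).
Proof.
move=> z0.
have e1 := ml_rec rho0 (- z) ltr01.
have [iE Ef] := ml_kernel_conv rho0 z rho0 ltr01 ltr01.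
rewrite {2}/ml_kernel !powR1 mulr1 mul1r (addrC rho) in Ef.
have h1 := ml1_ge0 z0.
rewrite Gamma1 invr1 -Ef in e1.
have : E 1 (- z) / Gamma (rho + 1) <= frac_integral rho (ml_kernel rho 1 z) 1.
  have -> : E 1 (- z) / Gamma (rho + 1) =
      (Gamma rho)^-1 * (E 1 (- z) * \int[mu]_(s in `[0, 1]) ((1 - s) `^ (rho - 1) * s `^ (1 - 1))).
    rewrite volterra_powR// powR1 Gamma1 !mulr1.
    move: grho grho1; rewrite /g; move: (Gamma rho) (Gamma _) (E 1 (- z)) => p q u p0 q0.
    by field; rewrite !gt_eqF.
  have ip := integrable_volterra_powR rho0 (@ltr01 R) (@ltr01 R).
  rewrite /frac_integral ler_wpM2l ?invr_ge0 ?(ltW grho)//.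
  rewrite -RintegralZl//; apply: le_Rintegral => //; first exact: rintegrableZ.
  move=> s; rewrite /= in_itv/= => /andP[s0 s1].
  rewrite subrr powRr0 mulr1 [leLHS]mulrC; apply: ler_wpM2l; first exact: powR_ge0.
  rewrite /ml_kernel subrr powRr0 mul1r mulNr; apply: ml1_antitone; apply/andP; split.
    by apply: mulr_ge0 => //; exact: powR_ge0.
  by apply: ler_piMr => //; apply: powR_le1; rewrite ?s0.
move=> /(ler_wpM2l z0) h2.
move: e1 h1; move: (E 1 (- z)) (frac_integral _ _ _) h2 => u v h2 e1 h1.
have h3 : z * (u / Gamma (rho + 1)) <= 1 by lra.
move: grho1 h3; rewrite /g; move: (Gamma (rho + 1)) => q q0.
by rewrite mulrA ler_pdivrMr// mul1r.
Qed.

Definition decay_const : R := Num.max (Gamma (rho + 1) / Gamma rho) (Gamma rho)^-1.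

(** The two bounds z E(-z) = O(1) and E(-z) = O(1) are interpolated; the power
    of [l] on the right is what has to be paid for an integrable singularity
    at [x = 0]. *)
Lemma kern_decay (e l x : R) : 0 < e <= 1 -> 0 <= l -> 0 < x ->
  l * kern l x <= decay_const * (l `^ e * x `^ (e * rho - 1)).
Proof.
move=> /andP[e0 e1] l0 x0.
have z0 : 0 <= l * x `^ rho by rewrite mulr_ge0 ?powR_ge0.
set z := l * x `^ rho in z0.
have C0 : 0 <= decay_const.
  by rewrite le_max; apply/orP; left; apply: divr_ge0; [exact: ltW grho1|exact: ltW grho].
have zE : z * E rho (- z) <= decay_const * z `^ e.
  have [z1|z1] := leP z 1.
    apply: (@le_trans _ _ (z * (Gamma rho)^-1)).
      rewrite ler_wpM2l//; have := @ml_rho_antitone 0 z; rewrite lexx z0 oppr0 ml0//.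
      exact.
    rewrite mulrC; apply: (@le_trans _ _ (decay_const * z)).
      by rewrite ler_wpM2r// le_max lexx orbT.
    rewrite ler_wpM2l//; have [->|zn] := eqVneq z 0; first exact: powR_ge0.
    by apply: ger1_powR => //; rewrite z1 andbT lt_neqAle eq_sym zn.
  apply: (le_trans (ml_rho_decay z0)).
  apply: (@le_trans _ _ decay_const); first by rewrite le_max lexx.
  rewrite ler_peMr// -[leLHS](powRr0 z); apply: ler_powR; exact: ltW.
have -> : l * kern l x = x^-1 * (z * E rho (- z)).
  rewrite /ml_kernel -/z mulNr -/z /z.
  have -> : x `^ (rho - 1) = x^-1 * x `^ rho.
    by rewrite powRB ?powRr1 ?(ltW x0) 1?mulrC// (gt_eqF x0) implybT.
  by ring.
have -> : l `^ e * x `^ (e * rho - 1) = x^-1 * z `^ e.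
  rewrite powRM ?powR_ge0// -powRrM powRB; last by rewrite (gt_eqF x0) implybT.
  by rewrite powRr1 ?(ltW x0)// (mulrC rho); ring.
by rewrite [leRHS]mulrCA; apply: ler_wpM2l zE; rewrite invr_ge0 ltW.
Qed.

Lemma ml1_decay_time (l t : R) : 0 <= l -> 0 < t ->
  l * E 1 (- l * t `^ rho) <= Gamma (rho + 1) * t `^ (- rho).
Proof.
move=> l0 t0; rewrite powRN ler_pdivlMr ?powR_gt0// mulrAC mulNr.
by apply: ml1_decay; rewrite mulr_ge0 ?powR_ge0.
Qed.

End Decay.

(** * Convolution of the kernel with a bounded source *)


Section WithinSeq.
Local Opaque mittag_leffler Gamma powR integral.
Context {R : realType}.

(** Dominated convergence is a statement about sequences; this criterion
    turns it into continuity in a parameter. *)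
Lemma cvg_within_seq (A : set R) (t l : R) (q : R -> R) : A t ->
  (forall x : R^nat, (forall n, A (x n)) ->
    x n @[n --> \oo] --> t -> q (x n) @[n --> \oo] --> l) ->
  q @ within A (nbhs t) --> l.
Proof.
move=> At H.
have qt : q t = l.
  have cq : q t @[_ --> \oo] --> l by apply: (H (fun=> t)) => //; exact: cvg_cst.
  have cq' : q t @[_ --> \oo] --> q t by exact: cvg_cst.
  by rewrite -(cvg_lim _ cq)// (cvg_lim _ cq').
have H' : q @ within A (t^') --> l by apply: cvg_within_dnbhs_seq => x Ax _; exact: H.
move=> P Pl; have := H' P Pl; rewrite /= /within/= /dnbhs/=.
move=> [e e0 He]; exists e => // s ts As.
have [->|st] := eqVneq s t; last exact: He.
by rewrite /= qt; exact: nbhs_singleton.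
Qed.

(** Retraction onto [0, T]: composed with it, a function that is continuous on
    [0, T] becomes continuous and bounded on the line. *)
Definition clamp (T s : R) : R := Num.min (Num.max s 0) T.

Lemma clamp_itv T s : 0 <= T -> 0 <= clamp T s <= T.
Proof. by move=> T0; rewrite /clamp le_min ge_min le_max lexx orbT T0 lexx orbT. Qed.

Lemma clampE T s : 0 <= s <= T -> clamp T s = s.
Proof. by move=> /andP[s0 sT]; rewrite /clamp max_l// min_l. Qed.

Lemma continuous_clamp T : continuous (clamp T).
Proof.
move=> s.
have c1 : {for s, continuous (fun s : R => Num.max s 0)}.
  exact: (@continuous_max R R^o id (cst 0) s (@cvg_id _ _) (@cvg_cst _ _ _ _ _)).
exact: (@continuous_min R R^o _ (cst T) s c1 (@cvg_cst _ _ _ _ _)).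
Qed.

Lemma continuous_comp_clamp T (g : R -> R) : 0 <= T ->
  {within `[0, T], continuous g} -> continuous (g \o clamp T).
Proof.
move=> T0 /subspace_continuousP cg s.
have As : `[0, T]%classic (clamp T s) by rewrite /= in_itv/=; exact: clamp_itv.
apply: (cvg_comp _ _ _ (cg _ As)) => P /= wP.
have := continuous_clamp (x := s) wP.
rewrite /= !near_simpl; apply: filterS => r /=; apply.
by rewrite /= in_itv/=; exact: clamp_itv.
Qed.

End WithinSeq.

Section Kconv.
Local Opaque mittag_leffler Gamma powR integral.
Context {R : realType}.
Local Notation mu := (@lebesgue_measure R).
Variable rho : R.
Hypothesis rho01 : 0 < rho < 1.
Let rho0 : 0 < rho. Proof. by case/andP: rho01. Qed.
Let rho1 : rho < 1. Proof. by case/andP: rho01. Qed.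
Let rho10 : 0 < 1 - rho. Proof. by rewrite subr_gt0. Qed.
Local Notation E := (mittag_leffler rho).
Local Notation kern := (ml_kernel rho rho).

Definition kconv (l : R) (g : R -> R) (t : R) : R :=
  \int[mu]_(xi in `[0, t]) (g (t - xi) * kern l xi).

Lemma kern_integrable0' l t : mu.-integrable `[0, t] (EFin \o kern l).
Proof.
have [t0|t0] := ltP 0 t; first exact: kern_integrable0.
apply: integrableS (kern_integrable0 rho01 l (@ltr01 R)) => //.
by apply: subset_itvl; rewrite bnd_simp (le_trans t0).
Qed.

Section Bounded.
Variables (g : R -> R) (M : R).
Hypotheses (mg : measurable_fun [set: R] g) (gM : forall s, `|g s| <= M).

Let M0 : 0 <= M. Proof. exact: le_trans (gM 0). Qed.

Lemma kconv_integrable l t : 0 <= l ->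
  mu.-integrable `[0, t] (EFin \o (fun xi => g (t - xi) * kern l xi)).
Proof.
move=> l0; apply: (@rintegrable_le _ _ _ _ (fun xi => M * kern l xi)) => //.
- by apply: (measurable_volterra _ mg); exact: measurable_kern.
- by apply: rintegrableZ => //; exact: kern_integrable0'.
- move=> xi _; rewrite normrM (ger0_norm (kern_ge0 rho01 xi l0)).
  apply: ler_wpM2r => //; exact: kern_ge0.
Qed.

Lemma kconv_bound l t : 0 <= l -> `|kconv l g t| <= M * \int[mu]_(xi in `[0, t]) kern l xi.
Proof.
move=> l0; apply: (le_trans (le_normr_Rintegral _ (kconv_integrable t l0))) => //.
have ik := kern_integrable0' l t.
rewrite -RintegralZl//; apply: le_Rintegral => //.
- by apply: rintegrable_norm => //; exact: kconv_integrable.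
- exact: rintegrableZ.
- move=> xi _; rewrite normrM (ger0_norm (kern_ge0 rho01 xi l0)).
  apply: ler_wpM2r => //; exact: kern_ge0.
Qed.

Lemma kconv_fine l t : kconv l g t = fine (econv (causal g) (causal (kern l)) t).
Proof. by apply: volterra_Rintegral => //; exact: measurable_kern. Qed.

Lemma kconv_econv l t : 0 <= l -> (kconv l g t)%:E = econv (causal g) (causal (kern l)) t.
Proof.
move=> l0; rewrite -volterra_econv//; last exact: measurable_kern.
rewrite /kconv /Rintegral fineK//; apply: integrable_fin_num => //.
exact: kconv_integrable.
Qed.

End Bounded.

Lemma kconv0 l g : kconv l g 0 = 0.
Proof. by rewrite /kconv set_itv1 Rintegral_set1. Qed.

(** Dominated convergence, once the integrands are extended by 0 to the fixed
    interval [0, T]. *)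
Lemma kconv_cont l g M T : 0 <= l -> continuous g -> (forall s, `|g s| <= M) ->
  {within `[0, T], continuous (kconv l g)}.
Proof.
move=> l0 cg gM.
have mg : measurable_fun [set: R] g by exact: continuous_measurable_fun.
apply/subspace_continuousP => t t0T; apply: cvg_within_seq => // x xA xt.
pose F s xi := if xi <= s then g (s - xi) * kern l xi else 0.
have FE s : s <= T -> kconv l g s = \int[mu]_(xi in `[0, T]) F s xi.
  move=> sT; rewrite /kconv [LHS]Rintegral_mkcond [RHS]Rintegral_mkcond.
  apply: eq_Rintegral => xi _; rewrite !patchE !mem_setE !in_itv/= /F.
  case: (leP xi s) => [xs|_]; first by rewrite (le_trans xs sT) andbT.
  by rewrite andbF if_same.
have tT : t <= T by move: t0T; rewrite /= in_itv/= => /andP[].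
have xT n : x n <= T by have := xA n; rewrite /= in_itv/= => /andP[].
rewrite /from_subspace (FE t tT); under eq_cvg do rewrite FE//.
have mF s : measurable_fun `[0, T] (F s).
  apply: measurable_funTS; apply: measurable_fun_ifT => //.
    by apply: measurable_fun_ler => //; exact: measurable_id.
  by apply: (measurable_volterra _ mg); exact: measurable_kern.
have iM : mu.-integrable `[0, T] (fun xi => (M * kern l xi)%:E).
  by apply: rintegrableZ => //; exact: kern_integrable0'.
have Fb s xi : `|F s xi| <= M * kern l xi.
  have k0 := kern_ge0 rho01 xi l0.
  rewrite /F; case: ifP => _.
    by rewrite normrM (ger0_norm k0); exact: ler_wpM2r.
  by rewrite normr0; apply: mulr_ge0 => //; exact: le_trans (gM 0).
have := @dominated_convergence _ _ R mu `[0, T]%classic (measurable_itv _)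
  (fun n xi => (F (x n) xi)%:E) (fun xi => (F t xi)%:E)
  (fun xi => (M * kern l xi)%:E) _ _ _ iM _.
case => //.
- by move=> n; apply/measurable_EFinP; exact: mF.
- by apply/measurable_EFinP; exact: mF.
- exists [set t]; split => //; first exact: lebesgue_measure_set1.
  move=> xi /= nxi; apply: contrapT => xit; apply: nxi => _.
  apply/cvg_EFin; first exact: nearW.
  rewrite /comp/=; move/eqP : xit; rewrite neq_lt => /orP[xit|xit].
    have cF : g (x n - xi) * kern l xi @[n --> \oo] --> F t xi.
      rewrite /F (ltW xit); apply: cvgM; last exact: cvg_cst.
      apply: (@cvg_comp _ _ _ (fun n => x n - xi) g); last exact: cg.
      by apply: cvgB => //; exact: cvg_cst.
    apply: cvg_trans cF; apply: near_eq_cvg.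
    near=> n; have xn : xi < x n by near: n; exact: (cvgr_gt _ xt _ xit).
    by rewrite /F (ltW xn).
  have -> : F t xi = 0 by rewrite /F leNgt xit.
  have c0 : (fun _ : nat => 0 : R) @ \oo --> (0 : R) by exact: cvg_cst.
  apply: cvg_trans c0; apply: near_eq_cvg.
  near=> n; have xn : x n < xi by near: n; exact: (cvgr_lt _ xt _ xit).
  by rewrite /F leNgt xn.
- by apply: aeW => xi n _ /=; rewrite lee_fin.
move=> iF _ cv.
have /fine_cvg : (\int[mu]_(xi in `[0%R, T]) (F (x n) xi)%:E @[n --> \oo] -->
    (\int[mu]_(xi in `[0%R, T]) (F t xi))%R%:E)%E.
  by rewrite /Rintegral fineK//; exact: integrable_fin_num.
exact.
Unshelve. all: by end_near. Qed.

End Kconv.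

Lemma kconvE (R : realType) (rho l : R) (g : R -> R) t : kconv rho l g t =
  \int[@lebesgue_measure R]_(x in `[0, t]) (g (t - x) * ml_kernel rho rho l x).
Proof. by []. Qed.

(** * The equation of a single mode *)

Lemma frac_integralE (R : realType) (b : R) (h : R -> R) (t : R) :
  frac_integral b h t = (Gamma b)^-1 *
    \int[@lebesgue_measure R]_(s in `[0, t]) ((t - s) `^ (b - 1) * h s).
Proof. by []. Qed.

Lemma ml_kernelE (R : realType) (rho m l t : R) :
  ml_kernel rho m l t = t `^ (m - 1) * mittag_leffler rho m (- l * t `^ rho).
Proof. by []. Qed.


Section RintegralLinear.
Local Opaque mittag_leffler Gamma powR frac_integral integral econv ml_kernel rl_kernel.
Context {R : realType}.
Local Notation mu := (@lebesgue_measure R).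
Variable D : set R.
Hypothesis mD : measurable D.

Lemma rRintegralB (f g : R -> R) : mu.-integrable D (EFin \o f) ->
  mu.-integrable D (EFin \o g) ->
  \int[mu]_(x in D) (f x - g x) = \int[mu]_(x in D) f x - \int[mu]_(x in D) g x.
Proof. by move=> fi gi; rewrite RintegralB. Qed.

Lemma rRintegralD (f g : R -> R) : mu.-integrable D (EFin \o f) ->
  mu.-integrable D (EFin \o g) ->
  \int[mu]_(x in D) (f x + g x) = \int[mu]_(x in D) f x + \int[mu]_(x in D) g x.
Proof. by move=> fi gi; rewrite RintegralD. Qed.

Lemma rRintegralZ (c : R) (f : R -> R) : mu.-integrable D (EFin \o f) ->
  \int[mu]_(x in D) (c * f x) = c * \int[mu]_(x in D) f x.
Proof. by move=> fi; rewrite RintegralZl. Qed.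

End RintegralLinear.

Section Balance.
Local Opaque mittag_leffler Gamma powR frac_integral integral econv ml_kernel rl_kernel.
Context {R : realType}.
Local Notation mu := (@lebesgue_measure R).
Variable rho : R.
Hypothesis rho01 : 0 < rho < 1.
Let rho0 : 0 < rho. Proof. by case/andP: rho01. Qed.
Let rho1 : rho < 1. Proof. by case/andP: rho01. Qed.
Let rho10 : 0 < 1 - rho. Proof. by rewrite subr_gt0. Qed.
Local Notation E := (mittag_leffler rho).
Local Notation kern := (ml_kernel rho rho).
Local Notation kconv := (kconv rho).

Section Nonneg.
Variables (g : R -> R) (M : R).
Hypotheses (mg : measurable_fun [set: R] g) (gM : forall s, `|g s| <= M).

Hypothesis g0 : forall s, 0 <= g s.

Let mcg : measurable_fun setT (causal g).
Proof. by apply: measurable_causal; exact: measurable_funTS. Qed.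
Let mck l : measurable_fun setT (causal (kern l)).
Proof. by apply: measurable_causal; apply: measurable_funTS; exact: measurable_kern. Qed.
Let mca al : measurable_fun setT (causal (@rl_kernel R al)).
Proof. by apply: measurable_causal; apply: measurable_funTS; exact: measurable_rl_kernel. Qed.
Let g0' s : (0 <= causal g s)%E.
Proof. by apply: causal_ge0 => ? _; exact: g0. Qed.
Let k0' l : 0 <= l -> forall s, (0 <= causal (kern l) s)%E.
Proof. by move=> l0; apply: causal_ge0 => ? _; exact: kern_ge0. Qed.
Let a0' al : 0 < al -> forall s, (0 <= causal (@rl_kernel R al) s)%E.
Proof. by move=> l0; apply: causal_ge0 => ? _; exact: rl_kernel_ge0. Qed.

Lemma measurable_kconv_ge0 l : 0 <= l -> measurable_fun [set: R] (kconv l g).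
Proof.
move=> l0.
have : measurable_fun [set: R] (fun t => fine (econv (causal g) (causal (kern l)) t)).
  by apply: measurableT_comp => //; apply: measurable_econv => //; exact: k0'.
by apply: eq_measurable_fun => t _; rewrite kconv_fine.
Qed.

Lemma causal_kconv l : 0 <= l ->
  causal (kconv l g) = econv (causal g) (causal (kern l)).
Proof.
move=> l0; apply/funext => t; rewrite {1}/causal; case: ltP => t0.
  exact: (kconv_econv rho01 mg gM).
by rewrite econv_causal_le0.
Qed.

Lemma integrable_rl_bounded (al t B : R) (h : R -> R) : 0 < al -> 0 < t ->
  measurable_fun [set: R] h ->
  (forall s, 0 <= s <= t -> `|h s| <= B) ->
  mu.-integrable `[0, t] (EFin \o (fun s => (t - s) `^ (al - 1) * h s)).
Proof.
move=> al0 t0 mh hB.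
have ip := integrable_volterra_powR al0 (@ltr01 R) t0.
apply: (@rintegrable_le _ _ _ _
    (fun s => B * ((t - s) `^ (al - 1) * s `^ (1 - 1)))) => //.
- by apply: (measurable_volterra (g := fun s => s `^ (al - 1))) => //; exact: measurable_powR.
- exact: rintegrableZ.
- move=> s; rewrite /= in_itv/= => s0t.
  rewrite subrr powRr0 mulr1 normrM (ger0_norm (powR_ge0 _ _)) mulrC.
  by apply: ler_wpM2r; [exact: powR_ge0|exact: hB].
Qed.

Lemma kconv_le_bound l s t : 0 <= l -> 0 <= s <= t ->
  `|kconv l g s| <= M * \int[mu]_(xi in `[0, t]) kern l xi.
Proof.
move=> l0 st; apply: (le_trans (kconv_bound rho01 mg gM s l0)).
apply: ler_wpM2l; first exact: le_trans (gM 0).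
apply: le_Rintegral_itvr => //; last exact: kern_integrable0'.
by move=> x; exact: kern_ge0.
Qed.

(** Convolve I^(1-rho) k_l + l I^1 k_l = 1, that is [ml1_frac_integral] and
    [ml1_kern], with [g], and use associativity. *)
Lemma kconv_balance_ge0 l t : 0 <= l -> 0 < t ->
  frac_integral (1 - rho) (kconv l g) t + l * frac_integral 1 (kconv l g) t =
  frac_integral 1 g t.
Proof.
move=> l0 t0.
have mk := measurable_kconv_ge0 l0.
have ek al : 0 < al -> econv (causal (rl_kernel al)) (econv (causal g) (causal (kern l))) t =
    (frac_integral al (kconv l g) t)%:E.
  move=> al0; rewrite -causal_kconv// econv_frac_integral//.
  by apply: integrable_rl_bounded => // s st; exact: (kconv_le_bound l0 st).
have eg : econv (causal (rl_kernel 1)) (causal g) t = (frac_integral 1 g t)%:E.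
  by rewrite econv_frac_integral//; apply: (@integrable_rl_bounded _ _ M).
have swap al : 0 < al ->
    econv (causal (rl_kernel al)) (econv (causal g) (causal (kern l))) =
    econv (causal g) (econv (causal (rl_kernel al)) (causal (kern l))).
  move=> al0; have k1 := k0' l0; have a1 := a0' al0.
  rewrite (econvA (mca al) mcg (mck l) a1 g0' k1).
  rewrite (econvC (mca al) mcg a1 g0').
  by rewrite -(econvA mcg (mca al) (mck l) g0' a1 k1).
have m1 : measurable_fun setT (econv (causal (rl_kernel (1 - rho))) (causal (kern l))).
  by apply: measurable_econv => //; [exact: a0'|exact: k0'].
have m2 : measurable_fun setT (econv (causal (rl_kernel 1)) (causal (kern l))).
  by apply: measurable_econv => //; [exact: a0'|exact: k0'].
have p1 s : (0 <= econv (causal (rl_kernel (1 - rho))) (causal (kern l)) s)%E.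
  by apply: econv_ge0; [exact: a0'|exact: k0'].
have p2 s : (0 <= econv (causal (rl_kernel 1)) (causal (kern l)) s)%E.
  by apply: econv_ge0; [exact: a0'|exact: k0'].
have l0e : (0 <= l%:E)%E by rewrite lee_fin.
have m2' := measurable_funeM l%:E m2.
have p2' s : (0 <= l%:E * econv (causal (rl_kernel 1)) (causal (kern l)) s)%E.
  exact: (mule_ge0 l0e (p2 s)).
have key : (econv (causal (rl_kernel (1 - rho))) (causal (kern l)) \+
    (fun s => l%:E * econv (causal (rl_kernel 1)) (causal (kern l)) s))%E =
    causal (rl_kernel 1).
  apply/funext => s /=; have [s0|s0] := leP s 0.
    rewrite (econv_causal_le0 (rl_kernel (1 - rho)) (kern l) s0).
    rewrite (econv_causal_le0 (rl_kernel 1) (kern l) s0) mule0 adde0.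
    by rewrite /causal ltNge s0.
  rewrite (econv_frac_integral rho10 (measurable_kern rho01 l) (kern_integrable rho01 l rho10 s0)).
  rewrite (econv_frac_integral ltr01 (measurable_kern rho01 l) (kern_integrable rho01 l ltr01 s0)).
  rewrite /causal s0 -EFinM -EFinD; congr EFin.
  by rewrite rl_kernel1 frac_integral1 -ml1_frac_integral// ml1_kern// subrK.
suff : ((frac_integral (1 - rho) (kconv l g) t)%:E +
    l%:E * (frac_integral 1 (kconv l g) t)%:E)%E = (frac_integral 1 g t)%:E.
  by rewrite -EFinM -EFinD => -[].
rewrite -(ek _ rho10) -(ek _ ltr01) (swap _ rho10) (swap _ ltr01) -eg.
rewrite -(econvZr _ mcg m2 l0e g0' p2) -(econvDr _ mcg m1 m2' g0' p1 p2').
by rewrite key (econvC mcg (mca 1) g0' (a0' ltr01)).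
Qed.

End Nonneg.

Lemma frac_integralB (al t B C : R) (u v : R -> R) : 0 < al -> 0 < t ->
  measurable_fun [set: R] u -> measurable_fun [set: R] v ->
  (forall s, 0 <= s <= t -> `|u s| <= B) -> (forall s, 0 <= s <= t -> `|v s| <= C) ->
  frac_integral al (fun s => u s - v s) t = frac_integral al u t - frac_integral al v t.
Proof.
move=> al0 t0 mu_ mv uB vC; rewrite !frac_integralE -mulrBr; congr (_ * _).
rewrite -(rRintegralB (measurable_itv _) (integrable_rl_bounded al0 t0 mu_ uB)
  (integrable_rl_bounded al0 t0 mv vC)).
by apply: eq_Rintegral => s _; rewrite mulrBr.
Qed.

Lemma frac_integralZ (al t B c : R) (u : R -> R) : 0 < al -> 0 < t ->
  measurable_fun [set: R] u -> (forall s, 0 <= s <= t -> `|u s| <= B) ->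
  frac_integral al (fun s => c * u s) t = c * frac_integral al u t.
Proof.
move=> al0 t0 mu_ uB; rewrite !frac_integralE mulrCA; congr (_ * _).
rewrite -(rRintegralZ (measurable_itv _) c (integrable_rl_bounded al0 t0 mu_ uB)).
by apply: eq_Rintegral => s _; rewrite mulrCA.
Qed.

(** Linearity reduces the case of a bounded source to that of a nonnegative
    one, by adding a constant to it. *)
Section Signed.
Variables (g : R -> R) (M : R).
Hypotheses (mg : measurable_fun [set: R] g) (gM : forall s, `|g s| <= M).

Let M0 : 0 <= M. Proof. exact: le_trans (gM 0). Qed.
Let h s := g s + M.
Let mh : measurable_fun [set: R] h. Proof. exact: measurable_funD. Qed.
Let h0 s : 0 <= h s.
Proof. by have := gM s; rewrite ler_norml /h -lerBlDr sub0r => /andP[]. Qed.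
Let hM s : `|h s| <= M + M.
Proof. by apply: (le_trans (ler_normD _ _)); apply: lerD => //; rewrite ger0_norm. Qed.
Let cM (s : R) : `|cst M s| <= M. Proof. by rewrite /= ger0_norm. Qed.
Let mc : measurable_fun [set: R] (cst M : R -> R). Proof. by []. Qed.

Let kconv_shift l : 0 <= l -> kconv l g = (fun t => kconv l h t - kconv l (cst M) t).
Proof.
move=> l0; apply/funext => t; rewrite !kconvE.
rewrite -(rRintegralB (measurable_itv _) (kconv_integrable rho01 mh hM t l0)
  (kconv_integrable rho01 mc cM t l0)).
by apply: eq_Rintegral => s _; rewrite /h -mulrBl addrK.
Qed.

Lemma measurable_kconv l : 0 <= l -> measurable_fun [set: R] (kconv l g).
Proof.
move=> l0; rewrite kconv_shift//; apply: measurable_funB.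
  exact: measurable_kconv_ge0.
by apply: measurable_kconv_ge0 => // s; exact: M0.
Qed.

(** The fractional integral of order [1 - rho] turns the equation
    D^rho v + l v = g with v 0 = 0 into an identity between integrals. *)
Lemma kconv_balance l t : 0 <= l -> 0 < t ->
  frac_integral (1 - rho) (kconv l g) t + l * frac_integral 1 (kconv l g) t =
  frac_integral 1 g t.
Proof.
move=> l0 t0.
have b1 := kconv_balance_ge0 mh hM h0 l0 t0.
have b2 := kconv_balance_ge0 mc cM (fun=> M0) l0 t0.
have m1 := measurable_kconv_ge0 mh h0 l0.
have m2 := measurable_kconv_ge0 mc (fun=> M0) l0.
have k1 s (st : 0 <= s <= t) := kconv_le_bound mh hM l0 st.
have k2 s (st : 0 <= s <= t) := kconv_le_bound mc cM l0 st.
have -> : frac_integral 1 g t = frac_integral 1 h t - frac_integral 1 (cst M) t.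
  rewrite -(frac_integralB ltr01 t0 mh mc (fun s _ => hM s) (fun s _ => cM s)).
  by congr frac_integral; apply/funext => s; rewrite /h addrK.
rewrite kconv_shift// (frac_integralB rho10 t0 m1 m2 k1 k2) (frac_integralB ltr01 t0 m1 m2 k1 k2).
by rewrite -b1 -b2 mulrBr opprD addrACA.
Qed.

End Signed.

Lemma ml1_ml_kernel l : (fun s : R => E 1 (- l * s `^ rho)) = ml_kernel rho 1 l.
Proof.
apply/funext => s.
by rewrite ml_kernelE subrr powRr0 mul1r.
Qed.

Lemma measurable_ml1 l : measurable_fun [set: R] (fun s : R => E 1 (- l * s `^ rho)).
Proof. by rewrite ml1_ml_kernel; exact: measurable_ml_kernel. Qed.

Lemma ml1_itv l s : 0 <= l -> 0 <= E 1 (- l * s `^ rho) <= 1.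
Proof.
move=> l0; rewrite mulNr.
have z0 : 0 <= l * s `^ rho by apply: mulr_ge0 => //; exact: powR_ge0.
by rewrite (ml1_ge0 rho01 z0) (ml1_le1 rho01 z0).
Qed.

Lemma ml1_norm l s : 0 <= l -> `|E 1 (- l * s `^ rho)| <= 1.
Proof. by move=> l0; have /andP[e0 e1] := ml1_itv s l0; rewrite ger0_norm. Qed.

Lemma ml1_balance l t : 0 <= l -> 0 < t ->
  frac_integral (1 - rho) (fun s => E 1 (- l * s `^ rho) - 1) t =
  - (l * frac_integral 1 (fun s => E 1 (- l * s `^ rho)) t).
Proof.
move=> l0 t0.
have c1 (s : R) : 0 <= s <= t -> `|cst (1 : R) s| <= 1 by rewrite /= normr1.
have mc1 : measurable_fun [set: R] (cst (1 : R)) by [].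
rewrite (frac_integralB rho10 t0 (measurable_ml1 l) mc1
  (fun s _ => ml1_norm s l0) c1).
rewrite ml1_ml_kernel.
have [_ ->] := ml_kernel_conv rho0 l rho10 ltr01 t0.
have [_ ->] := ml_kernel_conv rho0 l ltr01 ltr01 t0.
have -> : frac_integral (1 - rho) (cst 1) t = t `^ (1 - rho) / Gamma (1 - rho + 1).
  have := volterra_powR rho10 (@ltr01 R) t0.
  rewrite Gamma1 mulr1 addrK => e.
  have -> : frac_integral (1 - rho) (cst 1) t = (Gamma (1 - rho))^-1 *
      \int[mu]_(s in `[0, t]) ((t - s) `^ (1 - rho - 1) * s `^ (1 - 1)).
    rewrite frac_integralE; congr (_ * _); apply: eq_Rintegral => s _.
    by rewrite subrr powRr0.
  rewrite e; have := Gamma_gt0 rho10; move: (Gamma (1 - rho)) (Gamma _) (t `^ _) => p q u p0.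
  by rewrite -!mulrA mulKf ?gt_eqF// mulrC.
have -> : ml_kernel rho (1 - rho + 1) l t =
    t `^ (1 - rho) * E (1 - rho + 1) (- l * t `^ rho).
  by rewrite ml_kernelE addrK.
have -> : ml_kernel rho (1 + 1) l t = t * E (1 + 1) (- l * t `^ rho).
  by rewrite ml_kernelE addrK powRr1// ltW.
have m10 : 0 < 1 - rho + 1 by exact: addr_gt0.
rewrite (ml_rec rho0 _ m10).
have -> : 1 - rho + 1 + rho = 1 + 1 by lra.
have e : t `^ (1 - rho) * t `^ rho = t.
  by rewrite -powRD ?subrK ?powRr1 ?(ltW t0)// (gt_eqF t0) implybT.
rewrite -[X in _ = - (l * (X * _))]e.
move: (t `^ (1 - rho)) (t `^ rho) (E _ _) (Gamma _) => u v w p; ring.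
Qed.

(** Solution of D^rho v + l v = g, v 0 = p by variation of constants. *)
Definition mode_sol (l p : R) (g : R -> R) (t : R) : R :=
  p * E 1 (- l * t `^ rho) + kconv l g t.

Lemma mode_sol0 l p g : mode_sol l p g 0 = p.
Proof.
by rewrite /mode_sol kconv0 powR0 ?gt_eqF// mulr0 ml0// Gamma1 invr1 mulr1 addr0.
Qed.

Lemma measurable_mode_sol (l p : R) (g : R -> R) (M : R) : 0 <= l -> measurable_fun [set: R] g ->
  (forall s, `|g s| <= M) -> measurable_fun [set: R] (mode_sol l p g).
Proof.
move=> l0 mg gM; apply: measurable_funD; last exact: (measurable_kconv mg gM).
by apply: measurable_funM => //; exact: measurable_ml1.
Qed.

(** The Caputo derivative of the mode is the derivative of the left-hand side,
    so this is the equation integrated over [0, t]. *)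
Lemma mode_sol_balance (l p : R) (g : R -> R) (M t : R) : 0 <= l -> measurable_fun [set: R] g ->
  (forall s, `|g s| <= M) -> 0 < t ->
  frac_integral (1 - rho) (fun s => mode_sol l p g s - p) t =
  \int[mu]_(s in `[0, t]) (g s - l * mode_sol l p g s).
Proof.
move=> l0 mg gM t0.
have mk := measurable_kconv mg gM l0.
have k1 s (st : 0 <= s <= t) := kconv_le_bound mg gM l0 st.
have mE := measurable_ml1 l.
have mE1 : measurable_fun [set: R] (fun s : R => E 1 (- l * s `^ rho) - 1).
  by apply: measurable_funB.
have E1 s : 0 <= s <= t -> `|E 1 (- l * s `^ rho) - 1| <= 1.
  move=> _; have /andP[e0 e1] := ml1_itv s l0.
  by rewrite ler0_norm ?subr_le0// opprB gerBl.
have E2 s (_ : 0 <= s <= t) := ml1_norm s l0.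
have sc (c B : R) (u : R -> R) : (forall s, 0 <= s <= t -> `|u s| <= B) ->
    forall s, 0 <= s <= t -> `|c * u s| <= `|c| * B.
  by move=> uB s st; rewrite normrM; apply: ler_wpM2l; [exact: normr_ge0|exact: uB].
have mZ (c : R) (u : R -> R) : measurable_fun [set: R] u ->
    measurable_fun [set: R] (fun s => c * u s).
  by move=> mu_; apply: measurable_funM.
have -> : (fun s => mode_sol l p g s - p) =
    (fun s => kconv l g s - (- p) * (E 1 (- l * s `^ rho) - 1)).
  by apply/funext => s; rewrite /mode_sol; ring.
rewrite (frac_integralB rho10 t0 mk (mZ (- p) _ mE1) k1 (sc (- p) _ _ E1)).
rewrite (frac_integralZ (- p) rho10 t0 mE1 E1) ml1_balance//.
rewrite -frac_integral1.
have mS : measurable_fun [set: R] (mode_sol l p g).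
  exact: (measurable_mode_sol p l0 mg gM).
have [B SB] : exists B, forall s, 0 <= s <= t -> `|mode_sol l p g s| <= B.
  eexists => s st; apply: (le_trans (ler_normD _ _)).
  by apply: lerD; [exact: (sc p _ _ E2)|exact: k1].
rewrite (frac_integralB ltr01 t0 mg (mZ l _ mS) (fun s _ => gM s) (sc l _ _ SB)).
rewrite (frac_integralZ l ltr01 t0 mS SB).
have -> : frac_integral 1 (mode_sol l p g) t =
    frac_integral 1 (kconv l g) t + p * frac_integral 1 (fun s => E 1 (- l * s `^ rho)) t.
  have -> : mode_sol l p g = (fun s => kconv l g s - (- p) * E 1 (- l * s `^ rho)).
    by apply/funext => s; rewrite /mode_sol; ring.
  rewrite (frac_integralB ltr01 t0 mk (mZ (- p) _ mE) k1 (sc (- p) _ _ E2)).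
  by rewrite (frac_integralZ (- p) ltr01 t0 mE E2) mulNr opprK.
rewrite -(kconv_balance mg gM l0 t0); ring.
Qed.

End Balance.

(** * Iterated integrals over the torus *)


Section RowTopology.
Local Opaque integral.
Context {R : realType}.

Lemma continuous_seq (q : R -> R) (t : R) :
  (forall x : R^nat, x n @[n --> \oo] --> t -> q (x n) @[n --> \oo] --> q t) ->
  {for t, continuous q}.
Proof.
move=> H P Pq.
have := @cvg_within_seq R setT t (q t) q I (fun x _ => H x) P Pq.
rewrite /within/= => W.
have {}W : nbhs t (fun s => setT s -> P (q s)) by exact: W.
by apply: filterS W => s; exact.
Qed.

Lemma cvg_rowP (T : Type) (F : set_system T) (FF : Filter F) (n : nat)
    (f : T -> 'rV[R]_n) (l : 'rV[R]_n) :
  (forall j, f x 0 j @[x --> F] --> l 0 j) -> f x @[x --> F] --> l.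
Proof.
move=> H A [P lP PA].
have : \forall x \near F, forall j, P 0 j (f x 0 j).
  by apply: filter_forall => j; exact: (H j _ (lP 0 j)).
by apply: filterS => x Px; apply: PA => i j; rewrite (ord1 i).
Qed.

Definition cons_row (m : nat) (s : R) (y : 'rV[R]_m) : 'rV[R]_(m.+1) :=
  row_mx (const_mx s : 'rV[R]_1) y.

Lemma cons_row0 m s (y : 'rV[R]_m) : cons_row s y 0 ord0 = s.
Proof.
have -> : ord0 = lshift m (ord0 : 'I_1) :> 'I_(1 + m) by exact/val_inj.
by rewrite [LHS](row_mxEl (const_mx s : 'rV[R]_1)) mxE.
Qed.

Lemma cons_rowS m s (y : 'rV[R]_m) j : cons_row s y 0 (lift ord0 j) = y 0 j.
Proof.
have -> : lift ord0 j = rshift 1 j :> 'I_(1 + m) by exact/val_inj.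
exact: (row_mxEr (const_mx s : 'rV[R]_1)).
Qed.

Lemma row_consE m (x : 'rV[R]_(m.+1)) :
  x = cons_row (x 0 ord0) (\row_j x 0 (lift ord0 j)).
Proof.
apply/rowP => j; case: (unliftP ord0 j) => [k|] ->; last by rewrite cons_row0.
by rewrite cons_rowS mxE.
Qed.

Lemma cvg_cons_row (T : Type) (F : set_system T) (FF : Filter F) m
    (s : T -> R) (y : T -> 'rV[R]_m) (s0 : R) (y0 : 'rV[R]_m) :
  s x @[x --> F] --> s0 -> y x @[x --> F] --> y0 ->
  cons_row (s x) (y x) @[x --> F] --> cons_row s0 y0.
Proof.
move=> cs cy; apply: cvg_rowP => j; case: (unliftP ord0 j) => [k|] ->.
  rewrite cons_rowS; under eq_cvg do rewrite cons_rowS.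
  apply: (@cvg_comp _ _ _ y (fun M : 'rV[R]_m => M 0 k) _ _ _ cy).
  exact: coord_continuous.
by rewrite cons_row0; under eq_cvg do rewrite cons_row0.
Qed.

Definition slice (m : nat) (g : 'rV[R]_(m.+1) -> R) (s : R) : 'rV[R]_m -> R :=
  fun y => g (cons_row s y).

Lemma continuous_slice m g s : continuous g -> continuous (@slice m g s).
Proof.
move=> cg y; apply: (@cvg_comp _ _ _ (cons_row s) g); last exact: cg.
have c1 : (fun _ : 'rV[R]_m => s) z @[z --> y] --> s by exact: cst_continuous.
exact: (@cvg_cons_row _ (nbhs y) (nbhs_filter (y : 'rV[R]_m)) m (fun=> s) id s y c1
  (@cvg_id _ _)).
Qed.

End RowTopology.

Section TorusIntegral.
Local Opaque integral.
Context {R : realType}.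
Local Notation mu := (@lebesgue_measure R).
Local Notation I := (`]- pi, pi]%classic : set R).
Local Notation TI := (@torus_integral R _).

Lemma torus_integralS m (g : 'rV[R]_(m.+1) -> R) :
  TI g = \int[mu]_(s in I) TI (slice g s).
Proof. by []. Qed.

Lemma measure_torus1 : mu I = (2 * pi)%:E.
Proof.
have p0 := pi_gt0 R.
rewrite lebesgue_measure_itv/= lte_fin ifT; last by lra.
by rewrite -EFinB; congr EFin; lra.
Qed.

Lemma integrable_torus1_cst (c : R) : mu.-integrable I (EFin \o cst c).
Proof.
apply/integrableP; split; first exact/measurable_EFinP.
under eq_integral do rewrite /=.
by rewrite integral_cst//= measure_torus1 ltry.
Qed.

Lemma integrable_torus1 (h : R -> R) (M : R) : measurable_fun [set: R] h ->
  (forall s, `|h s| <= M) -> mu.-integrable I (EFin \o h).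
Proof.
move=> mh hM; apply: (@rintegrable_le _ _ _ _ (cst M)) => //.
  exact: measurable_funTS.
exact: integrable_torus1_cst.
Qed.

Lemma two_pi_gt0 : 0 < 2 * pi :> R.
Proof. by rewrite mulr_gt0 ?pi_gt0. Qed.

Lemma Rintegral_torus1_bound (h : R -> R) (M : R) : measurable_fun [set: R] h ->
  (forall s, `|h s| <= M) -> `|\int[mu]_(s in I) h s| <= 2 * pi * M.
Proof.
move=> mh hM; have ih := integrable_torus1 mh hM.
apply: (le_trans (le_normr_Rintegral _ ih)) => //.
have mc : measurable_fun [set: R] (cst M) by [].
have M0 : 0 <= M by exact: le_trans (hM 0).
have ic : mu.-integrable I (EFin \o cst M).
  by apply: (integrable_torus1 (M := M)) => // s; rewrite /= ger0_norm.
apply: (@le_trans _ _ (\int[mu]_(s in I) M)).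
  by apply: le_Rintegral => //; exact: rintegrable_norm.
by rewrite Rintegral_cst//= measure_torus1/= mulrC.
Qed.

(** Dominated convergence is the only property of the torus integral from
    which its regularity in parameters is derived; the induction step needs
    it to know that the inner integrals are continuous. *)
Lemma torus_integral_facts (n : nat) :
  [/\ (forall (gk : nat -> 'rV[R]_n -> R) (g : 'rV[R]_n -> R) (M : R),
        (forall k, continuous (gk k)) -> continuous g ->
        (forall k x, `|gk k x| <= M) -> (forall x, `|g x| <= M) ->
        (forall x, gk k x @[k --> \oo] --> g x) ->
        TI (gk k) @[k --> \oo] --> TI g),
      (forall (g : 'rV[R]_n -> R) (M : R), continuous g ->
        (forall x, `|g x| <= M) -> `|TI g| <= (2 * pi) ^+ n * M)
    & (forall (g h : 'rV[R]_n -> R) (M K c : R), continuous g -> continuous h ->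
        (forall x, `|g x| <= M) -> (forall x, `|h x| <= K) ->
        TI (fun x => c * g x + h x) = c * TI g + TI h)].
Proof.
elim: n => [|m [dct bd lin]].
  split; last by [].
  - by move=> gk g M _ _ _ _ gkg; exact: gkg.
  - by move=> g M _ gM; rewrite expr0 mul1r; exact: gM.
have cinner (g : 'rV[R]_(m.+1) -> R) (M : R) : continuous g ->
    (forall x, `|g x| <= M) -> continuous (fun s => TI (slice g s)).
  move=> cg gM s; apply: continuous_seq => x xs.
  apply: (dct _ _ M).
  - by move=> k; exact: continuous_slice.
  - exact: continuous_slice.
  - by move=> k y; exact: gM.
  - by move=> y; exact: gM.
  - move=> y; apply: (@cvg_comp _ _ _ (fun k => cons_row (x k) y) g); last exact: cg.
    by apply: cvg_cons_row => //; exact: cvg_cst.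
have binner (g : 'rV[R]_(m.+1) -> R) (M : R) : continuous g ->
    (forall x, `|g x| <= M) -> forall s, `|TI (slice g s)| <= (2 * pi) ^+ m * M.
  by move=> cg gM s; apply: bd => [|y]; [exact: continuous_slice|exact: gM].
have minner g M cg gM := continuous_measurable_fun (cinner g M cg gM).
split.
- move=> gk g M cgk cg gkM gM gkg.
  have ic : mu.-integrable I (EFin \o cst ((2 * pi) ^+ m * M)).
    exact: integrable_torus1_cst.
  have := @dominated_convergence _ _ R mu I (measurable_itv _)
    (fun k s => (TI (slice (gk k) s))%:E) (fun s => (TI (slice g s))%:E)
    (EFin \o cst ((2 * pi) ^+ m * M)) _ _ _ ic _.
  case => //.
  + move=> k; apply/measurable_EFinP; apply: measurable_funTS.
    exact: (minner _ M (cgk k) (gkM k)).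
  + apply/measurable_EFinP; apply: measurable_funTS.
    exact: (minner _ M cg gM).
  + apply: aeW => s _; apply/cvg_EFin; first exact: nearW.
    apply: (dct _ _ M).
    * by move=> k; exact: continuous_slice.
    * exact: continuous_slice.
    * by move=> k y; exact: gkM.
    * by move=> y; exact: gM.
    * by move=> y; exact: (gkg (cons_row s y)).
  + by apply: aeW => s k _ /=; rewrite lee_fin; exact: binner.
  move=> iF _ cv.
  have /fine_cvg : (\int[mu]_(s in I) (TI (slice (gk k) s))%:E @[k --> \oo] -->
      (\int[mu]_(s in I) (TI (slice g s)))%R%:E)%E.
    by rewrite /Rintegral fineK//; exact: integrable_fin_num.
  exact.
- move=> g M cg gM; rewrite torus_integralS exprS -mulrA.
  by apply: Rintegral_torus1_bound; [exact: (minner _ M)|exact: binner].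
- move=> g h M K c cg ch gM hK; rewrite !torus_integralS.
  have ig := integrable_torus1 (minner _ M cg gM) (binner _ M cg gM).
  have ih := integrable_torus1 (minner _ K ch hK) (binner _ K ch hK).
  rewrite -(rRintegralZ (measurable_itv _) c ig).
  rewrite -(rRintegralD (measurable_itv _) (rintegrableZ (measurable_itv _) c ig) ih).
  apply: eq_Rintegral => s _; apply: (lin _ _ M K).
  + exact: continuous_slice.
  + exact: continuous_slice.
  + by move=> y; exact: gM.
  + by move=> y; exact: hK.
Qed.

Lemma torus_integral_bound n (g : 'rV[R]_n -> R) (M : R) : continuous g ->
  (forall x, `|g x| <= M) -> `|TI g| <= (2 * pi) ^+ n * M.
Proof. by have [_ bd _] := torus_integral_facts n; exact: bd. Qed.

Lemma torus_integral_dct n (gk : nat -> 'rV[R]_n -> R) (g : 'rV[R]_n -> R) (M : R) :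
  (forall k, continuous (gk k)) -> continuous g ->
  (forall k x, `|gk k x| <= M) -> (forall x, `|g x| <= M) ->
  (forall x, gk k x @[k --> \oo] --> g x) ->
  TI (gk k) @[k --> \oo] --> TI g.
Proof. by have [dct _ _] := torus_integral_facts n; exact: dct. Qed.

Lemma torus_integral0 n : TI (fun _ : 'rV[R]_n => 0) = 0.
Proof.
apply/eqP; rewrite -normr_le0 -[leRHS](mulr0 ((2 * pi) ^+ n)).
apply: torus_integral_bound => [|x]; last by rewrite normr0.
exact: cst_continuous.
Qed.

Lemma torus_integralZ n (c : R) (g : 'rV[R]_n -> R) (M : R) : continuous g ->
  (forall x, `|g x| <= M) -> TI (fun x => c * g x) = c * TI g.
Proof.
move=> cg gM; have [_ _ lin] := torus_integral_facts n.
have c0 : continuous (fun _ : 'rV[R]_n => 0 : R) by exact: cst_continuous.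
have z0 (x : 'rV[R]_n) : `|0 : R| <= 0 by rewrite normr0.
rewrite -[RHS]addr0 -(torus_integral0 n) -(lin _ _ _ _ c cg c0 gM z0).
by congr (TI _); apply/funext => x; rewrite addr0.
Qed.

Lemma torus_integralD n (g h : 'rV[R]_n -> R) (M K : R) : continuous g ->
  continuous h -> (forall x, `|g x| <= M) -> (forall x, `|h x| <= K) ->
  TI (fun x => g x + h x) = TI g + TI h.
Proof.
move=> cg ch gM hK; have [_ _ lin] := torus_integral_facts n.
rewrite -[TI g]mul1r -(lin _ _ _ _ 1 cg ch gM hK).
by congr (TI _); apply/funext => x; rewrite mul1r.
Qed.

Lemma continuous_inner_torus_integral m (g : 'rV[R]_(m.+1) -> R) (M : R) :
  continuous g -> (forall x, `|g x| <= M) -> continuous (fun s => TI (slice g s)).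
Proof.
move=> cg gM s; apply: continuous_seq => x xs.
apply: (torus_integral_dct (M := M)).
- by move=> k; exact: continuous_slice.
- exact: continuous_slice.
- by move=> k y; exact: gM.
- by move=> y; exact: gM.
- move=> y; apply: (@cvg_comp _ _ _ (fun k => cons_row (x k) y) g); last exact: cg.
  by apply: cvg_cons_row => //; exact: cvg_cst.
Qed.

End TorusIntegral.

(** * Waves and uniqueness of Fourier coefficients *)


Section Periodic.
Local Opaque integral.
Context {R : realType}.

Lemma periodic_int (h : R -> R) (p : R) : (forall s, h (s + p) = h s) ->
  forall (m : int) s, h (s + m%:~R * p) = h s.
Proof.
move=> hp.
have hn (n : nat) s : h (s + n%:R * p) = h s.
  elim: n s => [|n ih] s; first by rewrite mul0r addr0.
  by rewrite -natr1 mulrDl mul1r addrA hp ih.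
move=> [n|n] s; first by rewrite hn.
rewrite NegzE mulrNz mulNr -[LHS](hn n.+1) subrK //.
Qed.

Lemma cosD2pi' (x : R) : cos (x + 2 * pi) = cos x.
Proof. by rewrite mulr_natl cosD2pi. Qed.

Lemma sinD2pi' (x : R) : sin (x + 2 * pi) = sin x.
Proof. by rewrite mulr_natl sinD2pi. Qed.

Lemma reduce_angle (s : R) : exists m : int, - pi <= s + m%:~R * (2 * pi) <= pi.
Proof.
have p0 := two_pi_gt0 (R := R).
exists (- Num.floor ((s + pi) / (2 * pi))).
have h1 := Num.Theory.floor_le ((s + pi) / (2 * pi)).
have h2 := Num.Theory.floorD1_gt ((s + pi) / (2 * pi)).
move: h1 h2; rewrite intrD ler_pdivlMr// ltr_pdivrMr// mulrNz.
move: (_%:~R) => k h1 h2; apply/andP; split; lra.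
Qed.

End Periodic.

Section DeriveAffine.
Local Opaque integral.
Context {R : realType}.

Lemma is_derive_affine (th k s : R) : is_derive s 1 (fun s : R => th + k * s) k.
Proof.
have -> : (fun s : R => th + k * s) = cst th + k \*: id by apply/funext.
have D := is_deriveD (is_derive_cst th s (1 : R)) (is_deriveZ k (is_derive_id s (1 : R))).
by apply: (is_derive_eq (f' := 0 + k *: (1 : R))); rewrite add0r [_ *: _]mulr1.
Qed.

Lemma is_derive_comp_affine (f df : R -> R) (th k s : R) :
  (forall x : R, is_derive x (1 : R) f (df x)) ->
  is_derive s (1 : R) (fun s : R => f (th + k * s)) (k * df (th + k * s)).
Proof.
move=> Df; have Da := is_derive_affine th k s.
have dd : derivable (fun s : R => f (th + k * s)) s 1.
  apply/derivable1_diffP; apply: (@differentiable_comp _ _ _ _ (fun s : R => th + k * s) f).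
    by apply/derivable1_diffP; have [] := Da.
  by apply/derivable1_diffP; have [] := Df (th + k * s).
apply: DeriveDef => //; rewrite -derive1E.
rewrite (@derive1_comp _ (fun s : R => th + k * s) f).
- by rewrite !derive1E; have -> := @derive_val _ _ _ _ _ _ _ Da; have Dx := Df (th + k * s); rewrite derive_val mulrC.
- by have [] := Da.
- by have [] := Df (th + k * s).
Qed.
End DeriveAffine.

Section Wave1.
Local Opaque integral.
Context {R : realType}.
Local Notation mu := (@lebesgue_measure R).
Local Notation I := (`]- pi, pi]%classic : set R).

Lemma continuous_cos_affine (th k : R) : continuous (fun s : R => cos (th + k * s)).
Proof.
move=> s; apply: (@cvg_comp _ _ _ (fun s : R => th + k * s) cos); last exact: continuous_cos.
by apply: cvgD; [exact: cvg_cst|apply: cvgM; [exact: cvg_cst|exact: cvg_id]].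
Qed.

Lemma Rintegral_wave1 (th : R) (k : int) :
  \int[mu]_(s in I) cos (th + k%:~R * s) = if k == 0 then 2 * pi * cos th else 0.
Proof.
have p0 := pi_gt0 R.
case: eqVneq => [->|k0].
  under eq_Rintegral do rewrite mul0r addr0.
  by rewrite Rintegral_cst//= measure_torus1 mulrC.
have kR : k%:~R != 0 :> R by rewrite intr_eq0.
pose F (s : R) := sin (th + k%:~R * s) / k%:~R.
have dF (s : R) : is_derive s 1 F (cos (th + k%:~R * s)).
  have -> : F = (k%:~R)^-1 \*: (fun s => sin (th + k%:~R * s)).
    by apply/funext => x; rewrite /F mulrC.
  have D := is_derive_comp_affine th k%:~R s (@is_derive_sin R).
  apply: (is_derive_eq (is_deriveZ (k%:~R)^-1 D)).
  by rewrite [_ *: _]mulrA mulVf ?mul1r.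
have cF (s : R) : {for s, continuous F}.
  apply: differentiable_continuous.
  by apply/derivable1_diffP; have [] := dF s.
have pp : - pi < pi :> R by lra.
have cI : continuous (fun s : R => cos (th + k%:~R * s)) by exact: continuous_cos_affine.
rewrite Rintegral_itv_obnd_cbnd; last first.
  by apply: (integrable_torus1 (M := 1)) => [|s]; [exact: continuous_measurable_fun|exact: cos_max].
rewrite /Rintegral (@continuous_FTC2 _ _ F)//.
- rewrite -EFinB /= /F -mulrBl.
  have -> : th + k%:~R * pi = th + k%:~R * - pi + k%:~R * (2 * pi) by ring.
  by rewrite (periodic_int (@sinD2pi' R)) subrr mul0r.
- by apply: continuous_subspaceT.
- split.
  + by move=> x _; have [] := dF x.
  + by apply: cvg_at_right_filter; exact: cF.
  + by apply: cvg_at_left_filter; exact: cF.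
- by move=> x _; rewrite derive1E; have D := dF x; rewrite derive_val.
Qed.

Section Uniqueness1.
Variables (w : R -> R) (M : R).
Hypotheses (cw : continuous w) (wM : forall s, `|w s| <= M).
Hypothesis w0 : forall th (k : int), \int[mu]_(s in I) (w s * cos (th + k%:~R * s)) = 0.

Let M0 : 0 <= M. Proof. exact: le_trans (wM 0). Qed.

(** Its powers are trigonometric polynomials that concentrate at [x0], the
    kernels of de la Vallee Poussin. *)
Definition peak (x0 s : R) : R := (1 + cos (s - x0)) / 2.

Lemma peak_itv x0 s : 0 <= peak x0 s <= 1.
Proof. by have := cos_geN1 (s - x0); have := cos_le1 (s - x0); rewrite /peak; lra. Qed.

Lemma continuous_peak x0 : continuous (peak x0).
Proof.
move=> s; apply: cvgM; last exact: cvg_cst.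
apply: cvgD; first exact: cvg_cst.
apply: (@cvg_comp _ _ _ (fun s : R => s - x0) cos); last exact: continuous_cos.
by apply: cvgB; [exact: cvg_id|exact: cvg_cst].
Qed.

Let ipeak x0 k th (n : int) : mu.-integrable I
  (EFin \o (fun s => w s * peak x0 s ^+ k * cos (th + n%:~R * s))).
Proof.
apply: (integrable_torus1 (M := M)) => [|s].
  apply: continuous_measurable_fun => s; apply: cvgM; last exact: continuous_cos_affine.
  apply: cvgM; first exact: cw.
  apply: (@cvg_comp _ _ _ (peak x0) (fun y => y ^+ k)); first exact: continuous_peak.
  exact: exprn_continuous.
rewrite !normrM -[leRHS]mulr1; apply: ler_pM; last exact: cos_max.
- by apply: mulr_ge0; exact: normr_ge0.
- exact: normr_ge0.
rewrite -[leRHS]mulr1; apply: ler_pM => //.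
have /andP[p0 p1] := peak_itv x0 s.
by rewrite ger0_norm ?exprn_ge0// exprn_ile1.
Qed.

(** Multiplication by [peak] replaces a wave by a combination of waves whose
    frequencies differ by at most 1. *)
Lemma moment_peak x0 k th (n : int) :
  \int[mu]_(s in I) (w s * peak x0 s ^+ k * cos (th + n%:~R * s)) = 0.
Proof.
elim: k th n => [|k ih] th n.
  by under eq_Rintegral do rewrite expr0 mulr1; exact: w0.
pose u th n s := w s * peak x0 s ^+ k * cos (th + n%:~R * s).
have iu th' n' : mu.-integrable I (EFin \o u th' n') by exact: ipeak.
have e (s : R) : w s * peak x0 s ^+ k.+1 * cos (th + n%:~R * s) =
    2^-1 * u th n s + (4^-1 * u (th - x0) (n + 1) s + 4^-1 * u (th + x0) (n - 1) s).
  have c1 : (th - x0) + (n + 1)%:~R * s = (th + n%:~R * s) + (s - x0).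
    by rewrite intrD; ring.
  have c2 : (th + x0) + (n - 1)%:~R * s = (th + n%:~R * s) - (s - x0).
    by rewrite intrB; ring.
  rewrite /u c1 c2 exprS /peak; move: (th + n%:~R * s) (s - x0) => A B.
  rewrite cosD cosB; move: (((1 + cos B) / 2) ^+ k) => p.
  by move: (cos A) (sin A) (cos B) (sin B) (w s) => a b c d v; field.
under eq_Rintegral do rewrite e.
have mI : measurable (I : set R) by exact: measurable_itv.
rewrite rRintegralD//; last 2 first.
- exact: rintegrableZ.
- by apply: rintegrableD => //; exact: rintegrableZ.
rewrite rRintegralD//; last 2 first.
- exact: rintegrableZ.
- exact: rintegrableZ.
by rewrite !rRintegralZ// /u !ih !mulr0 !addr0.
Qed.

Lemma cos_far (x0 s d : R) : - pi < x0 - d -> x0 + d < pi -> 0 < d ->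
  - pi < s <= pi -> d <= `|s - x0| -> cos (s - x0) <= cos d.
Proof.
move=> h1 h2 d0 /andP[s1 s2] ds.
have p0 := pi_gt0 R.
have dp : d <= pi by lra.
rewrite -cos_norm; set y := `|s - x0| in ds *.
have y2 : y <= 2 * pi - d.
  by rewrite /y ler_norml; apply/andP; split; lra.
have cdec (a b : R) : 0 <= a -> a <= b -> b <= pi -> cos b <= cos a.
  move=> a0; rewrite le_eqVlt => /predU1P[->//|ab] bp.
  by rewrite ltW// ltr_cos// in_itv/=; apply/andP; split; lra.
have [yp|yp] := leP y pi; first by apply: cdec => //; lra.
have -> : cos y = cos (2 * pi - y).
  by have := cosD2pi' (- y); rewrite cosN (addrC (- y)).
by apply: cdec; lra.
Qed.

(** If w x0 > 0, then the integral of w (peak x0)^k over a small interval about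
    [x0] decays in [k] with a strictly larger ratio than the contribution of the
    points where [w] may be negative; so the two cannot cancel. *)
Lemma uniqueness1_pos (x0 : R) : - pi < x0 < pi -> w x0 <= 0.
Proof.
move=> /andP[x1 x2]; rewrite leNgt; apply/negP => wp.
have p0 := pi_gt0 R.
pose c := w x0 / 2; have c0 : 0 < c by rewrite /c; lra.
have cx : c < w x0 by rewrite /c; lra.
have [d1 /= d10 Hd1] := cvgr_gt _ (cw (x := x0)) _ cx.
have [d [d0 dd h1 h2]] : exists d, [/\ 0 < d, d < d1, - pi < x0 - d & x0 + d < pi].
  exists (Num.min (d1 / 2) (Num.min ((x0 + pi) / 2) ((pi - x0) / 2))).
  rewrite !lt_min !gt_min.
  split.
  - by apply/and3P; split; lra.
  - by apply/orP; left; lra.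
  - have : Num.min (d1 / 2) (Num.min ((x0 + pi) / 2) ((pi - x0) / 2)) <= (x0 + pi) / 2.
      by rewrite !ge_min lexx orbT.
    lra.
  - have : Num.min (d1 / 2) (Num.min ((x0 + pi) / 2) ((pi - x0) / 2)) <= (pi - x0) / 2.
      by rewrite !ge_min lexx !orbT.
    lra.
have wc s : `|s - x0| <= d -> c < w s.
  by move=> sd; apply: Hd1 => /=; rewrite distrC; exact: le_lt_trans dd.
(* upper bound of the peak far from x0 and lower bound near x0 *)
pose q := (1 + cos d) / 2; pose q' := (1 + cos (d / 2)) / 2.
have qq : q < q'.
  rewrite /q /q'; have : cos d < cos (d / 2).
    by rewrite ltr_cos ?in_itv/=; [lra|apply/andP; split; lra|apply/andP; split; lra].
  lra.
have q0 : 0 <= q by have := cos_geN1 d; rewrite /q; lra.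
have q'0 : 0 < q' by exact: le_lt_trans qq.
pose J := `[x0 - d / 2, x0 + d / 2]%classic : set R.
have key k : c * d * q' ^+ k <= 2 * pi * M * q ^+ k.
  have := moment_peak x0 k 0 0.
  have -> : \int[mu]_(s in I) (w s * peak x0 s ^+ k * cos (0 + 0%:~R * s)) =
      \int[mu]_(s in I) (w s * peak x0 s ^+ k).
    by apply: eq_Rintegral => s _; rewrite mul0r addr0 cos0 mulr1.
  move=> z.
  have iL : mu.-integrable I (EFin \o (fun s => w s * peak x0 s ^+ k)).
    have := ipeak x0 k 0 0.
    by apply: eq_integrable => // s _ /=; rewrite mul0r addr0 cos0 mulr1.
  have mind : measurable_fun [set: R] (\1_J : R -> R).
    by apply: measurable_indic; exact: measurable_itv.
  have i1 : mu.-integrable I (EFin \o (\1_J : R -> R)).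
    apply: (integrable_torus1 (M := 1)) => // s.
    by rewrite indicE; case: (_ \in _); rewrite ?normr1 ?normr0.
  have iM : mu.-integrable I (EFin \o cst (M * q ^+ k)).
    exact: integrable_torus1_cst.
  have : \int[mu]_(s in I) (c * q' ^+ k * \1_J s - M * q ^+ k) <= 0.
    rewrite -z; apply: le_Rintegral => //.
      by apply: rintegrableB => //; exact: rintegrableZ.
    move=> s; rewrite /= in_itv/= => sI.
    have /andP[pk0 pk1] := peak_itv x0 s.
    rewrite indicE /J mem_setE in_itv/=.
    have MQ : 0 <= M * q ^+ k by apply: mulr_ge0 => //; exact: exprn_ge0.
    case: (boolP (x0 - d / 2 <= s <= x0 + d / 2)) => [/andP[j1 j2]|_] /=.
      have sd2 : `|s - x0| <= d / 2 by rewrite ler_norml; apply/andP; split; lra.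
      rewrite mulr1n mulr1; apply: (@le_trans _ _ (c * q' ^+ k)); first by rewrite gerBl.
      apply: ler_pM; [exact: ltW|exact/exprn_ge0/ltW|by apply/ltW/wc; lra|].
      rewrite lerXn2r ?nnegrE// ?(ltW q'0)//.
      rewrite /q' /peak; have : cos (d / 2) <= cos (s - x0); last by lra.
      rewrite -[cos (s - x0)]cos_norm.
      move: sd2; rewrite le_eqVlt => /predU1P[->//|sd2].
      by rewrite ltW// ltr_cos// in_itv/= ?normr_ge0/=; [lra|apply/andP; split; lra].
    rewrite mulr0n mulr0 sub0r.
    have [sd|sd] := leP `|s - x0| d.
      apply: (@le_trans _ _ 0); first by rewrite oppr_le0.
      apply: mulr_ge0; last exact: exprn_ge0.
      by apply/ltW/(lt_trans c0)/wc.
    have ps : peak x0 s <= q.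
      by rewrite /peak /q; have := cos_far h1 h2 d0 sI (ltW sd); lra.
    have : `|w s * peak x0 s ^+ k| <= M * q ^+ k.
      rewrite normrM; apply: ler_pM => //.
      rewrite ger0_norm ?exprn_ge0//.
      by rewrite lerXn2r ?nnegrE.
    by rewrite ler_norml => /andP[].
  rewrite rRintegralB//; last exact: rintegrableZ.
  rewrite rRintegralZ// Rintegral_cst//= measure_torus1/=.
  have -> : \int[mu]_(s in I) \1_J s = d.
    have mJ : measurable (J : set R) by exact: measurable_itv.
    have muJ : mu J = d%:E.
      rewrite /J lebesgue_measure_itv/= lte_fin ifT; last by lra.
      by rewrite -EFinB; congr EFin; lra.
    rewrite /Rintegral integral_indic// setIidl; first by rewrite [X in fine X]muJ.
    by move=> s; rewrite /J /= !in_itv/= => /andP[? ?]; apply/andP; split; lra.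
  by lra.
have r1 : `|q / q'| < 1.
  by rewrite ger0_norm ?divr_ge0 ?(ltW q'0)// ltr_pdivrMr// mul1r.
have cd0 : 0 < c * d by exact: mulr_gt0.
have := cvg_geometric (2 * pi * M) r1.
move=> /cvgrPdist_lt /(_ _ cd0) [k _ /(_ k (leqnn k))].
rewrite /= sub0r normrN => /(le_lt_trans (ler_norm _)).
apply/negP; rewrite -leNgt /geometric/= expr_div_n mulrA ler_pdivlMr ?exprn_gt0//.
Qed.

(** The endpoints are limits of interior points. *)
Lemma uniqueness1_le (s : R) : - pi <= s <= pi -> w s <= 0.
Proof.
move=> /andP[s1 s2]; rewrite leNgt; apply/negP => ws.
have p0 := pi_gt0 R.
have [e /= e0 He] := cvgr_gt _ (cw (x := s)) _ ws.
have [n [n0 n1 ne]] : exists n : R, [/\ 0 < n, n < 1 & n * pi < e].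
  exists (Num.min (1 / 2) (e / (2 * pi))).
  rewrite lt_min gt_min !divr_gt0//=; last by lra.
  split => //; first by apply/orP; left; lra.
  apply: (@le_lt_trans _ _ (e / (2 * pi) * pi)).
    by rewrite ler_wpM2r ?(ltW p0)// ge_min lexx orbT.
  by rewrite invfM mulrA mulfVK ?gt_eqF//; lra.
have := @uniqueness1_pos (s * (1 - n)).
have n1' : 0 < 1 - n by lra.
have h1 : - pi * (1 - n) <= s * (1 - n) by rewrite ler_wpM2r// ltW.
have h2 : s * (1 - n) <= pi * (1 - n) by rewrite ler_wpM2r// ltW.
have h3 : 0 < pi * n by exact: mulr_gt0.
rewrite (_ : - pi < _ < _); last by apply/andP; split; lra.
move=> /(_ isT); apply/negP; rewrite -ltNge; apply: He => /=.
have -> : s - s * (1 - n) = s * n by ring.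
apply: le_lt_trans ne; rewrite normrM (gtr0_norm n0) mulrC.
by apply: ler_wpM2l; [exact: ltW|rewrite ler_norml s1].
Qed.

End Uniqueness1.

Lemma uniqueness1 (w : R -> R) (M : R) : continuous w -> (forall s, `|w s| <= M) ->
  (forall s, w (s + 2 * pi) = w s) ->
  (forall th (k : int), \int[mu]_(s in I) (w s * cos (th + k%:~R * s)) = 0) ->
  forall s, w s = 0.
Proof.
move=> cw wM wp w0 s.
have [m ms] := reduce_angle s.
rewrite -(periodic_int wp m s).
have le1 := uniqueness1_le cw wM w0 ms.
have cN : continuous (fun s => - w s) by move=> x; apply: cvgN; exact: cw.
have NM x : `|- w x| <= M by rewrite normrN.
have N0 th (k : int) : \int[mu]_(s in I) (- w s * cos (th + k%:~R * s)) = 0.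
  have iw : mu.-integrable I (EFin \o (fun s => w s * cos (th + k%:~R * s))).
    apply: (integrable_torus1 (M := M)) => [|x].
      apply: continuous_measurable_fun => x; apply: cvgM; first exact: cw.
      exact: continuous_cos_affine.
    rewrite normrM -[leRHS]mulr1; apply: ler_pM => //; exact: cos_max.
  have := rRintegralZ (measurable_itv _) (-1) iw.
  rewrite w0 mulr0 => <-; apply: eq_Rintegral => x _.
  by rewrite mulN1r mulNr.
have := uniqueness1_le cN NM N0 ms.
by rewrite oppr_le0 => le2; apply/eqP; rewrite eq_le le1 le2.
Qed.

End Wave1.

Section WaveN.
Local Opaque integral.
Context {R : realType}.
Local Notation mu := (@lebesgue_measure R).
Local Notation I := (`]- pi, pi]%classic : set R).
Local Notation TI := (@torus_integral R _).

Lemma row_continuousM N (u v : 'rV[R]_N -> R) : continuous u -> continuous v ->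
  continuous (fun x => u x * v x).
Proof.
move=> cu cv x; have FF := nbhs_filter (x : 'rV[R]_N).
exact: (@cvgM _ _ _ FF u v _ _ (cu x) (cv x)).
Qed.

Lemma row_continuousD N (u v : 'rV[R]_N -> R) : continuous u -> continuous v ->
  continuous (fun x => u x + v x).
Proof.
move=> cu cv x; have FF := nbhs_filter (x : 'rV[R]_N).
exact: (@cvgD _ _ _ _ FF u v _ _ (cu x) (cv x)).
Qed.

Lemma row_continuousZ N (c : R) (u : 'rV[R]_N -> R) : continuous u ->
  continuous (fun x => c * u x).
Proof. by move=> cu; apply: row_continuousM => //; exact: cst_continuous. Qed.

Lemma continuous_dotn N (n : 'rV[int]_N) : continuous (fun x : 'rV[R]_N => dotn n x).
Proof.
move=> x; have FF := nbhs_filter (x : 'rV[R]_N).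
apply: (@cvg_big _ _ _ _ _ add_continuous _ _ _ _ _ FF) => j _.
apply: (@cvg_comp _ _ _ (fun M : 'rV[R]_N => M 0 j) (fun r => (n 0 j)%:~R * r)).
  exact: coord_continuous.
by move=> P; apply: (@mulrl_continuous R (n 0 j)%:~R).
Qed.

Lemma continuous_cos_dotn N (th : R) (n : 'rV[int]_N) :
  continuous (fun x : 'rV[R]_N => cos (th + dotn n x)).
Proof.
move=> x; apply: (@cvg_comp _ _ _ (dotn n) (fun r => cos (th + r))).
  exact: continuous_dotn.
have := @continuous_cos_affine R th 1 (dotn n x).
by under eq_fun do rewrite mul1r.
Qed.

Definition tail_row m (n : 'rV[int]_(m.+1)) : 'rV[int]_m :=
  \row_j n 0 (lift ord0 j).

Lemma dotn_cons m (n : 'rV[int]_(m.+1)) (s : R) (y : 'rV[R]_m) :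
  dotn n (cons_row s y) = (n 0 ord0)%:~R * s + dotn (tail_row n) y.
Proof.
rewrite /dotn big_ord_recl cons_row0; congr (_ + _).
by apply: eq_bigr => j _; rewrite cons_rowS mxE.
Qed.

Lemma row_eq0 m (n : 'rV[int]_(m.+1)) :
  (n == 0) = (n 0 ord0 == 0) && (tail_row n == 0).
Proof.
apply/eqP/andP => [->|[/eqP n0 /eqP nt]].
  by rewrite mxE eqxx; split => //; apply/eqP/rowP => j; rewrite !mxE.
apply/rowP => j; case: (unliftP ord0 j) => [k|] ->; last by rewrite n0 mxE.
by have /rowP /(_ k) := nt; rewrite !mxE.
Qed.

Lemma torus_integral_wave N (th : R) (n : 'rV[int]_N) :
  TI (fun x => cos (th + dotn n x)) = if n == 0 then (2 * pi) ^+ N * cos th else 0.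
Proof.
elim: N th n => [|m ih] th n /=.
  have -> : n = 0 by apply/rowP => -[].
  by rewrite eqxx expr0 mul1r /dotn big_ord0 addr0.
rewrite row_eq0.
have -> : \int[mu]_(s in I) TI (fun y : 'rV[R]_m => cos (th + dotn n (cons_row s y))) =
    \int[mu]_(s in I) (if tail_row n == 0 then (2 * pi) ^+ m * cos (th + (n 0 ord0)%:~R * s) else 0).
  apply: eq_Rintegral => s _; rewrite -ih; congr (TI _).
  by apply/funext => y; rewrite dotn_cons addrA.
case: eqP => _ /=; last by rewrite andbF Rintegral_cst//= mul0r.
rewrite andbT rRintegralZ//; last first.
  apply: (integrable_torus1 (M := 1)) => [|s]; last exact: cos_max.
  by apply: continuous_measurable_fun; exact: continuous_cos_affine.
rewrite Rintegral_wave1; case: eqP => _; last by rewrite mulr0.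
by rewrite exprS; ring.
Qed.

Definition rperiodic N (g : 'rV[R]_N -> R) : Prop :=
  forall x j, g (x + (2 * pi) *: unit_vec j) = g x.

Lemma shift_unit_vecE n (x : 'rV[R]_n) (r : R) (j i : 'I_n) :
  (x + r *: unit_vec j) 0 i = x 0 i + r * (i == j)%:R.
Proof. by rewrite !mxE eqxx. Qed.

Lemma cons_row_shift0 m (s r : R) (y : 'rV[R]_m) :
  cons_row s y + r *: unit_vec ord0 = cons_row (s + r) y.
Proof.
apply/rowP => j; rewrite shift_unit_vecE.
case: (unliftP ord0 j) => [k|] ->.
  by rewrite !cons_rowS mulr0 addr0.
by rewrite !cons_row0 mulr1.
Qed.

Lemma cons_row_shiftS m (s r : R) (y : 'rV[R]_m) (j : 'I_m) :
  cons_row s y + r *: unit_vec (lift ord0 j) = cons_row s (y + r *: unit_vec j).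
Proof.
apply/rowP => i; rewrite shift_unit_vecE.
case: (unliftP ord0 i) => [k|] ->.
  by rewrite !cons_rowS shift_unit_vecE (inj_eq (@lift_inj _ _)).
by rewrite !cons_row0 mulr0 addr0.
Qed.

(** Every value is taken on the compact cube [-pi, pi]^N. *)
Lemma rperiodic_bounded N (g : 'rV[R]_N -> R) : continuous g -> rperiodic g ->
  exists M, forall x, `|g x| <= M.
Proof.
move=> cg pg.
have shift1 (j : 'I_N) (m : int) x : g (x + (m%:~R * (2 * pi)) *: unit_vec j) = g x.
  have hp s : g (x + (s + 2 * pi) *: unit_vec j) = g (x + s *: unit_vec j).
    by rewrite scalerDl addrA pg.
  have := periodic_int (h := fun s => g (x + s *: unit_vec j)) hp m 0.
  by rewrite add0r scale0r addr0.
have red (k : nat) x : (k <= N)%N -> exists2 y, g y = g x &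
    forall j : 'I_N, (j < k)%N -> - pi <= y 0 j <= pi.
  elim: k x => [|k ih] x kN; first by exists x.
  have [y gy Hy] := ih x (ltnW kN).
  pose j0 := Ordinal kN.
  have [m hm] := reduce_angle (y 0 j0).
  exists (y + (m%:~R * (2 * pi)) *: unit_vec j0); first by rewrite shift1.
  move=> j; rewrite ltnS leq_eqVlt => /predU1P[jk|jk].
    have -> : j = j0 by exact/val_inj.
    by rewrite shift_unit_vecE eqxx mulr1.
  rewrite shift_unit_vecE; have -> : (j == j0) = false.
    by apply/negbTE; rewrite -val_eqE/= neq_ltn jk.
  by rewrite mulr0 addr0; exact: Hy.
pose B : set 'rV[R]_N := [set v | forall i, `[- pi, pi]%classic (v ord0 i)].
have cB : compact B.
  apply: (@rV_compact _ N (fun=> `[- pi, pi]%classic)) => i.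
  exact: segment_compact.
have B0 : B !=set0.
  exists 0 => i /=; rewrite mxE in_itv/= oppr_le0.
  by rewrite pi_ge0.
have cn : {within B, continuous (fun x => `|g x|)}.
  apply: continuous_subspaceT => x.
  apply: (@cvg_comp _ _ _ g (fun r : R => `|r|)); first exact: cg.
  exact: norm_continuous.
have [c _ Hc] := compact_EVT_max B0 cB cn.
exists `|g c| => x.
have [y <- Hy] := red N x (leqnn N).
by apply: Hc; rewrite inE => i; rewrite /= in_itv/=; exact: Hy.
Qed.

(** Induction on the dimension: the moments of the slice at [s] against the waves
    in the remaining variables are a continuous periodic function of [s] all of
    whose one-dimensional moments vanish. *)
Lemma torus_uniqueness N (w : 'rV[R]_N -> R) : continuous w -> rperiodic w ->
  (forall th (n : 'rV[int]_N), TI (fun x => w x * cos (th + dotn n x)) = 0) ->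
  forall x, w x = 0.
Proof.
elim: N w => [|m ih] w cw pw w0 x.
  have := w0 0 0; rewrite /= /dotn big_ord0 addr0 cos0 mulr1.
  by have -> : x = 0 by apply/rowP => -[].
have [M wM] := rperiodic_bounded cw pw.
rewrite (row_consE x); move: (x 0 ord0) (\row_j _) => s y.
rewrite -/(slice w s y).
apply: ih; last first.
- move=> th n.
  pose W r := TI (fun y : 'rV[R]_m => slice w r y * cos (th + dotn n y)).
  rewrite -/(W s).
  have [dct bd lin] := @torus_integral_facts R m.
  have cF r : continuous (fun y : 'rV[R]_m => slice w r y * cos (th + dotn n y)).
    by apply: row_continuousM; [exact: continuous_slice|exact: continuous_cos_dotn].
  have bF r z : `|slice w r z * cos (th + dotn n z)| <= M.
    by rewrite normrM -[leRHS]mulr1; apply: ler_pM => //; [exact: wM|exact: cos_max].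
  apply: (@uniqueness1 _ W ((2 * pi) ^+ m * M)).
  + move=> r; apply: continuous_seq => xn xr.
    apply: (dct _ _ M) => // z.
    apply: cvgM; last exact: cvg_cst.
    apply: (@cvg_comp _ _ _ (fun k => cons_row (xn k) z) w); last exact: cw.
    by apply: cvg_cons_row => //; exact: cvg_cst.
  + by move=> r; exact: bd.
  + move=> r; congr (TI _); apply/funext => z; congr (_ * _).
    by rewrite /slice -cons_row_shift0 pw.
  + move=> th' k.
    (* the product of two cosines is a combination of waves in m + 1 variables *)
    pose n1 : 'rV[int]_(m.+1) := \row_j (if unlift ord0 j is Some i then n 0 i else k).
    have n10 : n1 0 ord0 = k by rewrite mxE unlift_none.
    have n1S : tail_row n1 = n by apply/rowP => j; rewrite !mxE liftK.
    pose n2 : 'rV[int]_(m.+1) := \row_j (if unlift ord0 j is Some i then n 0 i else - k).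
    have n20 : n2 0 ord0 = - k by rewrite mxE unlift_none.
    have n2S : tail_row n2 = n by apply/rowP => j; rewrite !mxE liftK.
    pose G e (q : 'rV[int]_(m.+1)) x := w x * cos (e + dotn q x).
    have cG e q : continuous (G e q).
      by apply: row_continuousM; [exact: cw|exact: continuous_cos_dotn].
    have GM e q z : `|G e q z| <= M.
      by rewrite normrM -[leRHS]mulr1; apply: ler_pM => //; exact: cos_max.
    have iG e q : mu.-integrable I (EFin \o (fun r => TI (slice (G e q) r))).
      apply: (integrable_torus1 (M := (2 * pi) ^+ m * M)) => [|r].
        apply: continuous_measurable_fun.
        exact: (continuous_inner_torus_integral (cG e q) (GM e q)).
      by apply: torus_integral_bound => [|z]; [exact: continuous_slice|exact: GM].
    have zG e q : \int[mu]_(r in I) TI (slice (G e q) r) = 0 by exact: (w0 e q).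
    have mI : measurable (I : set R) by exact: measurable_itv.
    transitivity (\int[mu]_(r in I) (2^-1 * TI (slice (G (th + th') n1) r) +
        2^-1 * TI (slice (G (th - th') n2) r))); last first.
      by rewrite rRintegralD ?rRintegralZ ?zG ?mulr0 ?addr0//; exact: rintegrableZ.
    apply: eq_Rintegral => r _.
    have sM e q z : `|slice (G e q) r z| <= M by exact: GM.
    rewrite -(torus_integralZ 2^-1 (continuous_slice (cG _ n1)) (sM _ _)).
    rewrite -(torus_integralZ 2^-1 (continuous_slice (cG _ n2)) (sM _ _)).
    have hc e q : continuous (fun z => 2^-1 * slice (G e q) r z).
      by apply: row_continuousZ; exact: continuous_slice.
    have hM e q z : `|2^-1 * slice (G e q) r z| <= `|2^-1| * M.
      by rewrite normrM ler_wpM2l.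
    rewrite -(torus_integralD (hc _ _) (hc _ _) (hM _ _) (hM _ _)).
    rewrite mulrC -(torus_integralZ _ (cF r) (bF r)).
    congr (TI _); apply/funext => z; rewrite /slice /G !dotn_cons n10 n1S n20 n2S.
    rewrite mulrNz.
    have -> : th + th' + (k%:~R * r + dotn n z) = (th + dotn n z) + (th' + k%:~R * r) by ring.
    have -> : th - th' + (- k%:~R * r + dotn n z) = (th + dotn n z) - (th' + k%:~R * r) by ring.
    move: (th + dotn n z) (th' + _) (w _) => A B v.
    by rewrite cosD cosB; move: (cos A) (sin A) (cos B) (sin B) => a b c d; field.
- by move=> z j; rewrite /slice -cons_row_shiftS pw.
- exact: continuous_slice.
Qed.

End WaveN.

(** * Unordered sums with uniformly small tails *)

Section UnorderedSums.
Context {R : realType} {I : choiceType}.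
Local Open Scope fset_scope.
Local Open Scope ring_scope.
Implicit Types (F : {fset I}) (c b : I -> R).

Lemma sum_fsetD (V : zmodType) (F0 F : {fset I}) (c : I -> V) : F0 `<=` F ->
  \sum_(i <- F) c i = \sum_(i <- F0) c i + \sum_(i <- F `\` F0) c i.
Proof.
move=> /fsubsetP sub; rewrite -big_cat; apply: perm_big; apply: uniq_perm.
- exact: fset_uniq.
- rewrite cat_uniq !fset_uniq/= andbT; apply/hasPn => i.
  by rewrite inE => /andP[].
- move=> i; rewrite mem_cat !inE.
  by case: (boolP (i \in F0)) => // /sub ->.
Qed.

Lemma le_sum_fset (F0 F : {fset I}) c : (forall i, 0 <= c i) -> F0 `<=` F ->
  \sum_(i <- F0) c i <= \sum_(i <- F) c i.
Proof. by move=> c0 sub; rewrite (sum_fsetD c sub) lerDl sumr_ge0. Qed.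

Definition has_rsum c (S : R) : Prop := forall e : R, 0 < e ->
  exists F0 : {fset I}, forall F : {fset I}, F0 `<=` F ->
  `|\sum_(i <- F) c i - S| < e.

(** Equal to 0 for families that are not summable. *)
Definition rsum c : R := xget 0 [set S | has_rsum c S].

Lemma has_rsum_unique c S S' : has_rsum c S -> has_rsum c S' -> S = S'.
Proof.
move=> h h'; apply/eqP; rewrite -subr_eq0 -normr_le0; apply/ler_addgt0Pl => e e0.
have e2 : 0 < e / 2 by rewrite divr_gt0.
have [F0 H] := h _ e2; have [F1 H'] := h' _ e2.
have := H (F0 `|` F1) (fsubsetUl _ _); have := H' (F0 `|` F1) (fsubsetUr _ _).
move: (\sum_(i <- _) _) => v; rewrite !ltr_norml addr0 ler_norml => /andP[? ?] /andP[? ?].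
by apply/andP; split; lra.
Qed.

Lemma rsumP c S : has_rsum c S -> has_rsum c (rsum c).
Proof. by move=> h; rewrite /rsum; apply: (@xgetPex _ 0 [set S | has_rsum c S]); exists S. Qed.

Lemma has_rsum_rsum c S : has_rsum c S -> rsum c = S.
Proof. by move=> h; exact: has_rsum_unique (rsumP h) h. Qed.

Lemma has_rsumB b c S S' : has_rsum b S -> has_rsum c S' ->
  has_rsum (fun i => b i - c i) (S - S').
Proof.
move=> h h' e e0.
have e2 : 0 < e / 2 by rewrite divr_gt0.
have [F0 H] := h _ e2; have [F1 H'] := h' _ e2.
exists (F0 `|` F1) => F; rewrite fsubUset => /andP[/H + /H'].
rewrite big_split sumrN/=.
by rewrite !ltr_norml => /andP[? ?] /andP[? ?]; apply/andP; split; lra.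
Qed.

Lemma has_rsum_ge0 c (B : R) : (forall i, 0 <= c i) ->
  (forall F, \sum_(i <- F) c i <= B) -> exists S, has_rsum c S.
Proof.
move=> c0 cB; pose A := [set \sum_(i <- F) c i | F in [set: {fset I}]].
have A0 : A !=set0 by exists (\sum_(i <- fset0) c i), fset0.
have uA : has_ubound A by exists B => _ [F _ <-].
exists (sup A) => e e0.
have [_ [F0 _ <-] HF0] := sup_adherent e0 (conj A0 uA : has_sup A).
exists F0 => F /(le_sum_fset c0) F0F.
have FS : \sum_(i <- F) c i <= sup A by apply: ub_le_sup => //; exists F.
by rewrite ltr_norml; apply/andP; split; lra.
Qed.

Lemma has_rsum_abs c (B : R) : (forall F, \sum_(i <- F) `|c i| <= B) ->
  has_rsum c (rsum c).
Proof.
move=> cB.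
have [S hS] : exists S, has_rsum (fun i => Num.max (c i) 0) S.
  apply: (@has_rsum_ge0 _ B) => [i|F]; first by rewrite le_max lexx orbT.
  apply: le_trans (cB F); apply: ler_sum => i _.
  by rewrite ge_max ler_norm normr_ge0.
have [S' hS'] : exists S, has_rsum (fun i => Num.max (- c i) 0) S.
  apply: (@has_rsum_ge0 _ B) => [i|F]; first by rewrite le_max lexx orbT.
  apply: le_trans (cB F); apply: ler_sum => i _.
  by rewrite ge_max -normrN ler_norm normr_ge0.
apply: (@rsumP _ (S - S')).
have := has_rsumB hS hS'; congr has_rsum; apply/funext => i.
by case: (leP (c i) 0) => ci; case: (leP (- c i) 0) => ci'; lra.
Qed.

(** Absolute convergence with tails small uniformly in [x] relative to the
    weight [w x]. *)
Definition small_tails (X : Type) (D : set X) (w : X -> R) (c : I -> X -> R) : Prop :=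
  forall e : R, 0 < e -> exists F0 : {fset I}, forall F : {fset I},
  [disjoint F0 & F] -> forall x, D x -> \sum_(i <- F) `|c i x| <= e * w x.

Section Tails.
Context {X : Type}.
Implicit Types (D : set X) (w : X -> R).

Lemma small_tails_bounded D w (c : I -> X -> R) x : small_tails D w c -> D x ->
  exists B, forall F, \sum_(i <- F) `|c i x| <= B.
Proof.
move=> st Dx; have [F0 H] := st 1 ltr01.
exists (\sum_(i <- F0) `|c i x| + 1 * w x) => F.
have n0 i : 0 <= `|c i x| by [].
apply: (le_trans (le_sum_fset n0 (fsubsetUr F0 F))).
rewrite (sum_fsetD _ (fsubsetUl F0 F)) lerD2l; apply: H => //.
by apply/fdisjointP => i iF0; rewrite inE iF0.
Qed.

Lemma small_tails_rsum D w (c : I -> X -> R) x : small_tails D w c -> D x ->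
  has_rsum (c ^~ x) (rsum (c ^~ x)).
Proof. by move=> st Dx; have [B] := small_tails_bounded st Dx; exact: has_rsum_abs. Qed.

(** Weierstrass' criterion with a weight. *)
Lemma small_tails_unif D w (c : I -> X -> R) (e : R) : (forall x, D x -> 0 < w x) ->
  small_tails D w c -> 0 < e ->
  exists F0 : {fset I}, forall F : {fset I}, F0 `<=` F -> forall x, D x ->
  `|\sum_(i <- F) c i x - rsum (c ^~ x)| <= e * w x.
Proof.
move=> w0 st e0; have e2 : 0 < e / 2 by rewrite divr_gt0.
have [F0 H] := st _ e2; exists F0 => F F0F x Dx.
have ew : 0 < e / 2 * w x by rewrite mulr_gt0// w0.
have [F1 H1] := small_tails_rsum st Dx ew.
have := H1 (F `|` F1) (fsubsetUr _ _).
rewrite (sum_fsetD _ (fsubsetUl F F1)).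
have /H : [disjoint F0 & (F `|` F1) `\` F].
  apply/fdisjointP => i iF0; rewrite !inE negb_and negbK.
  by rewrite (fsubsetP F0F _ iF0).
move=> /(_ x Dx); set u := \sum_(i <- _ `\` _) c i x.
move=> h2; have h3 : `|u| <= e / 2 * w x.
  by apply: le_trans h2; exact: ler_norm_sum.
have -> : e * w x = e / 2 * w x + e / 2 * w x by lra.
move: (e / 2 * w x) h3 => v; rewrite ltr_norml !ler_norml => /andP[? ?] /andP[? ?].
by apply/andP; split; lra.
Qed.

Lemma small_tails_le D w (c b : I -> X -> R) (K : R) : 0 < K ->
  (forall i x, D x -> `|b i x| <= K * `|c i x|) ->
  small_tails D w c -> small_tails D w b.
Proof.
move=> K0 bc st e e0.
have [F0 H] := st _ (divr_gt0 e0 K0); exists F0 => F dF x Dx.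
apply: (@le_trans _ _ (K * \sum_(i <- F) `|c i x|)).
  by rewrite mulr_sumr; apply: ler_sum => i _; exact: bc.
apply: (le_trans (ler_wpM2l (ltW K0) (H _ dF _ Dx))).
by rewrite mulrA mulrCA divff ?mulr1// gt_eqF.
Qed.

Lemma small_tailsD D w (c b : I -> X -> R) :
  small_tails D w c -> small_tails D w b -> small_tails D w (fun i x => b i x + c i x).
Proof.
move=> sc sb e e0; have e2 : 0 < e / 2 by rewrite divr_gt0.
have [F0 H0] := sc _ e2; have [F1 H1] := sb _ e2.
exists (F0 `|` F1) => F; rewrite fdisjointUX => /andP[d0 d1] x Dx.
apply: (@le_trans _ _ (\sum_(i <- F) (`|b i x| + `|c i x|))).
  by apply: ler_sum => i _; exact: ler_normD.
rewrite big_split/=; have := H0 F d0 x Dx; have := H1 F d1 x Dx; lra.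
Qed.

Lemma small_tails_weight D w w' (c : I -> X -> R) (K : R) : 0 < K ->
  (forall x, D x -> w x <= K * w' x) -> small_tails D w c -> small_tails D w' c.
Proof.
move=> K0 ww st e e0.
have [F0 H] := st _ (divr_gt0 e0 K0); exists F0 => F dF x Dx.
apply: (le_trans (H _ dF _ Dx)).
apply: (le_trans (ler_wpM2l (ltW (divr_gt0 e0 K0)) (ww _ Dx))).
by rewrite mulrA mulfVK// gt_eqF.
Qed.

End Tails.

End UnorderedSums.

(** * Sums over the integer lattice *)

Section LatticeSum.
Context {R : realType}.

(** Mean value theorem for x^(1-p) on [a, a + 1]. *)
Lemma powR_telescope (p a : R) : 1 < p -> 1 <= a ->
  (a + 1) `^ (- p) <= (a `^ (1 - p) - (a + 1) `^ (1 - p)) / (p - 1).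
Proof.
move=> p1 a1; have a0 : 0 < a by exact: lt_le_trans a1.
have dF (x : R) : x \in `]a, (a + 1)[%R ->
    is_derive x (1 : R) (fun y => y `^ (1 - p)) ((1 - p) * x `^ (1 - p - 1)).
  rewrite in_itv/= => /andP[ax _]; apply: is_derive1_powR.
  exact: lt_trans ax.
have cF : {within `[a, a + 1], continuous (fun y : R => y `^ (1 - p))}.
  apply: continuous_in_subspaceT => x; rewrite inE/= in_itv/= => /andP[ax _].
  by apply: continuous_powR; exact: lt_le_trans ax.
have aa : a < a + 1 by rewrite ltrDl.
have [c + e] := MVT aa dF cF.
rewrite in_itv/= => /andP[ac ca].
have c0 : 0 < c by exact: lt_trans ac.
have le1 : (a + 1) `^ (- p) <= c `^ (- p).
  by apply: le_powR_neg => //; [rewrite oppr_le0; lra|exact: ltW].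
rewrite ler_pdivlMr; last by lra.
have e1 : 1 - p - 1 = - p by lra.
rewrite e1 in e.
move: e le1; move: ((a + 1) `^ (- p)) (c `^ _) (a `^ _) ((a + 1) `^ _) => A B C D e le1.
have : 0 <= (p - 1) * (B - A) by apply: mulr_ge0; lra.
by nra.
Qed.

Lemma line_sum (s : R) : 1 / 2 < s -> exists H, forall K,
  \sum_(k < K) (1 + k%:R ^+ 2) `^ (- s) <= H.
Proof.
move=> s2; pose h k : R := (1 + k%:R ^+ 2) `^ (- s).
have p1 : 1 < 2 * s by lra.
have h0 k : 0 <= h k by exact: powR_ge0.
have h1 k : h k <= 1.
  rewrite /h -[leRHS](powRr0 (1 + k%:R ^+ 2)); apply: ler_powR; last by lra.
  by rewrite lerDl exprn_ge0.
have hp k : h k.+1 <= k.+1%:R `^ (- (2 * s)).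
  rewrite -mulrN powRrM powR_mulrn//; apply: le_powR_neg; first by lra.
    by rewrite exprn_gt0.
  by rewrite lerDr.
have S K : \sum_(0 <= k < K) h k.+2 <= (1 - (K%:R + 1) `^ (1 - 2 * s)) / (2 * s - 1).
  elim: K => [|K ih].
    by rewrite big_geq// add0r powR1 subrr mul0r.
  rewrite big_nat_recr//=.
  have t := @powR_telescope (2 * s) (K%:R + 1) p1.
  have := hp K.+1; rewrite -[K.+2%:R]natr1 -[K.+1%:R]natr1 => h2.
  have /t h3 : 1 <= K%:R + 1 :> R by rewrite lerDr.
  have := lerD ih (le_trans h2 h3); rewrite -mulrDl addrA subrK; exact.
exists (1 + 1 + 1 / (2 * s - 1)) => K.
apply: (@le_trans _ _ (\sum_(0 <= k < K.+2) h k)).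
  rewrite big_mkord [leRHS](_ : _ = \sum_(0 <= k < K.+2) h k); last by rewrite big_mkord.
  rewrite -[leLHS](big_mkord xpredT h) (@big_cat_nat _ _ _ K 0 K.+2)//=; last by rewrite leqW// leqnSn.
  by rewrite lerDl sumr_ge0.
rewrite !big_nat_recl//= -addrA lerD ?lerD//.
apply: (le_trans (S K)); rewrite ler_wpM2r ?invr_ge0; [by []|lra|].
by rewrite gerBl powR_ge0.
Qed.

Lemma sqnorm_ge0 N (n : 'rV[int]_N) : 0 <= sqnorm n :> R.
Proof. by apply: sumr_ge0 => j _; rewrite sqr_ge0. Qed.

(** 1 + |n|^2 is at least each of the N factors 1 + n_j^2, hence at least their
    geometric mean; this separates the variables. *)
Lemma weight_prod N (b : R) (n : 'rV[int]_N) : (1 <= N)%N -> 0 <= b ->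
  (1 + sqnorm n) `^ (- b) <= \prod_(j < N) (1 + (absz (n 0 j))%:R ^+ 2 : R) `^ (- (b / N%:R)).
Proof.
move=> N1 b0; have NR : 0 < N%:R :> R by rewrite ltr0n.
have -> : (1 + sqnorm n) `^ (- b) = \prod_(j < N) (1 + sqnorm n : R) `^ (- (b / N%:R)).
  rewrite prodr_const card_ord -powR_mulrn ?powR_ge0// -powRrM; congr (_ `^ _).
  by rewrite mulNr divfK// gt_eqF.
apply: ler_prod => j _; rewrite powR_ge0/=; apply: le_powR_neg.
- by rewrite oppr_le0 divr_ge0// ltW.
- by rewrite ltr_pwDl// exprn_ge0.
- rewrite lerD2l /sqnorm (bigD1 j)//=.
  rewrite [X in X ^+ 2 <= _](_ : _ = `|(n 0 j)%:~R|); last first.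
    by rewrite natr_absz intr_norm.
  by rewrite real_normK ?num_real// lerDl sumr_ge0// => i _; rewrite sqr_ge0.
Qed.

(** A finite set of lattice points lies in a cube, over which the sum of the
    products of [weight_prod] is the N-th power of a one-dimensional sum. A point
    is encoded by the signs and the absolute values of its coordinates. *)
Lemma lattice_sum N (b : R) : (1 <= N)%N -> N%:R / 2 < b -> exists C,
  forall F : {fset 'rV[int]_N}, \sum_(n <- F) (1 + sqnorm n : R) `^ (- b) <= C.
Proof.
move=> N1 Nb; have NR : 0 < N%:R :> R by rewrite ltr0n.
have b0 : 0 < b by apply: lt_trans Nb; rewrite divr_gt0.
have s2 : 1 / 2 < b / N%:R by rewrite ltr_pdivlMr//; lra.
have [H HK] := line_sum s2.
pose h k : R := (1 + k%:R ^+ 2) `^ (- (b / N%:R)).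
exists ((2 * H) ^+ N) => F.
pose K := (\max_(n <- F) \max_(j < N) absz (n 0%R j)).+1.
have nK n j : n \in F -> (absz (n 0%R j) < K)%N.
  move=> nF; rewrite ltnS (leq_trans _ (leq_bigmax_seq _ nF _))//.
  exact: (leq_bigmax j).
pose enc (n : 'rV[int]_N) : {ffun 'I_N -> bool * 'I_K} :=
  [ffun j => (n 0 j < 0, inord (absz (n 0 j)))].
have enc_inj : {in F &, injective enc}.
  move=> n m nF mF /ffunP e; apply/rowP => j.
  have := e j; rewrite !ffunE => -[sg].
  move=> /(congr1 val); rewrite /= !inordK ?nK// => ab.
  rewrite [LHS]intEsign [RHS]intEsign ab; congr (_ * _).
  by rewrite sg.
pose G (f : {ffun 'I_N -> bool * 'I_K}) : R := \prod_(j < N) h (f j).2.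
have G0 f : 0 <= G f by apply: prodr_ge0 => j _; exact: powR_ge0.
apply: (@le_trans _ _ (\sum_(n <- F) G (enc n))).
  rewrite big_seq [leRHS]big_seq; apply: ler_sum => n nF.
  apply: (le_trans (weight_prod n N1 (ltW b0))).
  rewrite le_eqVlt; apply/orP; left; apply/eqP; apply: eq_bigr => j _.
  by rewrite ffunE /= inordK ?nK.
rewrite -(big_map enc xpredT G).
have ue : uniq (map enc F) by rewrite map_inj_in_uniq ?fset_uniq.
rewrite (big_uniq _ ue)/=.
apply: (@le_trans _ _ (\sum_f G f)).
  by rewrite [leRHS](bigID (mem (map enc F)))/= lerDl sumr_ge0.
rewrite /G -(bigA_distr_bigA (fun (j : 'I_N) (bk : bool * 'I_K) => h bk.2)).
rewrite prodr_const card_ord.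
apply: lerXn2r; rewrite ?nnegrE.
- by apply: sumr_ge0 => bk _; exact: powR_ge0.
- rewrite mulr_ge0//; apply: le_trans (HK 0%N); by rewrite big_ord0.
- rewrite -(pair_bigA _ (fun (_ : bool) (k : 'I_K) => h k))/=.
  rewrite sumr_const card_bool -[leLHS]mulr_natl ler_wpM2l//; exact: HK.
Qed.

End LatticeSum.

Section WeightedTails.
Context {R : realType}.
Local Open Scope fset_scope.
Local Open Scope ring_scope.

Lemma bounded_sum_tails (I : choiceType) (c : I -> R) (B e : R) :
  (forall i, 0 <= c i) -> (forall F : {fset I}, \sum_(i <- F) c i <= B) -> 0 < e ->
  exists F0 : {fset I}, forall F : {fset I}, [disjoint F0 & F] ->
    \sum_(i <- F) c i <= e.
Proof.
move=> c0 cB e0; have [S HS] := has_rsum_ge0 c0 cB.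
have e2 : 0 < e / 2 by rewrite divr_gt0.
have [F0 H] := HS _ e2; exists F0 => F dF.
have := H (F0 `|` F) (fsubsetUl _ _); have := H F0 (fsubset_refl _).
rewrite (sum_fsetD c (fsubsetUl F0 F)).
have -> : (F0 `|` F) `\` F0 = F.
  by apply/eqP; rewrite fsetDUl fsetDv fset0U; apply/eqP/fsetDidPl; rewrite fdisjoint_sym.
move: (\sum_(i <- F0) _) (\sum_(i <- F) _) => u v.
rewrite !ltr_norml => /andP[? ?] /andP[? ?]; lra.
Qed.

Lemma amgm (d u v : R) : 0 < d -> u * v <= (d^-1 * u ^+ 2 + d * v ^+ 2) / 2.
Proof.
move=> d0; have := sqr_ge0 (u - d * v) => h.
have -> : u * v = d^-1 * (d * u * v) by rewrite -mulrA mulKf// gt_eqF.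
have -> : d * v ^+ 2 = d^-1 * (d * v) ^+ 2.
  by rewrite exprMn expr2 -mulrA mulKf// gt_eqF.
rewrite -mulrDr -[leRHS]mulrA; apply: ler_wpM2l; first by rewrite invr_ge0 ltW.
by move: h; rewrite !expr2; lra.
Qed.

(** By [amgm], (1 + |n|^2)^e |c_n| is at most a multiple of the summable
    (1 + |n|^2)^(2 e - a) plus d (1 + |n|^2)^a |c_n|^2 / 2; the second part is small
    in total for small [d], and the first then has small tails. *)
Lemma weighted_tails N (X : Type) (D : set X) (c : 'rV[int]_N -> X -> R) (a e K : R) :
  (1 <= N)%N -> N%:R / 2 < a - 2 * e ->
  (forall x, D x -> forall F : {fset 'rV[int]_N},
     \sum_(n <- F) (1 + sqnorm n) `^ a * (c n x) ^+ 2 <= K) ->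
  small_tails D (fun=> 1) (fun n x => (1 + sqnorm n) `^ e * c n x).
Proof.
move=> N1 hae cK eps eps0.
have [C HC] := lattice_sum N1 hae.
pose K1 := `|K| + 1; have K10 : 0 < K1 by rewrite /K1 ltr_wpDl.
pose d := eps / K1; have d0 : 0 < d by rewrite divr_gt0.
have w0 (n : 'rV[int]_N) : 0 < 1 + sqnorm n :> R by rewrite ltr_pwDl// sqnorm_ge0.
have [F0 H] := bounded_sum_tails (fun n => powR_ge0 (1 + sqnorm n) (- (a - 2 * e))) HC
  (mulr_gt0 eps0 d0).
exists F0 => F dF x Dx.
have pt n : `|(1 + sqnorm n) `^ e * c n x| <=
   (d^-1 * (1 + sqnorm n) `^ (- (a - 2 * e)) + d * ((1 + sqnorm n) `^ a * c n x ^+ 2)) / 2.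
  have -> : `|(1 + sqnorm n) `^ e * c n x| =
     (1 + sqnorm n) `^ (e - a / 2) * ((1 + sqnorm n) `^ (a / 2) * `|c n x|).
    rewrite mulrA -powRD; last by rewrite (gt_eqF (w0 n)) implybT.
    by rewrite subrK normrM ger0_norm// powR_ge0.
  apply: le_trans (amgm _ _ d0) _.
  have sq r : ((1 + sqnorm n) `^ r) ^+ 2 = (1 + sqnorm n : R) `^ (r * 2).
    by rewrite powRrM -powR_mulrn// powR_ge0.
  rewrite exprMn !sq real_normK ?num_real//.
  have -> : (e - a / 2) * 2 = - (a - 2 * e) by lra.
  by have -> : a / 2 * 2 = a by lra.
apply: le_trans (ler_sum _ (fun n _ => pt n)) _.
rewrite -mulr_suml big_split/= -!mulr_sumr.
have h1 := H F dF; have h2 := cK x Dx F.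
have h3 : d^-1 * \sum_(n <- F) (1 + sqnorm n) `^ (- (a - 2 * e)) <= eps.
  by rewrite mulrC ler_pdivrMr.
have h4 : d * \sum_(n <- F) (1 + sqnorm n) `^ a * c n x ^+ 2 <= eps.
  rewrite /d mulrAC ler_pdivrMr//; apply: ler_wpM2l; first exact: ltW.
  by apply: (le_trans h2); rewrite /K1; have := ler_norm K; lra.
rewrite mulr1; lra.
Qed.

Lemma fset_sum_le_esum (I : choiceType) (c : I -> R) (B : R) :
  (forall i, 0 <= c i) -> (\esum_(i in [set: I]) (c i)%:E <= B%:E)%E ->
  forall F : {fset I}, \sum_(i <- F) c i <= B.
Proof.
move=> c0 h F; rewrite -lee_fin; apply: le_trans h.
apply: esum_ge; exists [set` F]; first by split; [exact: finite_fset|].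
by rewrite fsbig_finite//= set_fsetK sumEFin.
Qed.

Lemma esum_le_fset_sum (I : choiceType) (c : I -> R) (B : R) :
  (forall i, 0 <= c i) -> (forall F : {fset I}, \sum_(i <- F) c i <= B) ->
  (\esum_(i in [set: I]) (c i)%:E <= B%:E)%E.
Proof.
move=> c0 h; apply: ge_ereal_sup => _ [A [finA _] <-].
by rewrite fsbig_finite// sumEFin lee_fin.
Qed.

Lemma liouville_tails N (X : Type) (D : set X) (g : X -> 'rV[R]_N -> R[i]) (a e K : R) :
  (1 <= N)%N -> N%:R / 2 < a - 2 * e ->
  (forall x, D x -> (liouville_norm2 a (g x) <= K%:E)%E) ->
  small_tails D (fun=> 1)
    (fun n x => (1 + sqnorm n) `^ e * normc (fourier_coef (g x) n)).
Proof.
move=> N1 hae gK; apply: (weighted_tails N1 hae (K := K)) => x Dx.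
apply: fset_sum_le_esum (gK _ Dx) => n.
by rewrite mulr_ge0 ?powR_ge0// sqr_ge0.
Qed.

End WeightedTails.

(** * Sums of waves *)

Section RsumLimits.
Context {R : realType} {I : choiceType}.

Lemma cvg_seq_sum (X : Type) (Fi : set_system X) (FF : Filter Fi) (r : seq I)
    (c : I -> X -> R) (l : I -> R) :
  (forall i, c i x @[x --> Fi] --> l i) ->
  \sum_(i <- r) c i x @[x --> Fi] --> \sum_(i <- r) l i.
Proof.
move=> h; elim: r => [|i r ih].
  rewrite big_nil; under eq_fun do rewrite big_nil; exact: cvg_cst.
rewrite big_cons; under eq_fun do rewrite big_cons; exact: cvgD (h i) ih.
Qed.

(** Uniform convergence of the partial sums; it is enough that the weight is
    bounded near the limit point. *)
Lemma rsum_cvg (X : Type) (Fi : set_system X) (FF : Filter Fi) (D : set X) (w : X -> R)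
    (c : I -> X -> R) (x0 : X) (K : R) :
  (forall x, D x -> 0 < w x) -> small_tails D w c -> D x0 -> w x0 <= K ->
  (\forall x \near Fi, D x /\ w x <= K) ->
  (forall i, c i x @[x --> Fi] --> c i x0) ->
  rsum (c ^~ x) @[x --> Fi] --> rsum (c ^~ x0).
Proof.
move=> w0 st Dx0 wx0 nearD cc.
have K0 : 0 < K by apply: lt_le_trans (w0 _ Dx0) wx0.
apply/cvgrPdist_le => e e0.
have e'0 : 0 < e / (3 * K) by rewrite divr_gt0// mulr_gt0.
have [F0 H] := small_tails_unif w0 st e'0.
have e3 : 0 < e / 3 by rewrite divr_gt0.
have := @cvg_seq_sum X Fi FF F0 c _ cc.
move=> /cvgrPdist_le /(_ _ e3) h.
have small x : D x -> w x <= K -> `|\sum_(i <- F0) c i x - rsum (c ^~ x)| <= e / 3.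
  move=> Dx wx; apply: (le_trans (H F0 (fsubset_refl _) x Dx)).
  have -> : e / 3 = e / (3 * K) * K by rewrite invfM mulrA mulfVK// gt_eqF.
  by apply: ler_wpM2l => //; exact: ltW.
have h0 := small _ Dx0 wx0.
near=> x.
have [Dx wx] : D x /\ w x <= K by near: x.
have h1 := small _ Dx wx.
have : `|\sum_(i <- F0) c i x0 - \sum_(i <- F0) c i x| <= e / 3 by near: x.
move: h0 h1; move: (\sum_(i <- F0) _) (\sum_(i <- F0) _) (rsum _) (rsum _) => p q r s.
rewrite !ler_norml => /andP[? ?] /andP[? ?] /andP[? ?]; apply/andP; split; lra.
Unshelve. all: by end_near. Qed.

End RsumLimits.

Section Inversion.
Context {R : realType} {N : nat}.
Local Notation TI := (@torus_integral R N).
Implicit Types (n m : 'rV[int]_N) (x : 'rV[R]_N).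

(** Real part of [(A + i B) e^{i n x}]. *)
Definition wave (A B : 'rV[int]_N -> R) n x : R :=
  A n * cos (dotn n x) - B n * sin (dotn n x).

Lemma sin_as_cos (y : R) : sin y = cos (- (pi / 2) + y).
Proof. by rewrite addrC cosB cos_pihalf sin_pihalf mulr0 mulr1 add0r. Qed.

Lemma row_continuous_ext (g h : 'rV[R]_N -> R) : g =1 h -> continuous g -> continuous h.
Proof. by move=> /funext ->. Qed.

Lemma continuous_sin_dotn n : continuous (fun x : 'rV[R]_N => sin (dotn n x)).
Proof.
apply: (row_continuous_ext _ (@continuous_cos_dotn R N (- (pi / 2)) n)) => x.
by rewrite -sin_as_cos.
Qed.

Lemma continuous_cos_dotn0 n : continuous (fun x : 'rV[R]_N => cos (dotn n x)).
Proof.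
apply: (row_continuous_ext _ (@continuous_cos_dotn R N 0 n)) => x.
by rewrite add0r.
Qed.

Lemma continuous_wave A B n : continuous (wave A B n).
Proof.
have h1 := row_continuousZ (c := A n) (@continuous_cos_dotn0 n).
have h2 := row_continuousZ (c := - B n) (@continuous_sin_dotn n).
apply: (row_continuous_ext _ (row_continuousD h1 h2)) => x.
by rewrite /wave mulNr.
Qed.

Lemma wave_norm A B n x : `|wave A B n x| <= `|A n| + `|B n|.
Proof.
apply: (le_trans (ler_normB _ _)); rewrite !normrM; apply: lerD.
  by rewrite ler_piMr// ler_norml cos_geN1 cos_le1.
by rewrite ler_piMr// ler_norml sin_geN1 sin_le1.
Qed.

Lemma dotnD n m x : dotn (n + m) x = dotn n x + dotn m x.
Proof. by rewrite /dotn -big_split/=; apply: eq_bigr => j _; rewrite mxE intrD mulrDl. Qed.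

Lemma dotnN n x : dotn (- n) x = - dotn n x.
Proof. by rewrite /dotn -sumrN/=; apply: eq_bigr => j _; rewrite mxE intrN mulNr. Qed.

Lemma dotn_period n x (j : 'I_N) :
  dotn n (x + (2 * pi) *: unit_vec j) = dotn n x + (n 0 j)%:~R * (2 * pi).
Proof.
rewrite /dotn.
under eq_bigr => i _ do rewrite shift_unit_vecE mulrDr.
rewrite big_split/=; congr (_ + _); rewrite (bigD1 j)//= eqxx mulr1 big1 ?addr0//.
by move=> i /negbTE ij; rewrite ij !mulr0.
Qed.

Lemma cos_periodz (y : R) (k : int) : cos (y + k%:~R * (2 * pi)) = cos y.
Proof. by apply: (periodic_int (h := cos)); exact: cosD2pi'. Qed.

Lemma sin_periodz (y : R) (k : int) : sin (y + k%:~R * (2 * pi)) = sin y.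
Proof. by apply: (periodic_int (h := sin)); exact: sinD2pi'. Qed.

Lemma rperiodic_wave A B n : rperiodic (wave A B n).
Proof. by move=> x j; rewrite /wave dotn_period cos_periodz sin_periodz. Qed.

(** Product-to-sum formulas leave waves of the frequencies n + m and n - m. *)
Lemma torus_integral_wave_moment A B n (th : R) m :
  TI (fun x => wave A B n x * cos (th + dotn m x)) =
  (2 * pi) ^+ N * (((n == - m)%:R + (n == m)%:R) * A n * cos th -
    ((n == - m)%:R - (n == m)%:R) * B n * sin th) / 2.
Proof.
have -> : (fun x => wave A B n x * cos (th + dotn m x)) = (fun x =>
   (A n / 2 * cos (th + dotn (n + m) x) + A n / 2 * cos (- th + dotn (n - m) x)) +
   (- (B n / 2) * cos (th - pi / 2 + dotn (n + m) x) +
    - (B n / 2) * cos (- th - pi / 2 + dotn (n - m) x))).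
  apply/funext => x; rewrite /wave.
  have e1 (y z : R) : cos (y - pi / 2 + z) = sin (y + z).
    by rewrite sin_as_cos; congr cos; lra.
  rewrite !e1 !dotnD !dotnN.
  have -> : th + (dotn n x + dotn m x) = dotn n x + (th + dotn m x) by lra.
  have -> : - th + (dotn n x - dotn m x) = dotn n x - (th + dotn m x) by lra.
  move: (th + dotn m x) => y; rewrite cosD cosB sinD sinB.
  move: (cos _) (cos _) (sin _) (sin _) => c1 c2 s1 s2; by field.
have b1 : forall (t : R) (k : 'rV[int]_N) (y : 'rV[R]_N), `|cos (t + dotn k y)| <= 1.
  by move=> t k y; rewrite ler_norml cos_geN1 cos_le1.
have b2 : forall (c t : R) (k : 'rV[int]_N) (y : 'rV[R]_N), `|c * cos (t + dotn k y)| <= `|c|.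
  by move=> c t k y; rewrite normrM ler_piMr.
pose cc (c t : R) (k : 'rV[int]_N) := row_continuousZ (c := c) (@continuous_cos_dotn R N t k).
rewrite (torus_integralD (row_continuousD (cc _ _ _) (cc _ _ _))
   (row_continuousD (cc _ _ _) (cc _ _ _))
   (M := `|A n / 2| + `|A n / 2|) (K := `|- (B n / 2)| + `|- (B n / 2)|)); last 2 first.
- by move=> x; apply: le_trans (ler_normD _ _) (lerD (b2 _ _ _ _) (b2 _ _ _ _)).
- by move=> x; apply: le_trans (ler_normD _ _) (lerD (b2 _ _ _ _) (b2 _ _ _ _)).
rewrite !(torus_integralD (cc _ _ _) (cc _ _ _) (b2 _ _ _) (b2 _ _ _)).
rewrite !(torus_integralZ _ (@continuous_cos_dotn R N _ _) (b1 _ _)).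
rewrite !torus_integral_wave addr_eq0 subr_eq0.
have -> : cos (th - pi / 2) = sin th by rewrite cosB cos_pihalf sin_pihalf; lra.
have -> : cos (- th - pi / 2) = - sin th.
  by rewrite cosB cos_pihalf sin_pihalf sinN; lra.
rewrite cosN; case: (n == - m); case: (n == m) => /=; ring.
Qed.

End Inversion.

(** * Fourier inversion *)

Section ComplexParts.
Context {R : realType}.
Local Open Scope complex_scope.

Lemma complex_ReM (z w : R[i]) :
  complex.Re (z * w) = complex.Re z * complex.Re w - complex.Im z * complex.Im w.
Proof. by case: z => a b; case: w. Qed.

Lemma complex_ImM (z w : R[i]) :
  complex.Im (z * w) = complex.Re z * complex.Im w + complex.Im z * complex.Re w.
Proof. by case: z => a b; case: w. Qed.

Lemma complex_eqP (z w : R[i]) :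
  complex.Re z = complex.Re w -> complex.Im z = complex.Im w -> z = w.
Proof. by case: z => a b; case: w => c d /= -> ->. Qed.

Lemma normc_le (z : R[i]) : normc z <= `|complex.Re z| + `|complex.Im z|.
Proof.
case: z => a b /=; rewrite -[leRHS]ger0_norm ?addr_ge0// -sqrtr_sqr.
rewrite ler_wsqrtr// sqrrD !real_normK ?num_real//.
by rewrite lerD2r lerDl mulrn_wge0// mulr_ge0.
Qed.

Lemma normRe_le (z : R[i]) : `|complex.Re z| <= normc z.
Proof. by case: z => a b /=; rewrite -sqrtr_sqr ler_wsqrtr// lerDl sqr_ge0. Qed.

Lemma normIm_le (z : R[i]) : `|complex.Im z| <= normc z.
Proof. by case: z => a b /=; rewrite -sqrtr_sqr ler_wsqrtr// lerDr sqr_ge0. Qed.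

End ComplexParts.

Section FourierCoefficients.
Context {R : realType} {N : nat}.
Local Notation TI := (@torus_integral R N).
Implicit Types (n m : 'rV[int]_N) (x : 'rV[R]_N) (G : 'rV[R]_N -> R[i]).
Local Open Scope complex_scope.

Lemma torus_integral_sum (J : Type) (r : seq J) (c : J -> 'rV[R]_N -> R) (b : J -> R) :
  (forall i, continuous (c i)) -> (forall i x, `|c i x| <= b i) ->
  [/\ continuous (fun x => \sum_(i <- r) c i x),
      forall x, `|\sum_(i <- r) c i x| <= \sum_(i <- r) b i
    & TI (fun x => \sum_(i <- r) c i x) = \sum_(i <- r) TI (c i)].
Proof.
move=> cc cb; elim: r => [|i r [ih1 ih2 ih3]].
  have e0 : (fun x => \sum_(i <- [::]) c i x) = (fun=> 0).
    by apply/funext => x; rewrite big_nil.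
  rewrite e0 !big_nil; split; first exact: cst_continuous.
    by move=> x; rewrite big_nil normr0.
  exact: torus_integral0.
have e1 : (fun x => \sum_(i <- i :: r) c i x) = (fun x => c i x + \sum_(i <- r) c i x).
  by apply/funext => x; rewrite big_cons.
rewrite e1 !big_cons; split; first exact: row_continuousD (cc i) ih1.
  move=> x; rewrite big_cons; apply: (le_trans (ler_normD _ _)).
  exact: lerD (cb i x) (ih2 x).
by rewrite (torus_integralD (cc i) ih1 (cb i) ih2) ih3.
Qed.

Lemma Re_fourier_coef G n : complex.Re (fourier_coef G n) =
  (2 * pi) ^- N * TI (fun x => complex.Re (G x) * cos (dotn n x) +
                               complex.Im (G x) * sin (dotn n x)).
Proof.
rewrite /fourier_coef complex_ReM /= mul0r subr0; congr (_ * TI _); apply/funext => x.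
by rewrite complex_ReM /= cosN sinN mulrN opprK.
Qed.

Lemma Im_fourier_coef G n : complex.Im (fourier_coef G n) =
  (2 * pi) ^- N * TI (fun x => complex.Im (G x) * cos (dotn n x) -
                               complex.Re (G x) * sin (dotn n x)).
Proof.
rewrite /fourier_coef complex_ImM /= mul0r addr0; congr (_ * TI _); apply/funext => x.
by rewrite complex_ImM /= cosN sinN mulrN addrC.
Qed.

Lemma torus_continuous_bounded G : torus_continuous G ->
  exists M, forall x, `|complex.Re (G x)| <= M /\ `|complex.Im (G x)| <= M.
Proof.
move=> [pG [cR cI]].
have [M1 h1] : exists M, forall x, `|complex.Re (G x)| <= M.
  by apply: rperiodic_bounded => // x j; rewrite pG.
have [M2 h2] : exists M, forall x, `|complex.Im (G x)| <= M.
  by apply: rperiodic_bounded => // x j; rewrite pG.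
exists (Num.max M1 M2) => x; split; rewrite le_max ?h1// ?h2 orbT//.
Qed.

Lemma sum_fset_delta (F : {fset 'rV[int]_N}) k (z : 'rV[int]_N -> R) : k \in F ->
  \sum_(n <- F) (n == k)%:R * z n = z k.
Proof.
move=> kF; rewrite (bigD1_seq k kF (fset_uniq F))/= eqxx mul1r big1 ?addr0//.
by move=> i /negbTE ->; rewrite mul0r.
Qed.

Definition wave_sum (A B : 'rV[int]_N -> R) (x : 'rV[R]_N) : R :=
  rsum (fun n => wave A B n x).

Section WaveSums.
Variables (A B : 'rV[int]_N -> R) (S : R).
Hypothesis hS : forall F : {fset 'rV[int]_N}, \sum_(n <- F) (`|A n| + `|B n|) <= S.

Lemma wave_small_tails : small_tails [set: 'rV[R]_N] (fun=> 1) (wave A B).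
Proof.
move=> e e0.
have [n|F0 H] := bounded_sum_tails _ hS e0; first by rewrite addr_ge0.
exists F0 => F dF x _; rewrite mulr1; apply: le_trans (H F dF).
by apply: ler_sum => n _; exact: wave_norm.
Qed.

Lemma continuous_wave_sum : continuous (wave_sum A B).
Proof.
move=> x; apply: (rsum_cvg (nbhs_filter x) (D := setT) (w := fun=> 1) (K := 1)) => //.
- exact: wave_small_tails.
- exact: filterE.
- by move=> n; exact: continuous_wave.
Qed.

Lemma wave_sum_bound x : `|wave_sum A B x| <= S.
Proof.
apply/ler_addgt0Pl => e e0.
have [F0 H] := small_tails_rsum wave_small_tails (I : [set: 'rV[R]_N] x) e0.
have := H F0 (fsubset_refl _).
have : `|\sum_(n <- F0) wave A B n x| <= S.
  apply: le_trans (hS F0); apply: (le_trans (ler_norm_sum _ _ _)).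
  by apply: ler_sum => n _; exact: wave_norm.
rewrite /wave_sum; move: (\sum_(n <- F0) _) (rsum _) => u v.
by rewrite ltr_norml !ler_norml => /andP[? ?] /andP[? ?]; apply/andP; split; lra.
Qed.

(** Only n = m and n = - m contribute to the moment of a partial sum. *)
Lemma wave_sum_moment (th : R) m :
  TI (fun x => wave_sum A B x * cos (th + dotn m x)) =
  (2 * pi) ^+ N * ((A (- m) + A m) * cos th - (B (- m) - B m) * sin th) / 2.
Proof.
set V := RHS; apply/eqP; rewrite -subr_eq0 -normr_le0; apply/ler_addgt0Pl => e e0.
rewrite addr0.
have P0 : 0 < (2 * pi) ^+ N :> R by rewrite exprn_gt0// two_pi_gt0.
have [F0 H] := small_tails_unif (fun _ _ => ltr01) wave_small_tails (divr_gt0 e0 P0).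
pose F := (F0 `|` [fset m; - m])%fset.
have {}H := H F (fsubsetUl _ _).
have mF : m \in F by rewrite !inE eqxx orbT.
have nmF : - m \in F by rewrite !inE eqxx !orbT.
have b1 : forall y, `|cos (th + dotn m y)| <= 1 :> R.
  by move=> y; rewrite ler_norml cos_geN1 cos_le1.
have cw n : continuous (fun x => wave A B n x * cos (th + dotn m x)).
  exact: row_continuousM (@continuous_wave _ _ A B n) (@continuous_cos_dotn _ _ th m).
have bw n x : `|wave A B n x * cos (th + dotn m x)| <= `|A n| + `|B n|.
  by rewrite normrM; apply: (le_trans _ (wave_norm A B n x)); rewrite ler_piMr.
have [cs bs TIs] := torus_integral_sum F cw bw.
have VE : V = TI (fun x => \sum_(n <- F) wave A B n x * cos (th + dotn m x)).
  rewrite TIs; under eq_bigr => n _ do rewrite torus_integral_wave_moment.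
  rewrite -mulr_suml -mulr_sumr /V; congr (_ * _ / _).
  transitivity (\sum_(n <- F) ((n == - m)%:R * (A n * cos th) + (n == m)%:R * (A n * cos th)
     + ((n == - m)%:R * (- (B n * sin th)) + (n == m)%:R * (B n * sin th)))).
    rewrite !big_split/= !sum_fset_delta//; ring.
  by apply: eq_bigr => n _; ring.
have ch : continuous (fun x => wave_sum A B x * cos (th + dotn m x)).
  exact: row_continuousM continuous_wave_sum (@continuous_cos_dotn _ _ th m).
have bh x : `|wave_sum A B x * cos (th + dotn m x)| <= S.
  by rewrite normrM; apply: (le_trans _ (wave_sum_bound x)); rewrite ler_piMr.
rewrite VE -mulN1r -(torus_integralZ _ cs bs) -(torus_integralD ch (row_continuousZ cs) bh (K := \sum_(n <- F) (`|A n| + `|B n|))); last first.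
  by move=> x; rewrite mulN1r normrN.
rewrite (_ : e = (2 * pi) ^+ N * (e / (2 * pi) ^+ N)); last by rewrite mulrC mulfVK ?gt_eqF.
apply: torus_integral_bound.
  exact: row_continuousD ch (row_continuousZ cs).
move=> x; rewrite mulN1r -mulr_suml -mulrBl normrM distrC.
have := H x I; rewrite mulr1; apply: le_trans; by rewrite ler_piMr.
Qed.

Lemma rperiodic_wave_sum : rperiodic (wave_sum A B).
Proof.
move=> x j; rewrite /wave_sum; congr rsum.
by apply/funext => n; exact: rperiodic_wave.
Qed.

End WaveSums.

Section ReInversion.
Variable G : 'rV[R]_N -> R[i].
Hypothesis hG : torus_continuous G.
Variable S : R.
Let A n := complex.Re (fourier_coef G n).
Let B n := complex.Im (fourier_coef G n).
Hypothesis hS : forall F : {fset 'rV[int]_N}, \sum_(n <- F) (`|A n| + `|B n|) <= S.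
Let g1 x := complex.Re (G x).
Let g2 x := complex.Im (G x).
Let h := wave_sum A B.

(** By [wave_sum_moment] both sides have the same moments, so [torus_uniqueness]
    applies to their difference. *)
Lemma Re_inversion x : complex.Re (G x) = wave_sum A B x.
Proof.
have [M hM] := torus_continuous_bounded hG.
have [pG [c1 c2]] := hG.
have M1 x' : `|g1 x'| <= M by have [] := hM x'.
have M2 x' : `|g2 x'| <= M by have [] := hM x'.
have cosb : forall n y, `|cos (dotn n y)| <= 1 :> R.
  by move=> n y; rewrite ler_norml cos_geN1 cos_le1.
have sinb : forall n y, `|sin (dotn n y)| <= 1 :> R.
  by move=> n y; rewrite ler_norml sin_geN1 sin_le1.
have mb (u v : R) : `|u| <= M -> `|v| <= 1 -> `|u * v| <= M.
  by move=> hu hv; rewrite normrM; apply: (le_trans _ hu); rewrite ler_piMr.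
pose cM := fun (u v : 'rV[R]_N -> R) (cu : continuous u) (cv : continuous v) =>
  row_continuousM cu cv.
have cc n := @continuous_cos_dotn0 R N n; have cs n := @continuous_sin_dotn R N n.
have mM (u v : 'rV[R]_N -> R) : (forall x', `|u x'| <= M) -> (forall x', `|v x'| <= 1) ->
  forall x', `|u x' * v x'| <= M by move=> hu hv x'; exact: mb.
pose p m := TI (fun x => g1 x * cos (dotn m x)).
pose q m := TI (fun x => g2 x * sin (dotn m x)).
pose r m := TI (fun x => g2 x * cos (dotn m x)).
pose s m := TI (fun x => g1 x * sin (dotn m x)).
have AE m : A m = (2 * pi) ^- N * (p m + q m).
  rewrite /A Re_fourier_coef (torus_integralD (cM _ _ c1 (cc m)) (cM _ _ c2 (cs m))
    (mM _ _ M1 (cosb m)) (mM _ _ M2 (sinb m))) //.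
have BE m : B m = (2 * pi) ^- N * (r m - s m).
  rewrite /B Im_fourier_coef -[- s m]mulN1r.
  rewrite -(torus_integralZ _ (cM _ _ c1 (cs m)) (mM _ _ M1 (sinb m))).
  rewrite -(torus_integralD (cM _ _ c2 (cc m)) (row_continuousZ (cM _ _ c1 (cs m)))
    (mM _ _ M2 (cosb m)) (K := M)); last first.
    by move=> x'; rewrite mulN1r normrN; exact: mM M1 (sinb m) x'.
  by congr (_ * TI _); apply/funext => x'; rewrite mulN1r.
have pN m : p (- m) = p m by congr TI; apply/funext => x'; rewrite dotnN cosN.
have rN m : r (- m) = r m by congr TI; apply/funext => x'; rewrite dotnN cosN.
have qN m : q (- m) = - q m.
  rewrite -[RHS]mulN1r -(torus_integralZ _ (cM _ _ c2 (cs m)) (mM _ _ M2 (sinb m))).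
  by congr TI; apply/funext => x'; rewrite dotnN sinN mulrN mulN1r.
have sN m : s (- m) = - s m.
  rewrite -[RHS]mulN1r -(torus_integralZ _ (cM _ _ c1 (cs m)) (mM _ _ M1 (sinb m))).
  by congr TI; apply/funext => x'; rewrite dotnN sinN mulrN mulN1r.
pose w x := g1 x + - 1 * h x.
have cw : continuous w by exact: row_continuousD c1 (row_continuousZ (continuous_wave_sum hS)).
suff : w x = 0 by rewrite /w mulN1r => /subr0_eq.
apply: (torus_uniqueness cw).
  move=> x' j; by rewrite /w /g1 pG /h rperiodic_wave_sum.
move=> th m.
have ct := @continuous_cos_dotn R N th m.
have bt : forall y, `|cos (th + dotn m y)| <= 1 :> R.
  by move=> y; rewrite ler_norml cos_geN1 cos_le1.
have -> : (fun x => w x * cos (th + dotn m x)) =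
   (fun x => (cos th * (g1 x * cos (dotn m x)) + - sin th * (g1 x * sin (dotn m x))) +
     - 1 * (h x * cos (th + dotn m x))).
  apply/funext => x'; rewrite /w mulrDl -mulrA; congr (_ + _).
  by rewrite cosD; ring.
have bZ (c : R) (u : 'rV[R]_N -> R) (K : R) : (forall x', `|u x'| <= K) ->
    forall x', `|c * u x'| <= `|c| * K.
  by move=> hu x'; rewrite normrM; apply: ler_wpM2l.
have ch := cM _ _ (continuous_wave_sum hS) ct.
have bh : forall x', `|h x' * cos (th + dotn m x')| <= S.
  by move=> x'; rewrite normrM; apply: (le_trans _ (wave_sum_bound hS x')); rewrite ler_piMr.
have k1 := row_continuousZ (c := cos th) (cM _ _ c1 (cc m)).
have k2 := row_continuousZ (c := - sin th) (cM _ _ c1 (cs m)).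
have l1 := bZ (cos th) _ _ (mM _ _ M1 (cosb m)).
have l2 := bZ (- sin th) _ _ (mM _ _ M1 (sinb m)).
rewrite (torus_integralD (row_continuousD k1 k2) (row_continuousZ ch) (K := `|- 1| * S)
  (M := `|cos th| * M + `|- sin th| * M)); last 2 first.
- by move=> x'; apply: (le_trans (ler_normD _ _)); exact: lerD (l1 x') (l2 x').
- exact: bZ.
rewrite (torus_integralD k1 k2 l1 l2) (torus_integralZ _ ch bh).
rewrite (torus_integralZ _ (cM _ _ c1 (cc m)) (mM _ _ M1 (cosb m))).
rewrite (torus_integralZ _ (cM _ _ c1 (cs m)) (mM _ _ M1 (sinb m))).
rewrite (wave_sum_moment hS) !AE !BE pN rN qN sN -/(p m) -/(s m).
have : (2 * pi) ^+ N != 0 :> R by rewrite expf_neq0// gt_eqF// two_pi_gt0.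
move: ((2 * pi) ^+ N) (p m) (q m) (r m) (s m) (cos th) (sin th) => P p' q' r' s' u v P0.
by field.
Qed.

End ReInversion.

(** The imaginary part is the real part of [- i G]. *)
Lemma Im_inversion G (S : R) : torus_continuous G ->
  (forall F : {fset 'rV[int]_N}, \sum_(n <- F) (`|complex.Re (fourier_coef G n)| +
     `|complex.Im (fourier_coef G n)|) <= S) ->
  forall x, complex.Im (G x) = wave_sum (fun n => complex.Im (fourier_coef G n))
    (fun n => - complex.Re (fourier_coef G n)) x.
Proof.
move=> hG hS x; have [M hM] := torus_continuous_bounded hG.
have [pG [c1 c2]] := hG.
pose G' x := complex.Im (G x) +i* - complex.Re (G x).
have eR n : complex.Re (fourier_coef G' n) = complex.Im (fourier_coef G n).
  rewrite Re_fourier_coef Im_fourier_coef; congr (_ * TI _); apply/funext => y /=.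
  by rewrite mulNr.
have eI n : complex.Im (fourier_coef G' n) = - complex.Re (fourier_coef G n).
  rewrite Re_fourier_coef Im_fourier_coef -mulrN; congr (_ * _).
  have cu : continuous (fun y => complex.Re (G y) * cos (dotn n y) +
      complex.Im (G y) * sin (dotn n y)).
    exact: row_continuousD (row_continuousM c1 (@continuous_cos_dotn0 _ _ n))
      (row_continuousM c2 (@continuous_sin_dotn _ _ n)).
  rewrite -[RHS]mulN1r -(torus_integralZ _ cu (M := M + M)).
    by congr TI; apply/funext => y /=; ring.
  move=> y; have [h1 h2] := hM y; apply: (le_trans (ler_normD _ _)); rewrite !normrM.
  apply: lerD; [apply: (le_trans _ h1)|apply: (le_trans _ h2)].
    by rewrite ler_piMr// ler_norml cos_geN1 cos_le1.
  by rewrite ler_piMr// ler_norml sin_geN1 sin_le1.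
have hG' : torus_continuous G'.
  split; first by move=> y j; rewrite /G' !pG.
  split => //=; apply: (row_continuous_ext _ (row_continuousZ (c := -1) c1)) => y.
  by rewrite mulN1r.
rewrite -[LHS]/(complex.Re (G' x)) (@Re_inversion G' hG' S).
  by congr wave_sum; apply/funext => n.
move=> F; apply: le_trans (hS F); apply: ler_sum => n _.
by rewrite eR eI normrN addrC.
Qed.

End FourierCoefficients.

(** * Termwise differentiation in space *)

Section RsumAlgebra.
Context {R : realType} {I : choiceType}.
Local Open Scope fset_scope.
Local Open Scope ring_scope.

Lemma has_rsum0 : has_rsum (fun _ : I => 0 : R) 0.
Proof. by move=> e e0; exists fset0 => F _; rewrite big1// subrr normr0. Qed.

Lemma has_rsumZ (k : R) (c : I -> R) S : has_rsum c S -> has_rsum (fun i => k * c i) (k * S).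
Proof.
move=> h e e0.
have k1 : 0 < `|k| + 1 by rewrite ltr_wpDl.
have [F0 H] := h _ (divr_gt0 e0 k1); exists F0 => F /H {}H.
rewrite -mulr_sumr -mulrBr normrM; move: H; rewrite ltr_pdivlMr// mulrC.
apply: le_lt_trans; apply: ler_wpM2r => //; by rewrite lerDl.
Qed.

Lemma has_rsumD (b c : I -> R) S S' : has_rsum b S -> has_rsum c S' ->
  has_rsum (fun i => b i + c i) (S + S').
Proof.
move=> h /(has_rsumZ (-1)) /(has_rsumB h).
rewrite mulN1r opprK; congr has_rsum; apply/funext => i.
by rewrite mulN1r opprK.
Qed.

Lemma has_rsum_sum (J : Type) (r : seq J) (c : J -> I -> R) (S : J -> R) :
  (forall j, has_rsum (c j) (S j)) ->
  has_rsum (fun i => \sum_(j <- r) c j i) (\sum_(j <- r) S j).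
Proof.
move=> h; elim: r => [|j r ih].
  rewrite big_nil; have := has_rsum0; congr has_rsum; apply/funext => i.
  by rewrite big_nil.
rewrite big_cons; have := has_rsumD (h j) ih; congr has_rsum; apply/funext => i.
by rewrite big_cons.
Qed.

Lemma has_rsum_single (i0 : I) (c : I -> R) : (forall i, i != i0 -> c i = 0) ->
  has_rsum c (c i0).
Proof.
move=> h e e0; exists [fset i0] => F /fsubsetP sub.
have iF : i0 \in F by apply: sub; rewrite inE.
rewrite (bigD1_seq i0 iF (fset_uniq F))/= big1 ?addr0 ?subrr ?normr0//.
Qed.

End RsumAlgebra.

Section WaveDerivatives.
Context {R : realType} {N : nat}.
Implicit Types (n m : 'rV[int]_N) (x : 'rV[R]_N) (A B : 'rV[int]_N -> R) (j : 'I_N).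

Lemma lipschitz1 (f df : R -> R) (a b : R) :
  (forall y : R, is_derive y (1 : R) f (df y)) -> (forall y, `|df y| <= 1) ->
  `|f a - f b| <= `|a - b|.
Proof.
move=> fd d1; wlog ab : a b / a < b.
  move=> H; case: (ltgtP a b) => [|ba|->]; [exact: H| |by rewrite !subrr].
  by rewrite distrC (distrC a); exact: H.
have cf : {within `[a, b], continuous f}.
  apply: continuous_subspaceT => y; apply: differentiable_continuous.
  by apply/derivable1_diffP; have [] := fd y.
have [c _ e] := MVT ab (fun y _ => fd y) cf.
by rewrite distrC e normrM (distrC a) ler_piMl.
Qed.

Lemma dotn_shift n x j (r : R) :
  dotn n (r *: unit_vec j + x) = dotn n x + (n 0 j)%:~R * r.
Proof.
rewrite addrC /dotn.
under eq_bigr => i _ do rewrite shift_unit_vecE mulrDr.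
rewrite big_split/=; congr (_ + _); rewrite (bigD1 j)//= eqxx mulr1 big1 ?addr0//.
by move=> i /negbTE ij; rewrite ij !mulr0.
Qed.

(** [dwaveA] and [dwaveB] are the amplitudes of the j-th partial derivative of a
    wave. *)
Definition dwaveA j (B : 'rV[int]_N -> R) n : R := - ((n 0 j)%:~R * B n).
Definition dwaveB j (A : 'rV[int]_N -> R) n : R := (n 0 j)%:~R * A n.

Lemma derive_quotient (F : R -> R) (d : R) : is_derive (0 : R) (1 : R) F d ->
  r^-1 * (F r - F 0) @[r --> (0 : R)^'] --> d.
Proof.
move=> [dv dE]; move: dv; rewrite -dE /derivable /derive.
have -> : (fun h : R => h^-1 *: ((F \o shift (0 : R)) (h *: (1 : R)) - F 0)) =
          (fun r : R => r^-1 * (F r - F 0)); last exact.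
by apply/funext => r; rewrite /GRing.scale /= mulr1 addr0.
Qed.

Lemma quotient_derive (g : 'rV[R]_N -> R) x (v : 'rV[R]_N) (d : R) :
  r^-1 * (g (r *: v + x) - g x) @[r --> (0 : R)^'] --> d -> is_derive x v g d.
Proof.
move=> h; apply: DeriveDef; first by apply/cvg_ex; exists d; exact: h.
by apply/cvg_lim; [exact: Rhausdorff | exact: h].
Qed.

Lemma wave_shift A B n x j (r : R) : wave A B n (r *: unit_vec j + x) =
  A n * cos (dotn n x + (n 0 j)%:~R * r) - B n * sin (dotn n x + (n 0 j)%:~R * r).
Proof. by rewrite /wave dotn_shift. Qed.

Lemma wave_quotient_cvg A B n x j :
  r^-1 * (wave A B n (r *: unit_vec j + x) - wave A B n x) @[r --> (0 : R)^'] -->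
  wave (dwaveA j B) (dwaveB j A) n x.
Proof.
pose k : R := (n 0 j)%:~R; pose th : R := dotn n x.
have dc := derive_quotient
  (@is_derive_comp_affine R (@cos R) (fun y => - sin y) th k 0 (@is_derive_cos R)).
have ds := derive_quotient
  (@is_derive_comp_affine R (@sin R) (@cos R) th k 0 (@is_derive_sin R)).
have cv := cvgB (cvgMl_tmp (a := A n) dc) (cvgMl_tmp (a := B n) ds).
have -> : wave (dwaveA j B) (dwaveB j A) n x =
    A n * (k * - sin (th + k * 0)) - B n * (k * cos (th + k * 0)).
  by rewrite /wave /dwaveA /dwaveB mulr0 addr0 -/k -/th; ring.
rewrite (_ : (fun r : R => _) = (fun r => A n * (r^-1 * (cos (th + k * r) - cos (th + k * 0))) -
  B n * (r^-1 * (sin (th + k * r) - sin (th + k * 0))))); first exact: cv.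
apply/funext => r; rewrite wave_shift /wave -/k -/th mulr0 addr0.
by move: (r^-1) => r'; ring.
Qed.

Lemma wave_quotient_bound A B n x j (r : R) : r != 0 ->
  `|r^-1 * (wave A B n (r *: unit_vec j + x) - wave A B n x)| <=
  `|(n 0 j)%:~R| * (`|A n| + `|B n|).
Proof.
move=> r0; rewrite wave_shift /wave.
have sinb (y : R) : `|sin y| <= 1 by rewrite ler_norml sin_geN1 sin_le1.
have cosb (y : R) : `|cos y| <= 1 by rewrite ler_norml cos_geN1 cos_le1.
have nsinb (y : R) : `|- sin y| <= 1 by rewrite normrN.
pose k : R := (n 0 j)%:~R; pose th : R := dotn n x.
have l1 := lipschitz1 (th + k * r) th (@is_derive_cos R) nsinb.
have l2 := lipschitz1 (th + k * r) th (@is_derive_sin R) cosb.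
rewrite addrAC subrr add0r in l1 l2.
rewrite -/k -/th.
have -> : A n * cos (th + k * r) - B n * sin (th + k * r) - (A n * cos th - B n * sin th) =
  A n * (cos (th + k * r) - cos th) - B n * (sin (th + k * r) - sin th) by ring.
rewrite normrM normfV mulrC ler_pdivrMr ?normr_gt0//.
apply: (le_trans (ler_normB _ _)); rewrite !normrM.
have m1 := ler_wpM2l (normr_ge0 (A n)) l1; have m2 := ler_wpM2l (normr_ge0 (B n)) l2.
apply: (le_trans (lerD m1 m2)); rewrite normrM.
rewrite le_eqVlt; apply/orP; left; apply/eqP.
by move: `|k| `|r| `|A n| `|B n| => p q s t; ring.
Qed.

(** The terms of the difference quotient, completed by the derivative at r = 0,
    are dominated by the summable amplitudes uniformly in [r]; so the sum passes to
    the limit. *)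
Lemma wave_sum_derive A B x j (S : R) :
  (forall F : {fset 'rV[int]_N},
     \sum_(n <- F) (1 + `|(n 0%R j)%:~R|) * (`|A n| + `|B n|) <= S) ->
  is_derive x (unit_vec j) (wave_sum A B) (wave_sum (dwaveA j B) (dwaveB j A) x).
Proof.
move=> hS; apply: quotient_derive.
(* value at r = 0 chosen so that the terms are continuous there *)
pose T := fun n (r : R) => if r == 0 then wave (dwaveA j B) (dwaveB j A) n x
  else r^-1 * (wave A B n (r *: unit_vec j + x) - wave A B n x).
have bT n r : `|T n r| <= (1 + `|(n 0 j)%:~R|) * (`|A n| + `|B n|).
  apply: (@le_trans _ _ (`|(n 0 j)%:~R| * (`|A n| + `|B n|))); last first.
    by apply: ler_wpM2r; [exact: addr_ge0 | rewrite lerDr].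
  rewrite /T; case: ifPn => [_|r0]; last exact: wave_quotient_bound.
  apply: (le_trans (wave_norm _ _ _ _)).
  by rewrite /dwaveA /dwaveB normrN !normrM -mulrDr addrC.
have st : small_tails [set: R] (fun=> 1) T.
  move=> e e0; have [n|F0 H] := bounded_sum_tails _ hS e0.
    by rewrite mulr_ge0// addr_ge0.
  exists F0 => F dF r _; rewrite mulr1; apply: le_trans (H F dF).
  by apply: ler_sum => n _; exact: bT.
have hAB (F : {fset 'rV[int]_N}) : \sum_(n <- F) (`|A n| + `|B n|) <= S.
  apply: le_trans (hS F); apply: ler_sum => n _.
  by rewrite ler_peMl ?addr_ge0// lerDl.
have stW := wave_small_tails hAB.
have quotE r : r != 0 ->
    rsum (T ^~ r) = r^-1 * (wave_sum A B (r *: unit_vec j + x) - wave_sum A B x).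
  move=> r0; apply: has_rsum_rsum.
  have h1 := small_tails_rsum stW (I : [set: 'rV[R]_N] (r *: unit_vec j + x)).
  have h2 := small_tails_rsum stW (I : [set: 'rV[R]_N] x).
  have := has_rsumZ r^-1 (has_rsumB h1 h2).
  by rewrite (_ : (fun i => _) = T ^~ r)//; apply/funext => n; rewrite /T (negbTE r0).
have -> : wave_sum (dwaveA j B) (dwaveB j A) x = rsum (T ^~ 0).
  by rewrite /wave_sum; congr rsum; apply/funext => n; rewrite /T eqxx.
have cT n : T n r @[r --> (0 : R)^'] --> T n 0.
  rewrite {2}/T eqxx; apply: cvg_trans (@wave_quotient_cvg A B n x j).
  apply: near_eq_cvg; near=> r; rewrite /T ifF//; apply/negbTE.
  near: r; exact: nbhs_dnbhs_neq.
have nD : \forall r \near (0 : R)^', setT r /\ (1 : R) <= 1 by near=> r; split.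
have cv := @rsum_cvg R _ R (0 : R)^' _ setT (fun=> 1) T 0 1 (fun _ _ => ltr01) st I
  (lexx _) nD cT.
apply: cvg_trans (cv _) ; apply: (@near_eq_cvg _ _ (0 : R)^' _ (fun r => rsum (T ^~ r))
  (fun r => r^-1 * (wave_sum A B (r *: unit_vec j + x) - wave_sum A B x))).
near=> r; apply: quotE.
near: r; exact: nbhs_dnbhs_neq.
Unshelve. all: by end_near. Qed.

(** [|n_i| <= 1 + |n|^2] and [|n_i| |n_j| <= |n|^2]: second-order symbols are
    dominated by the symbol of [1 - Laplacian]. *)
Lemma sqnorm_coord n i : (n 0 i)%:~R ^+ 2 <= sqnorm n :> R.
Proof. by rewrite /sqnorm (bigD1 i)//= lerDl sumr_ge0// => k _; rewrite sqr_ge0. Qed.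

Lemma coord_weight1 n i : 1 + `|(n 0 i)%:~R| <= 2 * (1 + sqnorm n) :> R.
Proof.
have := sqnorm_coord n i; rewrite -real_normK ?num_real//.
move: `|_| (sqnorm n) => p l; nra.
Qed.

Lemma coord_weight2 n i j :
  (1 + `|(n 0 i)%:~R|) * `|(n 0 j)%:~R| <= 2 * (1 + sqnorm n) :> R.
Proof.
have := sqnorm_coord n i; have := sqnorm_coord n j.
rewrite -[X in X <= _ -> _](@real_normK R) ?num_real//.
rewrite -[X in _ -> X <= _ -> _](@real_normK R) ?num_real//.
move: `|(n 0 j)%:~R| `|(n 0 i)%:~R| (sqnorm n) => p q l h1 h2.
have := sqr_ge0 (p - q); have := sqr_ge0 (p - 1); nra.
Qed.

Section SecondOrder.
Variables (A B : 'rV[int]_N -> R) (S : R).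
Hypothesis hS : forall F : {fset 'rV[int]_N},
  \sum_(n <- F) (1 + sqnorm n) * (`|A n| + `|B n|) <= S.

Let le_hS (w : 'rV[int]_N -> R) (K : R) : 0 <= K ->
  (forall n, w n <= K * ((1 + sqnorm n) * (`|A n| + `|B n|))) ->
  forall F : {fset 'rV[int]_N}, \sum_(n <- F) w n <= K * S.
Proof.
move=> K0 h F; apply: le_trans (ler_wpM2l K0 (hS F)).
by rewrite mulr_sumr; apply: ler_sum => n _.
Qed.

Let ab0 n : 0 <= `|A n| + `|B n|. Proof. by rewrite addr_ge0. Qed.

Let hS0 (F : {fset 'rV[int]_N}) : \sum_(n <- F) (`|A n| + `|B n|) <= 1 * S.
Proof.
apply: (@le_hS (fun n => `|A n| + `|B n|)) => // n; rewrite mul1r ler_peMl//.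
by rewrite lerDl sqnorm_ge0.
Qed.

Let hS1 i (F : {fset 'rV[int]_N}) : \sum_(n <- F) (1 + `|(n 0%R i)%:~R|) * (`|A n| + `|B n|) <= 2 * S.
Proof.
apply: (@le_hS (fun n => (1 + `|(n 0 i)%:~R|) * (`|A n| + `|B n|))) => // n; rewrite mulrA; apply: ler_wpM2r => //.
exact: coord_weight1.
Qed.

Let hS2 i j (F : {fset 'rV[int]_N}) : \sum_(n <- F) (1 + `|(n 0%R i)%:~R|) *
  (`|dwaveA j B n| + `|dwaveB j A n|) <= 2 * S.
Proof.
apply: (@le_hS (fun n => (1 + `|(n 0 i)%:~R|) * (`|dwaveA j B n| + `|dwaveB j A n|))) => // n.
rewrite /dwaveA /dwaveB normrN !normrM -mulrDr (addrC `|B n|) !mulrA; apply: ler_wpM2r => //; exact: coord_weight2.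
Qed.

Let hS1' j (F : {fset 'rV[int]_N}) : \sum_(n <- F) (`|dwaveA j B n| + `|dwaveB j A n|) <= 2 * S.
Proof.
apply: le_trans (hS2 j j F); apply: ler_sum => n _.
by rewrite ler_peMl ?addr_ge0// lerDl.
Qed.

Let hS2' i j (F : {fset 'rV[int]_N}) : \sum_(n <- F) (`|dwaveA i (dwaveB j A) n| + `|dwaveB i (dwaveA j B) n|) <= 2 * S.
Proof.
apply: le_trans (hS2 i j F); apply: ler_sum => n _.
have -> : `|dwaveA i (dwaveB j A) n| + `|dwaveB i (dwaveA j B) n| =
    `|(n 0 i)%:~R| * (`|dwaveA j B n| + `|dwaveB j A n|).
  by rewrite {1}/dwaveA {2}/dwaveB normrN !normrM -mulrDr addrC.
by apply: ler_wpM2r; [rewrite addr_ge0 | rewrite lerDr].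
Qed.

Lemma derive_wave_sum j :
  'D_(unit_vec j) (wave_sum A B) = wave_sum (dwaveA j B) (dwaveB j A).
Proof. by apply/funext => x; have [_ ->] := wave_sum_derive x (hS1 j). Qed.

Lemma derive2_wave_sum i j :
  'D_(unit_vec i) (wave_sum (dwaveA j B) (dwaveB j A)) =
  wave_sum (dwaveA i (dwaveB j A)) (dwaveB i (dwaveA j B)).
Proof. by apply/funext => x; have [_ ->] := wave_sum_derive x (hS2 i j). Qed.

Lemma wave_sum_C2 : is_C2 (wave_sum A B).
Proof.
have C1 : is_C1 (wave_sum A B).
  split; first exact: continuous_wave_sum hS0.
  move=> j; split=> [x|]; first by have [] := wave_sum_derive x (hS1 j).
  rewrite derive_wave_sum; exact: continuous_wave_sum (hS1' j).
split=> // j; rewrite derive_wave_sum; split; first exact: continuous_wave_sum (hS1' j).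
move=> i; split=> [x|]; first by have [] := wave_sum_derive x (hS2 i j).
rewrite derive2_wave_sum; exact: continuous_wave_sum (hS2' i j).
Qed.

Lemma laplacian_wave_sum x : laplacian (wave_sum A B) x =
  - wave_sum (fun n => sqnorm n * A n) (fun n => sqnorm n * B n) x.
Proof.
transitivity (\sum_j wave_sum (dwaveA j (dwaveB j A)) (dwaveB j (dwaveA j B)) x).
  by apply: eq_bigr => j _; rewrite derive_wave_sum -derive2_wave_sum.
have h j : has_rsum (fun n => wave (dwaveA j (dwaveB j A)) (dwaveB j (dwaveA j B)) n x)
  (wave_sum (dwaveA j (dwaveB j A)) (dwaveB j (dwaveA j B)) x).
  exact: small_tails_rsum (wave_small_tails (hS2' j j)) (I : [set: 'rV[R]_N] x).
have := has_rsumZ (-1) (has_rsum_sum (index_enum 'I_N) h).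
rewrite mulN1r => hs; apply/eqP; rewrite -eqr_oppLR; apply/eqP/esym/has_rsum_rsum.
move: hs; congr has_rsum; apply/funext => n.
rewrite mulN1r -sumrN /wave /sqnorm !mulr_suml -sumrB.
by apply: eq_bigr => j _; rewrite /dwaveA /dwaveB; ring.
Qed.

End SecondOrder.

(** A single wave is a sum of waves, to which the results on sums apply. *)
Lemma wave_sum_single A B n x :
  wave_sum (fun m => (m == n)%:R * A m) (fun m => (m == n)%:R * B m) x = wave A B n x.
Proof.
rewrite /wave_sum; set c := fun m => _.
rewrite (has_rsum_rsum (has_rsum_single (i0 := n) (c := c) _)).
  by rewrite /c /wave eqxx !mul1r.
by move=> m /negbTE mn; rewrite /c /wave mn !mul0r subrr.
Qed.

Lemma single_summable A B n (F : {fset 'rV[int]_N}) :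
  \sum_(m <- F) (1 + sqnorm m) * (`|(m == n)%:R * A m| + `|(m == n)%:R * B m|) <=
  (1 + sqnorm n) * (`|A n| + `|B n|).
Proof.
have E m : (1 + sqnorm m) * (`|(m == n)%:R * A m| + `|(m == n)%:R * B m|) =
    (m == n)%:R * ((1 + sqnorm m) * (`|A m| + `|B m|)).
  by rewrite !normrM !normr_nat -mulrDr mulrCA.
under eq_bigr => m _ do rewrite E.
have p0 m : 0 <= (1 + sqnorm m) * (`|A m| + `|B m|) :> R.
  by rewrite mulr_ge0 ?addr_ge0 ?sqnorm_ge0.
have [nF|nF] := boolP (n \in F).
  by rewrite (sum_fset_delta (fun m => (1 + sqnorm m) * (`|A m| + `|B m|)) nF).
rewrite big_seq big1// => m mF; case: eqP => [e|_]; last by rewrite mul0r.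
by move: mF; rewrite e (negbTE nF).
Qed.

End WaveDerivatives.

(** * Families of modes *)

Lemma norm_Rintegral_le (R : realType) (D : set R) (h : R -> R) : measurable D ->
  (@lebesgue_measure R).-integrable D (EFin \o h) ->
  `|\int[@lebesgue_measure R]_(x in D) h x| <= \int[@lebesgue_measure R]_(x in D) `|h x|.
Proof. by move=> mD ih; apply: (le_trans (le_normr_Rintegral _ ih)). Qed.

Lemma eq_frac_integral (R : realType) (al s : R) (u w : R -> R) :
  (forall r, 0 <= r <= s -> u r = w r) -> frac_integral al u s = frac_integral al w s.
Proof.
move=> uw; rewrite /frac_integral; congr (_ * _); apply: eq_Rintegral => r.
by rewrite inE/= in_itv/= => /uw ->.
Qed.

Section Modes.
Context {R : realType} {I : choiceType}.
Local Notation mu := (@lebesgue_measure R).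
Variables (rho T e : R).
Hypotheses (rho01 : 0 < rho < 1) (T0 : 0 < T) (e01 : 0 < e <= 1).
Variables (l p : I -> R) (g : I -> R -> R) (M : I -> R).
Hypotheses (l0 : forall i, 0 <= l i) (cg : forall i, continuous (g i))
  (gM : forall i s, `|g i s| <= M i).
Hypothesis tp : small_tails [set: R] (fun=> 1) (fun i _ => p i).
Hypothesis tg : small_tails [set: R] (fun=> 1) (fun i s => (1 + l i) `^ e * g i s).
Local Notation E := (mittag_leffler rho).
Local Notation kern := (ml_kernel rho rho).
Local Notation kconv := (kconv rho).

Local Opaque mittag_leffler Gamma powR integral Rintegral ml_kernel rl_kernel frac_integral.

(** Summing the convolutions under the integral sign trades the weight [w] for
    the weight [v] on the data and the integrable majorant [W]. *)
Lemma sum_kconv_bound (F : {fset I}) (w v : I -> R) (W : R -> R) (B t : R) :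
  (forall i, 0 <= w i) -> (forall i, 0 <= v i) -> (forall x, 0 < x -> 0 <= W x) ->
  (forall i x, 0 < x -> w i * kern (l i) x <= v i * W x) ->
  mu.-integrable `[0, t] (EFin \o W) ->
  (forall s, \sum_(i <- F) v i * `|g i s| <= B) ->
  \sum_(i <- F) w i * `|kconv (l i) (g i) t| <= B * \int[mu]_(x in `[0, t]) W x.
Proof.
move=> w0 v0 W0 wk iW gB.
have mg i : measurable_fun [set: R] (g i) by exact: continuous_measurable_fun.
pose h i x := w i * `|g i (t - x) * kern (l i) x|.
have iki i : mu.-integrable `[0, t] (EFin \o (fun x => g i (t - x) * kern (l i) x)).
  exact: kconv_integrable.
have ih i : mu.-integrable `[0, t] (EFin \o h i).
  exact: (rintegrableZ (measurable_itv _) (w i) (rintegrable_norm (iki i))).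
have ind : forall r : seq I,
    mu.-integrable `[0, t] (EFin \o (fun x => \sum_(i <- r) h i x)) /\
    \sum_(i <- r) w i * `|kconv (l i) (g i) t| <=
      \int[mu]_(x in `[0, t]) \sum_(i <- r) h i x.
  elim=> [|i r [ih1 ih2]].
    rewrite big_nil; have -> : (fun x => \sum_(i <- [::]) h i x) = cst 0.
      by apply/funext => x; rewrite big_nil.
    split; first exact: integrable0.
    by rewrite Rintegral_cst//; rewrite mul0r.
  have -> : (fun x => \sum_(i <- i :: r) h i x) = (fun x => h i x + \sum_(i <- r) h i x).
    by apply/funext => x; rewrite big_cons.
  split; first exact: (rintegrableD (measurable_itv _) (ih i) ih1).
  rewrite big_cons (rRintegralD (measurable_itv _) (ih i) ih1); apply: lerD ih2.
  rewrite /h (rRintegralZ (measurable_itv _) (w i) (rintegrable_norm (iki i))).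
  apply: ler_wpM2l; first exact: w0.
  by rewrite kconvE; exact: (norm_Rintegral_le (measurable_itv _) (iki i)).
have [iS SE] := ind F; apply: (le_trans SE); rewrite -(rRintegralZ (measurable_itv _) B iW).
apply: (le_Rintegral_itv0 iS (rintegrableZ (measurable_itv _) B iW)).
move=> x /andP[x0 xt].
apply: (@le_trans _ _ ((\sum_(i <- F) v i * `|g i (t - x)|) * W x)); last first.
  by apply: ler_wpM2r; [exact: W0 | exact: gB].
rewrite mulr_suml; apply: ler_sum => i _.
rewrite /h normrM (ger0_norm (kern_ge0 rho01 x (l0 i))) mulrCA [leRHS]mulrAC mulrC.
by rewrite mulrC [leRHS]mulrC; apply: ler_wpM2l => //; exact: wk.
Qed.

Definition mode (i : I) (t : R) : R := mode_sol rho (l i) (p i) (g i) t.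

Lemma small_tails_sub (X J : choiceType) (D D' : set X) (w : X -> R) (c : J -> X -> R) :
  D' `<=` D -> small_tails D w c -> small_tails D' w c.
Proof.
move=> sub st d d0; have [F0 H] := st _ d0.
by exists F0 => F dF x /sub; exact: H.
Qed.

Let v i := (1 + l i) `^ e.
Let v0 i : 0 <= v i. Proof. exact: powR_ge0. Qed.
Let l1 i : 1 <= 1 + l i. Proof. by rewrite lerDl. Qed.
Let e0 : 0 <= e. Proof. by case/andP: e01 => /ltW. Qed.

Lemma weight_ge1 i : 1 <= v i.
Proof.
have := ge0_ler_powR e0; move=> /(_ 1 (1 + l i)).
rewrite powR1; apply; rewrite ?nnegrE//; exact: le_trans (l1 i).
Qed.

Lemma weight_ge_l i : l i `^ e <= v i.
Proof.
by apply: (ge0_ler_powR e0); rewrite ?nnegrE// ?lerDr// (le_trans (@ler01 R)).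
Qed.

Local Notation D0 := [set t : R | 0 <= t <= T].
Local Notation D1 := [set t : R | 0 < t <= T].

Lemma kconv_tails (w : I -> R) (W : R -> R) :
  (forall i, 0 <= w i) -> (forall x, 0 <= W x) ->
  (forall i x, 0 < x -> w i * kern (l i) x <= v i * W x) ->
  mu.-integrable `[0, T] (EFin \o W) ->
  small_tails D0 (fun=> 1) (fun i t => w i * kconv (l i) (g i) t).
Proof.
move=> w0 W0 wk iW d d0.
pose K := \int[mu]_(x in `[0, T]) W x.
have K0 : 0 <= K by apply: Rintegral_ge0 => x _; exact: W0.
have dK : 0 < d / (K + 1) by rewrite divr_gt0// ltr_wpDl.
have [F0 H] := tg dK; exists F0 => F dF t /andP[t0 tT].
have gB s : \sum_(i <- F) v i * `|g i s| <= d / (K + 1).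
  have := H F dF s Logic.I; rewrite mulr1; apply: le_trans; apply: ler_sum => i _.
  by rewrite normrM (ger0_norm (v0 i)).
have iWt : mu.-integrable `[0, t] (EFin \o W).
  by apply: integrableS iW => //; apply: subset_itvl; rewrite bnd_simp.
have := sum_kconv_bound w0 v0 (fun x _ => W0 x) wk iWt gB.
have -> : \sum_(i <- F) w i * `|kconv (l i) (g i) t| =
    \sum_(i <- F) `|w i * kconv (l i) (g i) t|.
  by apply: eq_bigr => i _; rewrite normrM (ger0_norm (w0 i)).
move=> h; apply: (le_trans h); rewrite mulr1.
have WK : \int[mu]_(x in `[0, t]) W x <= K.
  by apply: (le_Rintegral_itvr _ W0 iW); rewrite t0 tT.
apply: (@le_trans _ _ (d / (K + 1) * K)).
  by apply: ler_wpM2l WK; exact: ltW.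
by rewrite mulrAC ler_pdivrMr ?ltr_wpDl//; apply: ler_wpM2l; [exact: ltW | rewrite lerDl].
Qed.

Lemma mode_tails : small_tails D0 (fun=> 1) mode.
Proof.
have -> : mode = fun i t => p i * E 1 (- l i * t `^ rho) + 1 * kconv (l i) (g i) t.
  by apply/funext => i; apply/funext => t; rewrite mul1r.
apply: small_tailsD.
  apply: (@kconv_tails (fun=> 1) (kern 0)) => //.
  - by move=> x; exact: kern_ge0.
  - move=> i x x0; rewrite mul1r; apply: (le_trans (kern_antitone rho01 (lexx 0) (l0 i) x0)).
    by apply: ler_peMl; [exact: kern_ge0 | exact: weight_ge1].
  - exact: kern_integrable0'.
have tp' : small_tails D0 (fun=> 1) (fun i _ => p i) by exact: small_tails_sub tp.
apply: (small_tails_le ltr01 _ tp') => i t _; rewrite mul1r normrM.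
by apply: ler_piMr => //; exact: ml1_norm.
Qed.

Lemma decay_const_ge0 : 0 <= decay_const rho.
Proof.
rewrite /decay_const le_max; apply/orP; right; rewrite invr_ge0.
by apply/ltW/Gamma_gt0; case/andP: rho01.
Qed.

(** The initial value contributes the singular weight, by [ml1_decay_time]; the
    source contributes a bounded one, by [kern_decay]. *)
Lemma lmode_tails : small_tails D1 (fun t => 1 + t `^ (- rho)) (fun i t => l i * mode i t).
Proof.
have -> : (fun i t => l i * mode i t) =
    fun i t => l i * p i * E 1 (- l i * t `^ rho) + l i * kconv (l i) (g i) t.
  by apply/funext => i; apply/funext => t; rewrite /mode /mode_sol mulrDr mulrA.
apply: small_tailsD.
  apply: (@small_tails_weight _ _ _ D1 (fun=> 1) _ _ 1) => //.
    by move=> t _; rewrite mul1r lerDl powR_ge0.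
  apply: (@small_tails_sub _ _ D0); first by move=> t /= /andP[t0 ->]; rewrite ltW.
  apply: (@kconv_tails l (fun x => decay_const rho * x `^ (e * rho - 1))) => //.
  - by move=> x; apply: mulr_ge0; [exact: decay_const_ge0 | exact: powR_ge0].
  - move=> i x x0; apply: (le_trans (kern_decay rho01 e01 (l0 i) x0)).
    rewrite mulrCA; apply: ler_wpM2r; last exact: weight_ge_l.
    by apply: mulr_ge0; [exact: decay_const_ge0 | exact: powR_ge0].
  - apply: (rintegrableZ (measurable_itv _)); apply: integrable_powR_itv => //.
    by rewrite ltrBrDl subrr mulr_gt0//; [case/andP: e01 | case/andP: rho01].
move=> d d0; have G0 : 0 < Gamma (rho + 1).
  by apply: Gamma_gt0; rewrite addr_gt0//; case/andP: rho01.
have [F0 H] := tp (divr_gt0 d0 G0); exists F0 => F dF t /andP[t0 tT].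
have {}H := H F dF 0 Logic.I; rewrite mulr1 in H.
apply: (@le_trans _ _ (\sum_(i <- F) `|p i| * (Gamma (rho + 1) * t `^ (- rho)))).
  apply: ler_sum => i _; rewrite (mulrC (l i)) -mulrA normrM; apply: ler_wpM2l => //.
  have [E0 _] := andP (ml1_itv rho01 t (l0 i)).
  rewrite ger0_norm; first exact: ml1_decay_time.
  by apply: mulr_ge0.
rewrite -mulr_suml; apply: (le_trans (ler_wpM2r _ H)).
  by rewrite mulr_ge0 ?powR_ge0// ltW.
rewrite mulrA mulfVK; last by rewrite gt_eqF.
by apply: ler_wpM2l; [exact: ltW | rewrite lerDr].
Qed.

Lemma weighted_balance_tails :
  small_tails D1 (fun t => 1 + t `^ (- rho)) (fun i t => g i t - l i * mode i t).
Proof.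
have -> : (fun i t => g i t - l i * mode i t) = (fun i t => g i t + -1 * (l i * mode i t)).
  by apply/funext => i; apply/funext => t; rewrite mulN1r.
apply: small_tailsD.
  apply: (small_tails_le ltr01 _ lmode_tails) => i t _.
  by rewrite normrM normrN normr1.
apply: (@small_tails_weight _ _ _ D1 (fun=> 1) _ _ 1) => //.
  by move=> t _; rewrite mul1r lerDl powR_ge0.
have tg' : small_tails D1 (fun=> 1) (fun i s => v i * g i s) by exact: small_tails_sub tg.
apply: (small_tails_le ltr01 _ tg') => i t _.
by rewrite mul1r normrM (ger0_norm (v0 i)); apply: ler_peMl => //; exact: weight_ge1.
Qed.

Lemma ml1_within_continuous i :
  {within `[0, T], continuous (fun t : R => E 1 (- l i * t `^ rho))}.
Proof.
have c1 : continuous (cst (1 : R) : R -> R) by move=> x; exact: cvg_cst.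
have b1 : forall s : R, `|cst (1 : R) s| <= 1 by move=> s; rewrite /= normr1.
have := kconv_cont (T := T) rho01 (l0 i) c1 b1.
move=> /subspace_continuousP ck; apply/subspace_continuousP => t tT.
have Eq s : `[0, T]%classic s -> E 1 (- l i * s `^ rho) = 1 - l i * kconv (l i) (cst 1) s.
  rewrite /= in_itv/= => /andP[s0 _].
  move: s0; rewrite le_eqVlt => /predU1P[<-|s0].
    have r0 : rho != 0 by rewrite gt_eqF//; case/andP: rho01.
    by rewrite kconv0 mulr0 subr0 (powR0 r0) mulr0 ml0 ?Gamma1 ?invr1//; case/andP: rho01.
  rewrite (ml1_kern rho01 (l i) s0) kconvE; congr (_ - _ * _).
  by apply: eq_Rintegral => x _; rewrite /= mul1r.
rewrite /from_subspace (Eq t tT).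
have cv : 1 - l i * kconv (l i) (cst 1) s @[s --> within `[0, T] (nbhs t)] -->
    1 - l i * kconv (l i) (cst 1) t.
  apply: cvgB; first exact: cvg_cst.
  exact: (cvgMl_tmp (a := l i) (ck t tT)).
apply: cvg_trans cv; apply: near_eq_cvg; near=> s.
have sT : `[0, T]%classic s by near: s; exact: withinT.
by rewrite (Eq s sT).
Unshelve. all: by end_near. Qed.

Lemma mode_within_continuous i : {within `[0, T], continuous (mode i)}.
Proof.
have /subspace_continuousP c1 := @ml1_within_continuous i.
have /subspace_continuousP c2 := kconv_cont (T := T) rho01 (l0 i) (@cg i) (gM i).
apply/subspace_continuousP => t tT; rewrite /from_subspace /mode /mode_sol.
apply: cvgD; last exact: c2.
exact: (cvgMl_tmp (a := p i) (c1 t tT)).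
Qed.

(** [bsum] is the sum of the g_i - l_i v_i, that is, of the Caputo derivatives of
    the modes summed in [msum]. *)
Definition msum t := rsum (mode ^~ t).
Definition bsum t := rsum (fun i => g i t - l i * mode i t).

Lemma msum_within_continuous : {within `[0, T], continuous msum}.
Proof.
apply/subspace_continuousP => t tT; rewrite /from_subspace.
have tT' : D0 t by move: tT; rewrite /= in_itv.
apply: (rsum_cvg _ (D := D0) (w := fun=> 1) (K := 1)) => //.
- exact: mode_tails.
- near=> s; split=> //; have : `[0, T]%classic s by near: s; exact: withinT.
  by rewrite /= in_itv.
- by move=> i; have /subspace_continuousP := @mode_within_continuous i; exact.
Unshelve. all: by end_near. Qed.

Lemma bsum_cvg t : 0 < t <= T -> bsum s @[s --> within `[0, T] (nbhs t)] --> bsum t.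
Proof.
move=> tT; have /andP[t0 tT1] := tT.
have tT' : `[0, T]%classic t by rewrite /= in_itv/= ltW.
have w0 (s : R) : D1 s -> 0 < 1 + s `^ (- rho).
  by move=> _; apply: ltr_pwDl => //; exact: powR_ge0.
have wle (s : R) : t / 2 <= s -> 1 + s `^ (- rho) <= 1 + (t / 2) `^ (- rho).
  move=> ts; rewrite lerD2l; apply: le_powR_neg => //.
    by rewrite oppr_le0; case/andP: rho01 => /ltW.
  by rewrite divr_gt0.
apply: (rsum_cvg _ w0 weighted_balance_tails (K := 1 + (t / 2) `^ (- rho))) => //.
- by apply: wle; lra.
- near=> s.
  have : `[0, T]%classic s by near: s; exact: withinT.
  rewrite /= in_itv/= => /andP[_ sT].
  have s2 : t / 2 <= s.
    by apply/ltW; near: s; apply: cvg_within; apply: lt_nbhsr; lra.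
  split; last exact: wle.
  by rewrite /= sT andbT; apply: lt_le_trans s2; rewrite divr_gt0.
- move=> i; apply: cvgB; first by apply: cvg_within_filter; exact: (@cg i).
  apply: (cvgMl_tmp (a := l i)).
  by have /subspace_continuousP := @mode_within_continuous i; exact.
Unshelve. all: by end_near. Qed.

Lemma frac_integralD (al t B C : R) (u w : R -> R) : 0 < al -> 0 < t ->
  measurable_fun [set: R] u -> measurable_fun [set: R] w ->
  (forall s, 0 <= s <= t -> `|u s| <= B) -> (forall s, 0 <= s <= t -> `|w s| <= C) ->
  frac_integral al (fun s => u s + w s) t = frac_integral al u t + frac_integral al w t.
Proof.
move=> al0 t0 mu_ mw uB wC; rewrite !frac_integralE -mulrDr; congr (_ * _).
rewrite -(rRintegralD (measurable_itv _) (integrable_rl_bounded al0 t0 mu_ uB)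
  (integrable_rl_bounded al0 t0 mw wC)).
by apply: eq_Rintegral => s _; rewrite mulrDr.
Qed.

Lemma frac_integral_bound (al B s : R) (u : R -> R) : 0 < al -> 0 < s <= T ->
  measurable_fun [set: R] u -> (forall r, 0 <= r <= s -> `|u r| <= B) ->
  `|frac_integral al u s| <= B * (T `^ al / Gamma (al + 1)).
Proof.
move=> al0 /andP[s0 sT] mu_ uB.
have B0 : 0 <= B by apply: le_trans (uB 0 _); rewrite // lexx ltW.
have G0 := Gamma_gt0 al0.
have ik := integrable_volterra_powR al0 (@ltr01 R) s0.
have iu := integrable_rl_bounded al0 s0 mu_ uB.
have h : `|\int[mu]_(r in `[0, s]) ((s - r) `^ (al - 1) * u r)| <=
    B * (Gamma al / Gamma (al + 1) * s `^ al).
  apply: (le_trans (norm_Rintegral_le (measurable_itv _) iu)).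
  have -> : Gamma al / Gamma (al + 1) * s `^ al =
      \int[mu]_(r in `[0, s]) ((s - r) `^ (al - 1) * r `^ (1 - 1)).
    by rewrite (volterra_powR al0 (@ltr01 R) s0) Gamma1 mulr1 addrK.
  rewrite -(rRintegralZ (measurable_itv _) B ik).
  apply: (le_Rintegral_itv0 (rintegrable_norm iu) (rintegrableZ (measurable_itv _) B ik)).
  move=> r /andP[r0 rs]; rewrite subrr powRr0 mulr1 normrM mulrC (ger0_norm (powR_ge0 _ _)).
  by apply: ler_wpM2r; [exact: powR_ge0 | apply: uB; rewrite !ltW].
rewrite frac_integralE normrM ger0_norm; last by rewrite invr_ge0 ltW.
apply: (le_trans (ler_wpM2l _ h)); first by rewrite invr_ge0 ltW.
rewrite mulrCA; apply: ler_wpM2l => //.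
have -> : (Gamma al)^-1 * (Gamma al / Gamma (al + 1) * s `^ al) = s `^ al / Gamma (al + 1).
  by rewrite mulrA mulKf ?gt_eqF// mulrC.
have iG : 0 <= (Gamma (al + 1))^-1 by rewrite invr_ge0; apply/ltW/Gamma_gt0; rewrite addr_gt0.
apply: (ler_wpM2r iG).
by apply: (ge0_ler_powR (ltW al0)); rewrite ?nnegrE// ltW.
Qed.

Let rho0 : 0 < rho. Proof. by case/andP: rho01. Qed.
Let rho10 : 0 < 1 - rho. Proof. by rewrite subr_gt0; case/andP: rho01. Qed.
Let mg i : measurable_fun [set: R] (g i).
Proof. exact: continuous_measurable_fun. Qed.

Lemma measurable_mode i : measurable_fun [set: R] (mode i).
Proof.
have h := measurable_mode_sol rho01 (p i) (l0 i) (mg i) (gM i).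
exact: h.
Qed.

Lemma mode_bounded i : exists B, forall s, 0 <= s <= T -> `|mode i s| <= B.
Proof.
exists (`|p i| + M i * \int[mu]_(x in `[0, T]) kern (l i) x) => s sT.
apply: (le_trans (ler_normD _ _)); apply: lerD.
  by rewrite normrM; apply: ler_piMr => //; exact: ml1_norm.
have h := kconv_le_bound rho01 (mg i) (gM i) (l0 i) sT; exact: h.
Qed.

Lemma integrable_balance i s : s <= T ->
  mu.-integrable `[0, s] (EFin \o (fun r => g i r - l i * mode i r)).
Proof.
move=> sT; have cb : {within `[0, T], continuous (fun r => g i r - l i * mode i r)}.
  have /subspace_continuousP c := @mode_within_continuous i.
  apply/subspace_continuousP => t tT; apply: cvgB.
    by apply: cvg_within_filter; exact: (@cg i).
  exact: (cvgMl_tmp (a := l i) (c t tT)).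
apply: integrableS (continuous_compact_integrable (@segment_compact _ 0 T) cb) => //.
by apply: subset_itvl; rewrite bnd_simp.
Qed.

Lemma sum_mode_balance (r : seq I) (s : R) : 0 < s <= T ->
  [/\ measurable_fun [set: R] (fun r' => \sum_(i <- r) (mode i r' - p i)),
      (exists B, forall r', 0 <= r' <= s -> `|\sum_(i <- r) (mode i r' - p i)| <= B),
      mu.-integrable `[0, s] (EFin \o (fun r' => \sum_(i <- r) (g i r' - l i * mode i r')))
    & frac_integral (1 - rho) (fun r' => \sum_(i <- r) (mode i r' - p i)) s =
      \int[mu]_(r' in `[0, s]) \sum_(i <- r) (g i r' - l i * mode i r')].
Proof.
move=> /andP[s0 sT]; elim: r => [|i r [m1 [B HB] ii ih]].
  have E0 : (fun r' : R => \sum_(i <- [::]) (mode i r' - p i)) = cst 0.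
    by apply/funext => x; rewrite big_nil.
  have E1 : (fun r' : R => \sum_(i <- [::]) (g i r' - l i * mode i r')) = cst 0.
    by apply/funext => x; rewrite big_nil.
  rewrite E0 E1; split.
  - exact: measurable_cst.
  - by exists 0 => x _; rewrite big_nil normr0.
  - exact: integrable0.
  - rewrite frac_integralE Rintegral_cst// mul0r.
    have -> : (fun x => (s - x) `^ (1 - rho - 1) * cst 0 x) = cst (0 : R).
      by apply/funext => x; rewrite /= mulr0.
    by rewrite Rintegral_cst// mul0r mulr0.
have E0 : (fun r' : R => \sum_(i <- i :: r) (mode i r' - p i)) =
    fun r' => (mode i r' - p i) + \sum_(i <- r) (mode i r' - p i).
  by apply/funext => x; rewrite big_cons.
have E1 : (fun r' : R => \sum_(i <- i :: r) (g i r' - l i * mode i r')) =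
    fun r' => (g i r' - l i * mode i r') + \sum_(i <- r) (g i r' - l i * mode i r').
  by apply/funext => x; rewrite big_cons.
have m2 : measurable_fun [set: R] (fun r' => mode i r' - p i).
  by apply: measurable_funB; [exact: measurable_mode | exact: measurable_cst].
have [C HC] := mode_bounded i.
have HC' r' : 0 <= r' <= s -> `|mode i r' - p i| <= C + `|p i|.
  move=> /andP[r0 rs]; apply: (le_trans (ler_normB _ _)); rewrite lerD2r; apply: HC.
  by rewrite r0 (le_trans rs).
rewrite E0 E1; split.
- exact: measurable_funD.
- exists (C + `|p i| + B) => x xs; rewrite big_cons.
  by apply: (le_trans (ler_normD _ _)); apply: lerD; [exact: HC' | exact: HB].
- exact: (rintegrableD (measurable_itv _) (integrable_balance i sT) ii).
- rewrite (rRintegralD (measurable_itv _) (integrable_balance i sT) ii) -ih.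
  rewrite (frac_integralD rho10 s0 m2 m1 HC' HB); congr (_ + _).
  have h := mode_sol_balance rho01 (p i) (l0 i) (mg i) (gM i) s0; exact: h.
Qed.

Lemma measurable_msum_clamp : measurable_fun [set: R] (msum \o clamp T).
Proof.
apply: continuous_measurable_fun; apply: continuous_comp_clamp; first exact: ltW.
exact: msum_within_continuous.
Qed.

(** [I^(1-rho) (msum - msum 0)] is the limit, uniformly on [0, T], of its
    partial sums. *)
Lemma frac_msum_approx (d : R) : 0 < d -> exists F0 : {fset I}, forall F : {fset I},
  (F0 `<=` F)%fset -> forall s, 0 < s <= T ->
  `|frac_integral (1 - rho) (fun r => msum r - msum 0) s -
    \int[mu]_(r in `[0, s]) \sum_(i <- F) (g i r - l i * mode i r)| <= d.
Proof.
move=> d0; pose K := T `^ (1 - rho) / Gamma (1 - rho + 1).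
have K0 : 0 < K by rewrite divr_gt0 ?powR_gt0// Gamma_gt0// addr_gt0.
pose eta := d / (2 * K).
have eta0 : 0 < eta by rewrite divr_gt0// mulr_gt0.
have [F0 H] := small_tails_unif (fun _ _ => ltr01) mode_tails eta0.
exists F0 => F F0F s sT; have /andP[s0 sT1] := sT.
have {}H t := H F F0F t; have [m1 [B HB] _ <-] := sum_mode_balance F sT.
pose u r := msum (clamp T r) - msum 0.
have clE r : 0 <= r <= s -> clamp T r = r.
  by move=> /andP[r0 rs]; apply: clampE; rewrite r0 (le_trans rs).
have mu_ : measurable_fun [set: R] u.
  by apply: measurable_funB; [exact: measurable_msum_clamp | exact: measurable_cst].
have -> : frac_integral (1 - rho) (fun r => msum r - msum 0) s = frac_integral (1 - rho) u s.
  by apply: eq_frac_integral => r /clE cr; rewrite /u cr.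
have near2 r : 0 <= r <= s -> `|u r - \sum_(i <- F) (mode i r - p i)| <= 2 * eta.
  move=> rs; rewrite /u (clE r rs).
  have rT : D0 r by move: rs => /andP[r0 rs]; rewrite /= r0 (le_trans rs).
  have zT : D0 0 by rewrite /= lexx ltW.
  have h1 := H r rT; have h2 := H 0 zT; rewrite mulr1 in h1, h2.
  have e2 : \sum_(i <- F) mode i 0 = \sum_(i <- F) p i.
    by apply: eq_bigr => i _; exact: mode_sol0.
  rewrite big_split/= sumrN -e2; move: h1 h2; rewrite -/(msum r) -/(msum 0).
  move: (msum r) (msum 0) (\sum_(i <- F) _) (\sum_(i <- F) _) => a b c c'.
  by rewrite !ler_norml => /andP[? ?] /andP[? ?]; apply/andP; split; lra.
have [Bu HBu] : exists B, forall r, 0 <= r <= s -> `|u r| <= B.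
  exists (2 * eta + B) => r rs; have := near2 r rs; have := HB r rs.
  move: (u r) (\sum_(i <- F) _) => a b.
  by rewrite !ler_norml => /andP[? ?] /andP[? ?]; apply/andP; split; lra.
rewrite -(frac_integralB rho10 s0 mu_ m1 HBu HB).
have mB : measurable_fun [set: R] (fun r => u r - \sum_(i <- F) (mode i r - p i)).
  exact: measurable_funB.
apply: (le_trans (frac_integral_bound rho10 sT mB near2)).
rewrite -/K /eta le_eqVlt; apply/orP; left; apply/eqP.
by rewrite invfM; field; rewrite gt_eqF.
Qed.

Lemma integral_increment (k : R -> R) (a b c d : R) : 0 <= a <= b ->
  mu.-integrable `[0, b] (EFin \o k) -> (forall r, a < r <= b -> `|k r - c| <= d) ->
  `|\int[mu]_(r in `[0, b]) k r - \int[mu]_(r in `[0, a]) k r - (b - a) * c| <= (b - a) * d.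
Proof.
move=> /andP[a0 ab] ik kc.
have iab : mu.-integrable `]a, b] (EFin \o k).
  by apply: integrableS ik => //; apply: subset_itvr; rewrite bnd_simp.
have ic z : mu.-integrable `]a, b] (EFin \o cst z).
  apply/integrableP; split; first exact/measurable_EFinP/measurable_cst.
  under eq_integral do rewrite /=.
  by rewrite integral_cst//= lebesgue_measure_itv/= lte_fin; case: ifP => _;
    rewrite ?mule0// -EFinB -EFinM ltry.
have mab : fine (mu `]a, b]) = b - a.
  rewrite lebesgue_measure_itv/= lte_fin; case: ltP => // ba.
  have -> : a = b by apply/eqP; rewrite eq_le ab ba.
  by rewrite subrr.
have cE z : \int[mu]_(r in `]a, b]) cst z r = z * (b - a).
  by rewrite Rintegral_cst// mab.
rewrite (Rintegral_itvB ik) ?bnd_simp//.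
rewrite [(b - a) * c]mulrC -cE -(rRintegralB (measurable_itv _) iab (ic c)).
have ikc := rintegrableB (measurable_itv _) iab (ic c).
apply: (le_trans (norm_Rintegral_le (measurable_itv _) ikc)).
rewrite [leRHS]mulrC -cE; apply: le_Rintegral => //.
  exact: rintegrable_norm ikc.
Qed.

(** For a partial sum, the increment is the integral between [t] and [s] of a
    function close to [bsum t]; by [frac_msum_approx] the estimate holds in the
    limit. *)
Lemma msum_increment (t eps : R) : 0 < t <= T -> 0 < eps ->
  let J := frac_integral (1 - rho) (fun r => msum r - msum 0) in
  exists2 d, 0 < d & forall s, 0 <= s <= T -> `|t - s| < d ->
    `|J s - J t - (s - t) * bsum t| <= `|s - t| * eps.
Proof.
move=> tT eps0 J; have /andP[t0 tT1] := tT.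
have eps2 : 0 < eps / 2 by rewrite divr_gt0.
have := bsum_cvg tT; move=> /cvgrPdist_le /(_ _ eps2).
rewrite /within/= => /nbhs_ballP[d0 /= d00 Hd].
have t2 : 0 < t / 2 by rewrite divr_gt0.
pose d := Num.min d0 (t / 2).
(* the bound d <= t / 2 keeps the weight bounded *)
have dd0 : d <= d0 by rewrite ge_min lexx.
have dt : d <= t / 2 by rewrite ge_min lexx orbT.
exists d; first by rewrite lt_min d00.
move=> s sT st; have /andP[s0' sT1] := sT.
have pos r : `|t - r| < d -> t / 2 < r.
  by move=> /lt_le_trans => /(_ _ dt); rewrite ltr_norml => /andP[_ ?]; lra.
have s0 : 0 < s by apply: lt_trans (pos _ st).
pose K := 1 + (t / 2) `^ (- rho).
have K0 : 0 < K by apply: ltr_pwDl => //; exact: powR_ge0.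
have w0 (r : R) : D1 r -> 0 < 1 + r `^ (- rho).
  by move=> _; apply: ltr_pwDl => //; exact: powR_ge0.
have [F0 HF0] := small_tails_unif w0 weighted_balance_tails (divr_gt0 eps2 K0).
have close F r : (F0 `<=` F)%fset -> 0 < r <= T -> `|t - r| < d ->
    `|\sum_(i <- F) (g i r - l i * mode i r) - bsum t| <= eps.
  move=> F0F rT rd; have := HF0 F F0F r rT; rewrite -/(bsum r).
  have : `|bsum t - bsum r| <= eps / 2.
    by apply: Hd; [exact: lt_le_trans dd0 | move: rT; rewrite /= in_itv/= => /andP[/ltW -> ->]].
  have : eps / 2 / K * (1 + r `^ (- rho)) <= eps / 2.
    rewrite mulrAC ler_pdivrMr//; apply: ler_wpM2l; first exact: ltW.
    rewrite lerD2l; apply: le_powR_neg => //; first by rewrite oppr_le0 ltW.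
    by apply/ltW; exact: pos.
  move: (_ * (1 + _)) (bsum r) (bsum t) (\sum_(i <- F) _) => q x y z q1 + h.
  move: (le_trans h q1).
  by rewrite !ler_norml => /andP[? ?] /andP[? ?]; apply/andP; split; lra.
apply/ler_addgt0Pl => e2 e20.
have e4 : 0 < e2 / 2 by rewrite divr_gt0.
have [F1 HF1] := frac_msum_approx e4.
pose F := (F0 `|` F1)%fset.
have Js := HF1 F (fsubsetUr _ _) s; have Jt := HF1 F (fsubsetUr _ _) t tT.
have {}Js : `|J s - \int[mu]_(r in `[0, s]) \sum_(i <- F) (g i r - l i * mode i r)| <= e2 / 2.
  by apply: Js; rewrite s0.
have {}close r := close F r (fsubsetUl _ _).
have iF x : 0 < x <= T ->
    mu.-integrable `[0, x] (EFin \o (fun r => \sum_(i <- F) (g i r - l i * mode i r))).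
  by move=> xT; have [] := sum_mode_balance F xT.
have inc : `|\int[mu]_(r in `[0, s]) \sum_(i <- F) (g i r - l i * mode i r) -
    \int[mu]_(r in `[0, t]) \sum_(i <- F) (g i r - l i * mode i r) - (s - t) * bsum t| <=
    `|s - t| * eps.
  have [ts|ts] := leP t s.
    rewrite (ger0_norm (_ : 0 <= s - t)) ?subr_ge0//; apply: integral_increment.
    - by rewrite (ltW t0).
    - by apply: iF; rewrite s0.
    - move=> r /andP[tr rs]; apply: close; first by rewrite (lt_trans t0 tr) (le_trans rs).
      have n1 : `|t - r| = r - t by rewrite distrC ger0_norm// subr_ge0 ltW.
      have n2 : `|t - s| = s - t by rewrite distrC ger0_norm// subr_ge0.
      by rewrite n1; apply: le_lt_trans (_ : s - t < d); [rewrite lerD2r | rewrite -n2].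
  have st0 : 0 <= t - s by rewrite subr_ge0 ltW.
  have sw (x y z : R) : `|x - y - (s - t) * z| = `|y - x - (t - s) * z|.
    by rewrite -normrN; congr `|_|; ring.
  rewrite (distrC s) (ger0_norm st0) sw.
  apply: integral_increment.
  - by rewrite s0' ltW.
  - exact: iF.
  - move=> r /andP[sr rt]; apply: close; first by rewrite (lt_trans s0 sr) (le_trans rt).
    have n1 : `|t - r| = t - r by rewrite ger0_norm// subr_ge0.
    have n2 : `|t - s| = t - s by rewrite ger0_norm.
    rewrite n1; apply: le_lt_trans (_ : t - s < d); last by rewrite -n2.
    by rewrite lerD2l lerN2 ltW.
move: Js Jt inc; rewrite -/(J t).
move: (J s) (J t) (\int[mu]_(r in _) _) (\int[mu]_(r in _) _) => a b a' b'.
move: (_ * bsum t) (_ * eps) => c q; rewrite !ler_norml.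
by move=> /andP[? ?] /andP[? ?] /andP[? ?]; apply/andP; split; lra.
Qed.

Lemma caputo_msum t : 0 < t <= T ->
  caputo_quotient rho msum t @ within `[0, T] (t^') --> bsum t.
Proof.
move=> tT; apply/cvgrPdist_le => eps eps0.
have [d d0 Hd] := msum_increment tT eps0.
have nn : \forall s \near t^', s != t by exact: nbhs_dnbhs_neq.
have nb : \forall s \near t^', `|t - s| < d.
  have : \forall s \near nbhs t, `|t - s| < d by apply/nbhs_ballP; exists d.
  by apply: filterS => s h _.
near=> s.
have sT : 0 <= s <= T.
  by have : `[0, T]%classic s by [near: s; exact: withinT]; rewrite /= in_itv.
have st : s != t by near: s; apply: filterS nn => s h _.
have sd : `|t - s| < d by near: s; apply: filterS nb => s h _.
have st0 : 0 < `|s - t| by rewrite normr_gt0 subr_eq0.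
have := Hd s sT sd; rewrite /caputo_quotient.
move: (frac_integral _ _ s) (frac_integral _ _ t) => a b h.
have nz : s - t != 0 by rewrite subr_eq0.
have sw : (s - t) * (bsum t - (a - b) / (s - t)) = - (a - b - (s - t) * bsum t).
  by field.
by rewrite -(ler_pM2l st0) -normrM sw normrN.
Unshelve. all: by end_near. Qed.

End Modes.

(** * Real solutions as sums of waves *)

Section JointLimits.
Context {R : realType} {N : nat}.
Implicit Types (n : 'rV[int]_N) (x : 'rV[R]_N).

Lemma within_sub (X : Type) (F : set_system X) (FF : Filter F) (A B : set X) : A `<=` B ->
  within A F `=>` within B F.
Proof. by move=> AB P; rewrite /within/=; apply: filterS => x h /AB. Qed.

Lemma cvg_snd_within (I : set R) x (t : R) :
  p.2 @[p --> within ([set: 'rV[R]_N] `*` I) (nbhs (x, t))] --> within I (nbhs t).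
Proof.
move=> P wP.
have c2 : (fun p : 'rV[R]_N * R => p.2) @ nbhs (x, t) --> t by exact: cvg_snd.
have := c2 _ wP; rewrite /within /= !near_simpl.
by apply: filterS => -[y s] /= h [_ /h].
Qed.

Lemma cvg_fst_within (I : set R) x (t : R) :
  p.1 @[p --> within ([set: 'rV[R]_N] `*` I) (nbhs (x, t))] --> x.
Proof. by apply: cvg_within_filter; exact: cvg_fst. Qed.

Lemma wave_tails (X : Type) (D : set X) (w : X -> R) (a b : 'rV[int]_N -> X -> R) :
  small_tails D w a -> small_tails D w b ->
  small_tails ([set: 'rV[R]_N] `*` D) (fun p => w p.2)
    (fun n p => wave (a ^~ p.2) (b ^~ p.2) n p.1).
Proof.
move=> ta tb.
have ta' : small_tails D w (fun n s => `|a n s| ).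
  by apply: (small_tails_le ltr01 _ ta) => n s _; rewrite normr_id mul1r.
have tb' : small_tails D w (fun n s => `|b n s| ).
  by apply: (small_tails_le ltr01 _ tb) => n s _; rewrite normr_id mul1r.
move=> e e0; have [F0 H] := small_tailsD tb' ta' e0; exists F0 => F dF [x s] [_ Ds] /=.
apply: le_trans (H F dF s Ds); apply: ler_sum => n _.
rewrite [leRHS]ger0_norm; first exact: wave_norm.
by rewrite addr_ge0.
Qed.

Lemma wave_sum_joint_cvg (I : set R) (w : R -> R) (K : R) (a b : 'rV[int]_N -> R -> R) x t :
  (forall s, I s -> 0 < w s) -> small_tails I w a -> small_tails I w b -> I t -> w t <= K ->
  (\forall s \near within I (nbhs t), w s <= K) ->
  (forall n, a n s @[s --> within I (nbhs t)] --> a n t) ->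
  (forall n, b n s @[s --> within I (nbhs t)] --> b n t) ->
  wave_sum (a ^~ p.2) (b ^~ p.2) p.1
    @[p --> within ([set: 'rV[R]_N] `*` I) (nbhs (x, t))] -->
  wave_sum (a ^~ t) (b ^~ t) x.
Proof.
move=> w0 ta tb It wt wK ca cb.
have T2 := @cvg_snd_within I x t; have T1 := @cvg_fst_within I x t.
have FF : Filter (within ([set: 'rV[R]_N] `*` I) (nbhs (x, t))) by exact: within_filter.
apply: (rsum_cvg FF (D := [set: 'rV[R]_N] `*` I) (w := fun p => w p.2) (K := K)
  (c := fun n p => wave (a ^~ p.2) (b ^~ p.2) n p.1) (x0 := (x, t))) => //.
- by move=> [y s] [_ /= /w0].
- exact: wave_tails.
- near=> p.
  have p1 : ([set: 'rV[R]_N] `*` I) p by near: p; exact: withinT.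
  split=> //; near: p; exact: (T2 _ wK).
- move=> n; rewrite /wave /=.
  have cc := cvg_comp _ _ T1 (@continuous_cos_dotn0 R N n x).
  have cs := cvg_comp _ _ T1 (@continuous_sin_dotn R N n x).
  have c1 := cvg_comp _ _ T2 (ca n).
  have c2 := cvg_comp _ _ T2 (cb n).
  exact: cvgB (cvgM c1 cc) (cvgM c2 cs).
Unshelve. all: by end_near. Qed.

End JointLimits.

Section WaveSolution.
Context {R : realType} {N : nat}.
Local Notation mu := (@lebesgue_measure R).
Variables (rho T e : R).
Hypotheses (rho01 : 0 < rho < 1) (T0 : 0 < T) (e01 : 0 < e <= 1).
Variables (p1 p2 : 'rV[int]_N -> R) (g1 g2 : 'rV[int]_N -> R -> R) (M1 M2 : 'rV[int]_N -> R).
Hypotheses (cg1 : forall n, continuous (g1 n)) (cg2 : forall n, continuous (g2 n)).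
Hypotheses (gM1 : forall n s, `|g1 n s| <= M1 n) (gM2 : forall n s, `|g2 n s| <= M2 n).
Hypothesis tp1 : small_tails [set: R] (fun=> 1) (fun n _ => p1 n).
Hypothesis tp2 : small_tails [set: R] (fun=> 1) (fun n _ => p2 n).
Hypothesis tg1 : small_tails [set: R] (fun=> 1) (fun n s => (1 + sqnorm n) `^ e * g1 n s).
Hypothesis tg2 : small_tails [set: R] (fun=> 1) (fun n s => (1 + sqnorm n) `^ e * g2 n s).

Local Opaque mittag_leffler Gamma powR integral Rintegral ml_kernel rl_kernel frac_integral.

Let l (n : 'rV[int]_N) : R := sqnorm n.
Let l0 n : 0 <= l n. Proof. exact: sqnorm_ge0. Qed.
Let rho0 : 0 < rho. Proof. by case/andP: rho01. Qed.
Let A1 := mode rho l p1 g1.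
Let A2 := mode rho l p2 g2.
Let b1 n t := g1 n t - l n * A1 n t.
Let b2 n t := g2 n t - l n * A2 n t.
Local Notation D0 := [set t : R | 0 <= t <= T].
Local Notation D1 := [set t : R | 0 < t <= T].

(** [wsol] is the sum of the waves whose amplitudes are modes; [wcap] and [wlap]
    are its images under D^rho and A taken term by term. *)
Definition wsol (x : 'rV[R]_N) (t : R) : R := wave_sum (A1 ^~ t) (A2 ^~ t) x.
Definition wcap (x : 'rV[R]_N) (t : R) : R := wave_sum (b1 ^~ t) (b2 ^~ t) x.
Definition wlap (x : 'rV[R]_N) (t : R) : R :=
  wave_sum (fun n => l n * A1 n t) (fun n => l n * A2 n t) x.

Let q (x : 'rV[R]_N) n := wave p1 p2 n x.
Let h (x : 'rV[R]_N) n s := wave (g1 ^~ s) (g2 ^~ s) n x.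

Let mg1 n : measurable_fun [set: R] (g1 n). Proof. exact: continuous_measurable_fun. Qed.
Let mg2 n : measurable_fun [set: R] (g2 n). Proof. exact: continuous_measurable_fun. Qed.

(** A mode depends linearly on its data, so at a fixed point the wave is itself a
    mode. *)
Lemma wave_mode x n t : wave (A1 ^~ t) (A2 ^~ t) n x = mode rho l (q x) (h x) n t.
Proof.
have k1 := kconv_integrable rho01 (mg1 n) (gM1 n) t (l0 n).
have k2 := kconv_integrable rho01 (mg2 n) (gM2 n) t (l0 n).
have kE : kconv rho (l n) (h x n) t = cos (dotn n x) * kconv rho (l n) (g1 n) t -
   sin (dotn n x) * kconv rho (l n) (g2 n) t.
  rewrite !kconvE -(rRintegralZ (measurable_itv _) _ k1) -(rRintegralZ (measurable_itv _) _ k2).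
  rewrite -(rRintegralB (measurable_itv _) (rintegrableZ (measurable_itv _) _ k1)
    (rintegrableZ (measurable_itv _) _ k2)).
  apply: eq_Rintegral => s _; rewrite /h /wave.
  by move: (g1 _ _) (g2 _ _) (ml_kernel _ _ _ _) (cos _) (sin _) => *; ring.
rewrite /wave /A1 /A2 /mode /mode_sol kE /q /wave.
by move: (mittag_leffler _ _ _) (kconv _ _ _ _) (kconv _ _ _ _) (cos _) (sin _) => *; ring.
Qed.

Let ch x n : continuous (h x n).
Proof.
move=> s; apply: cvgB; apply: cvgMr_tmp; [exact: (@cg1 n) | exact: (@cg2 n)].
Qed.

Let hM x n s : `|h x n s| <= M1 n + M2 n.
Proof. by apply: (le_trans (wave_norm _ _ _ _)); apply: lerD. Qed.

Let tq x : small_tails [set: R] (fun=> 1) (fun n _ => q x n).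
Proof.
move=> d d0; have [F0 H] := wave_tails tp1 tp2 d0.
by exists F0 => F dF s _; exact: (H F dF (x, s)).
Qed.

Let th x : small_tails [set: R] (fun=> 1) (fun n s => (1 + l n) `^ e * h x n s).
Proof.
move=> d d0; have [F0 H] := wave_tails tg1 tg2 d0.
exists F0 => F dF s _; apply: le_trans (H F dF (x, s) _); last by [].
apply: ler_sum => n _; rewrite /h /wave /= le_eqVlt; apply/orP; left; apply/eqP.
by congr `|_|; ring.
Qed.

Lemma wsol_msum x : wsol x = msum rho l (q x) (h x).
Proof.
apply/funext => t; rewrite /wsol /wave_sum /msum; congr rsum.
by apply/funext => n; exact: wave_mode.
Qed.

Lemma wcap_bsum x : wcap x = bsum rho l (q x) (h x).
Proof.
apply/funext => t; rewrite /wcap /wave_sum /bsum; congr rsum.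
apply/funext => n; rewrite -wave_mode /h /b1 /b2 /wave.
by move: (A1 n t) (A2 n t) (g1 n t) (g2 n t) (cos _) (sin _) => *; ring.
Qed.

Lemma wsol_caputo x t : 0 < t <= T ->
  caputo_quotient rho (wsol x) t @ within `[0, T] (t^') --> wcap x t.
Proof.
move=> tT; rewrite wsol_msum wcap_bsum.
exact: (caputo_msum rho01 T0 e01 l0 (@ch x) (hM x) (tq x) (th x) tT).
Qed.

(** A single mode is the solution for data supported at one frequency. *)
Lemma wave_caputo n x t : 0 < t <= T ->
  caputo_quotient rho (fun s => wave (A1 ^~ s) (A2 ^~ s) n x) t @ within `[0, T] (t^') -->
  wave (b1 ^~ t) (b2 ^~ t) n x.
Proof.
move=> tT.
have st1 (X : Type) (D : set X) (c : unit -> X -> R) : small_tails D (fun=> 1) c.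
  move=> d d0; exists [fset tt]%fset => F; rewrite fdisjoint1X => dF y Dy.
  rewrite big_seq big1 ?mulr1 ?(ltW d0)// => -[] uF.
  by rewrite uF in dF.
have single (c : unit -> R) : rsum c = c tt.
  by apply/has_rsum_rsum/has_rsum_single => -[].
have := @caputo_msum R unit rho T e rho01 T0 e01 (fun=> l n) (fun=> q x n) (fun=> h x n)
  (fun=> M1 n + M2 n) (fun=> l0 n) (fun=> @ch x n) (fun=> hM x n) (st1 _ _ _) (st1 _ _ _) t tT.
have E s : msum rho (fun _ : unit => l n) (fun=> q x n) (fun=> h x n) s =
    wave (A1 ^~ s) (A2 ^~ s) n x.
  by rewrite /msum single wave_mode.
rewrite (funext E) /bsum single.
have -> : h x n t - l n * mode rho (fun=> l n) (fun=> q x n) (fun=> h x n) tt t =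
    wave (b1 ^~ t) (b2 ^~ t) n x; last by [].
have -> : mode rho (fun=> l n) (fun=> q x n) (fun=> h x n) tt t =
    wave (A1 ^~ t) (A2 ^~ t) n x by rewrite wave_mode.
rewrite /h /b1 /b2 /wave.
by move: (A1 n t) (A2 n t) (g1 n t) (g2 n t) (cos _) (sin _) => *; ring.
Qed.

Let mt1 : small_tails D0 (fun=> 1) A1.
Proof. exact: (mode_tails T rho01 e01 l0 cg1 gM1 tp1 tg1). Qed.
Let lt1 : small_tails D1 (fun t => 1 + t `^ (- rho)) (fun n t => l n * A1 n t).
Proof. exact: (lmode_tails rho01 T0 e01 l0 cg1 gM1 tp1 tg1). Qed.
Let bt1 : small_tails D1 (fun t => 1 + t `^ (- rho)) b1.
Proof. exact: (weighted_balance_tails rho01 T0 e01 l0 cg1 gM1 tp1 tg1). Qed.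
Let mc1 n : {within `[0, T], continuous (A1 n)}.
Proof. exact: (@mode_within_continuous _ _ _ _ rho01 _ p1 _ _ l0 cg1 gM1 n). Qed.

Let mt2 : small_tails D0 (fun=> 1) A2.
Proof. exact: (mode_tails T rho01 e01 l0 cg2 gM2 tp2 tg2). Qed.
Let lt2 : small_tails D1 (fun t => 1 + t `^ (- rho)) (fun n t => l n * A2 n t).
Proof. exact: (lmode_tails rho01 T0 e01 l0 cg2 gM2 tp2 tg2). Qed.
Let bt2 : small_tails D1 (fun t => 1 + t `^ (- rho)) b2.
Proof. exact: (weighted_balance_tails rho01 T0 e01 l0 cg2 gM2 tp2 tg2). Qed.
Let mc2 n : {within `[0, T], continuous (A2 n)}.
Proof. exact: (@mode_within_continuous _ _ _ _ rho01 _ p2 _ _ l0 cg2 gM2 n). Qed.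

Let D0E : `[0, T]%classic = D0.
Proof. by apply/seteqP; split => s; rewrite /= in_itv. Qed.

Let D1E : `]0, T]%classic = D1.
Proof. by apply/seteqP; split => s; rewrite /= in_itv. Qed.

Let D10 : (`]0, T]%classic : set R) `<=` `[0, T]%classic.
Proof. by move=> s; rewrite /= !in_itv/= => /andP[/ltW -> ->]. Qed.

Lemma wsol_joint_cvg x t : 0 <= t <= T ->
  wsol p.1 p.2 @[p --> within ([set: 'rV[R]_N] `*` `[0, T]) (nbhs (x, t))] --> wsol x t.
Proof.
move=> tT; have tT' : `[0, T]%classic t by rewrite D0E.
apply: (wave_sum_joint_cvg (w := fun=> 1) (K := 1) (a := A1) (b := A2)) => //.
- by near=> s.
- by move=> n; have /subspace_continuousP := @mc1 n; exact.
- by move=> n; have /subspace_continuousP := @mc2 n; exact.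
Unshelve. all: by end_near. Qed.

Let weight_near (t : R) : 0 < t -> \forall s \near within (`]0, T]%classic : set R) (nbhs t),
  1 + (s : R) `^ (- rho) <= 1 + (t / 2) `^ (- rho).
Proof.
move=> t0; near=> s; rewrite lerD2l; apply: le_powR_neg.
- by rewrite oppr_le0 ltW.
- by rewrite divr_gt0.
- by apply/ltW; near: s; apply: cvg_within; apply: lt_nbhsr; lra.
Unshelve. all: by end_near. Qed.

Let weight_at t : 0 < t -> 1 + t `^ (- rho) <= 1 + (t / 2) `^ (- rho).
Proof.
move=> t0; rewrite lerD2l; apply: le_powR_neg; [by rewrite oppr_le0 ltW| |lra].
by rewrite divr_gt0.
Qed.

Let weight_gt0 s : D1 s -> 0 < 1 + s `^ (- rho).
Proof. by move=> _; apply: ltr_pwDl => //; exact: powR_ge0. Qed.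

Let mode_cvg1 n t : 0 < t <= T -> A1 n s @[s --> within `]0, T] (nbhs t)] --> A1 n t.
Proof.
move=> tT; have tT' : `[0, T]%classic t by apply: D10; rewrite D1E.
have /subspace_continuousP /(_ t tT') c := @mc1 n.
by move=> P /c; apply: within_sub.
Qed.

Let mode_cvg2 n t : 0 < t <= T -> A2 n s @[s --> within `]0, T] (nbhs t)] --> A2 n t.
Proof.
move=> tT; have tT' : `[0, T]%classic t by apply: D10; rewrite D1E.
have /subspace_continuousP /(_ t tT') c := @mc2 n.
by move=> P /c; apply: within_sub.
Qed.

Lemma wcap_joint_cvg x t : 0 < t <= T ->
  wcap p.1 p.2 @[p --> within ([set: 'rV[R]_N] `*` `]0, T]) (nbhs (x, t))] --> wcap x t.
Proof.
move=> tT; have /andP[t0 _] := tT.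
apply: (wave_sum_joint_cvg (w := fun s => 1 + s `^ (- rho)) (K := 1 + (t / 2) `^ (- rho))
  (a := b1) (b := b2)).
- by rewrite D1E; exact: weight_gt0.
- by rewrite D1E; exact: bt1.
- by rewrite D1E; exact: bt2.
- by rewrite D1E.
- exact: weight_at.
- exact: weight_near.
- move=> n; apply: cvgB; first by apply: cvg_within_filter; exact: (@cg1 n).
  apply: cvgMl_tmp; exact: mode_cvg1.
- move=> n; apply: cvgB; first by apply: cvg_within_filter; exact: (@cg2 n).
  apply: cvgMl_tmp; exact: mode_cvg2.
Qed.

Lemma wlap_joint_cvg x t : 0 < t <= T ->
  wlap p.1 p.2 @[p --> within ([set: 'rV[R]_N] `*` `]0, T]) (nbhs (x, t))] --> wlap x t.
Proof.
move=> tT; have /andP[t0 _] := tT.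
apply: (wave_sum_joint_cvg (w := fun s => 1 + s `^ (- rho)) (K := 1 + (t / 2) `^ (- rho))
  (a := fun n s => l n * A1 n s) (b := fun n s => l n * A2 n s)).
- by rewrite D1E; exact: weight_gt0.
- by rewrite D1E; exact: lt1.
- by rewrite D1E; exact: lt2.
- by rewrite D1E.
- exact: weight_at.
- exact: weight_near.
- by move=> n; apply: cvgMl_tmp; exact: mode_cvg1.
- by move=> n; apply: cvgMl_tmp; exact: mode_cvg2.
Qed.

Lemma wsol_summable t : 0 < t <= T -> exists S, forall F : {fset 'rV[int]_N},
  \sum_(n <- F) (1 + sqnorm n) * (`|A1 n t| + `|A2 n t|) <= S.
Proof.
move=> tT; have /andP[t0 tT1] := tT.
have tT0 : D0 t by rewrite /= ltW.
have [S1 H1] := small_tails_bounded mt1 tT0; have [S2 H2] := small_tails_bounded mt2 tT0.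
have [S3 H3] := small_tails_bounded lt1 (tT : D1 t).
have [S4 H4] := small_tails_bounded lt2 (tT : D1 t).
exists (S1 + S2 + (S3 + S4)) => F.
apply: le_trans (lerD (lerD (H1 F) (H2 F)) (lerD (H3 F) (H4 F))).
rewrite -!big_split/=; apply: ler_sum => n _.
rewrite !normrM (ger0_norm (l0 n)) le_eqVlt; apply/orP; left; apply/eqP.
by rewrite /l; ring.
Qed.

Lemma wsol_C2 t : 0 < t <= T -> is_C2 (wsol ^~ t).
Proof. by move=> /wsol_summable[S HS]; exact: wave_sum_C2 HS. Qed.

Lemma wsol_laplacian x t : 0 < t <= T -> laplacian (wsol ^~ t) x = - wlap x t.
Proof. by move=> /wsol_summable[S HS]; exact: laplacian_wave_sum HS x. Qed.

Let single1 n t : wave (A1 ^~ t) (A2 ^~ t) n =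
  wave_sum (fun m => (m == n)%:R * A1 m t) (fun m => (m == n)%:R * A2 m t).
Proof. by apply/funext => x; rewrite wave_sum_single. Qed.

Lemma wave_C2 n t : is_C2 (wave (A1 ^~ t) (A2 ^~ t) n).
Proof. by rewrite single1; exact: wave_sum_C2 (single_summable (A1 ^~ t) (A2 ^~ t) n). Qed.

Lemma wave_laplacian n x t : laplacian (wave (A1 ^~ t) (A2 ^~ t) n) x =
  - wave (fun m => l m * A1 m t) (fun m => l m * A2 m t) n x.
Proof.
rewrite single1 (laplacian_wave_sum (single_summable (A1 ^~ t) (A2 ^~ t) n)).
rewrite -wave_sum_single; congr (- wave_sum _ _ x); apply/funext => m; exact: mulrCA.
Qed.

Lemma wsol_equation x t : 0 < t <= T ->
  wcap x t + wlap x t = wave_sum (g1 ^~ t) (g2 ^~ t) x.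
Proof.
move=> tT.
have Dx : ([set: 'rV[R]_N] `*` D1) (x, t) by [].
have h1 := small_tails_rsum (wave_tails bt1 bt2) Dx.
have h2 := small_tails_rsum (wave_tails lt1 lt2) Dx.
apply/esym/has_rsum_rsum; have := has_rsumD h1 h2; congr has_rsum.
apply/funext => n; rewrite /wave /b1 /b2 /=.
by move: (A1 n t) (A2 n t) (cos _) (sin _) => *; ring.
Qed.

Lemma wsol_init x : wsol x 0 = wave_sum p1 p2 x.
Proof.
rewrite /wsol /wave_sum; congr rsum; apply/funext => n.
by rewrite /wave /A1 /A2 /mode !mode_sol0.
Qed.

Lemma wsol_term_tails :
  small_tails ([set: 'rV[R]_N] `*` D0) (fun=> 1) (fun n p => wave (A1 ^~ p.2) (A2 ^~ p.2) n p.1).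
Proof. exact: wave_tails mt1 mt2. Qed.

Lemma wcap_term_tails : small_tails ([set: 'rV[R]_N] `*` D1) (fun p => 1 + p.2 `^ (- rho))
  (fun n p => wave (b1 ^~ p.2) (b2 ^~ p.2) n p.1).
Proof. exact: wave_tails bt1 bt2. Qed.

Lemma wlap_term_tails : small_tails ([set: 'rV[R]_N] `*` D1) (fun p => 1 + p.2 `^ (- rho))
  (fun n p => wave (fun n => l n * A1 n p.2) (fun n => l n * A2 n p.2) n p.1).
Proof. exact: wave_tails lt1 lt2. Qed.

End WaveSolution.

(** * From real to complex-valued functions *)

Section ComplexConversions.
Context {R : realType}.
Local Open Scope complex_scope.

(** This makes the limit that defines the Caputo derivative unique; at t = T it
    is a limit from the left. *)
Lemma within_punctured_proper (T t : R) : 0 < t <= T ->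
  ProperFilter (within `[0, T] (t^')).
Proof.
move=> /andP[t0 tT]; apply: Build_ProperFilter_ex.
move=> P; rewrite /within /= => /nbhs_ballP[d /= d0 Hd].
pose r := Num.min d t / 2.
have m0 : 0 < Num.min d t by rewrite lt_min d0.
have r0 : 0 < r by rewrite divr_gt0.
have rd : r < d by rewrite ltr_pdivrMr//; have : Num.min d t <= d by [rewrite ge_min lexx]; lra.
have rt : r < t by rewrite ltr_pdivrMr//; have : Num.min d t <= t by [rewrite ge_min lexx orbT]; lra.
exists (t - r); apply: Hd.
- by rewrite /ball /= opprB addrC subrK gtr0_norm.
- by rewrite -subr_eq0 addrAC subrr add0r oppr_eq0 gt_eqF.
- by rewrite in_itv/=; apply/andP; split; lra.
Qed.

Lemma caputo_quotient_eq (rho T t s : R) (h k : R -> R) : 0 <= t <= T -> 0 <= s <= T ->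
  (forall r, 0 <= r <= T -> h r = k r) ->
  caputo_quotient rho h t s = caputo_quotient rho k t s.
Proof.
move=> /andP[t0 tT] /andP[s0 sT] hk; rewrite /caputo_quotient.
have E x : 0 <= x <= T -> frac_integral (1 - rho) (fun r => h r - h 0) x =
    frac_integral (1 - rho) (fun r => k r - k 0) x.
  move=> /andP[x0 xT]; apply: eq_frac_integral => r /andP[r0 rx].
  by rewrite !hk ?lexx ?r0 ?(le_trans rx)//; exact: le_trans x0 xT.
by rewrite !E ?t0 ?s0.
Qed.

Lemma caputo_value (rho T t : R) (h : R -> R[i]) (hR hI : R -> R) (a b : R) : 0 < t <= T ->
  (forall s, 0 <= s <= T -> complex.Re (h s) = hR s) ->
  (forall s, 0 <= s <= T -> complex.Im (h s) = hI s) ->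
  caputo_quotient rho hR t @ within `[0, T] (t^') --> a ->
  caputo_quotient rho hI t @ within `[0, T] (t^') --> b ->
  caputo_derivable rho T h t /\ caputo rho T h t = a +i* b.
Proof.
move=> tT eR eI cR cI; have PF := within_punctured_proper tT.
have tT0 : 0 <= t <= T by case/andP: tT => /ltW ->.
have tr (u k : R -> R) (c : R) : (forall s, 0 <= s <= T -> u s = k s) ->
    caputo_quotient rho k t @ within `[0, T] (t^') --> c ->
    caputo_quotient rho u t @ within `[0, T] (t^') --> c.
  move=> uk ck; apply: cvg_trans ck; apply: near_eq_cvg; near=> s.
  apply/esym; apply: (caputo_quotient_eq rho tT0) => //.
  by have : `[0, T]%classic s by [near: s; exact: withinT]; rewrite /= in_itv.
have {}cR := tr (fun s => complex.Re (h s)) hR a eR cR.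
have {}cI := tr (fun s => complex.Im (h s)) hI b eI cI.
split; first by split; apply/cvg_ex; [exists a | exists b].
by rewrite /caputo /caputo_real (cvg_lim (@Rhausdorff R) cR) (cvg_lim (@Rhausdorff R) cI).
Unshelve. all: by end_near. Qed.

Lemma Re_sum (J : Type) (r : seq J) (c : J -> R[i]) :
  complex.Re (\sum_(i <- r) c i) = \sum_(i <- r) complex.Re (c i).
Proof. by elim: r => [|i r ih]; rewrite ?big_nil// !big_cons raddfD/= ih. Qed.

Lemma Im_sum (J : Type) (r : seq J) (c : J -> R[i]) :
  complex.Im (\sum_(i <- r) c i) = \sum_(i <- r) complex.Im (c i).
Proof. by elim: r => [|i r ih]; rewrite ?big_nil// !big_cons raddfD/= ih. Qed.

Lemma complex_cvg_abs_unif (J : choiceType) (X : Type) (c : J -> X -> R[i]) (S : X -> R[i]) :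
  small_tails [set: X] (fun=> 1) (fun i x => complex.Re (c i x)) ->
  small_tails [set: X] (fun=> 1) (fun i x => complex.Im (c i x)) ->
  (forall x, complex.Re (S x) = rsum (fun i => complex.Re (c i x))) ->
  (forall x, complex.Im (S x) = rsum (fun i => complex.Im (c i x))) ->
  cvg_abs_unif_to c S.
Proof.
move=> tR tI eR eI; split=> [x|e e0].
  have [B1 H1] := small_tails_bounded tR (I : [set: X] x).
  have [B2 H2] := small_tails_bounded tI (I : [set: X] x).
  apply: (le_lt_trans (esum_le_fset_sum (B := B1 + B2) _ _)) => [i|F|]; last exact: ltry.
    by case: (c i x) => a b /=; exact: sqrtr_ge0.
  apply: le_trans (lerD (H1 F) (H2 F)); rewrite -big_split/=; apply: ler_sum => i _.
  exact: normc_le.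
have e3 : 0 < e / 3 by rewrite divr_gt0.
have [F1 H1] := small_tails_unif (fun _ _ => ltr01) tR e3.
have [F2 H2] := small_tails_unif (fun _ _ => ltr01) tI e3.
exists (F1 `|` F2)%fset => F; rewrite fsubUset => /andP[s1 s2] x.
apply: (le_lt_trans (normc_le _)).
have h1 := H1 F s1 x Logic.I; have h2 := H2 F s2 x Logic.I.
rewrite !raddfB/= Re_sum Im_sum eR eI.
by apply: le_lt_trans (lerD h1 h2) _; lra.
Qed.

Lemma cvg_abs_unif_has_sum (J : choiceType) (X : Type) (c : J -> X -> R[i]) (S : X -> R[i]) x :
  cvg_abs_unif_to c S -> has_sum (c ^~ x) (S x).
Proof. by move=> [_ h] e /h[F0 H]; exists F0 => F /H. Qed.

End ComplexConversions.

Section FourierData.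
Context {R : realType} {N : nat}.
Local Notation TI := (@torus_integral R N).
Local Open Scope complex_scope.
Implicit Types (n : 'rV[int]_N) (x : 'rV[R]_N).

Lemma joint_comp (G : 'rV[R]_N * R -> R) (I : set R) x (t : R) (Y : Type)
    (Fi : set_system Y) (FF : Filter Fi) (qx : Y -> 'rV[R]_N) (qt : Y -> R) :
  {within [set: 'rV[R]_N] `*` I, continuous G} -> I t ->
  qx y @[y --> Fi] --> x -> qt y @[y --> Fi] --> t -> (\forall y \near Fi, I (qt y)) ->
  G (qx y, qt y) @[y --> Fi] --> G (x, t).
Proof.
move=> /subspace_continuousP cG It cx ct nI.
have At : ([set: 'rV[R]_N] `*` I) (x, t) by [].
have cp : (qx y, qt y) @[y --> Fi] --> within ([set: 'rV[R]_N] `*` I) (nbhs (x, t)).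
  move=> P wP; have h0 : Fi (fun y => ([set: 'rV[R]_N] `*` I) (qx y, qt y) -> P (qx y, qt y)).
    exact: (cvg_pair cx ct wP).
  change (Fi (fun y => P (qx y, qt y))).
  by apply: filterS2 nI h0 => y Iy; apply.
exact: (cvg_comp _ _ cp (cG _ At)).
Qed.

Lemma small_tails_ubounded (J : choiceType) (X : Type) (D : set X) (c : J -> X -> R) (b : R) :
  small_tails D (fun=> 1) c -> (forall i (y : X), D y -> `|c i y| <= b) ->
  exists B, forall y : X, D y -> forall F : {fset J}, \sum_(i <- F) `|c i y| <= B.
Proof.
move=> st cb; have [F0 H] := st 1 ltr01.
exists (\sum_(i <- F0) b + 1 * 1) => x Dx F.
apply: (le_trans (le_sum_fset (c := fun i => `|c i x|) (fun=> normr_ge0 _) (fsubsetUr F0 F))).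
rewrite (sum_fsetD _ (fsubsetUl F0 F)); apply: lerD.
  by apply: ler_sum => i _; exact: cb.
by apply: H => //; apply/fdisjointP => i iF0; rewrite inE iF0.
Qed.

Lemma normc_pos (z : R[i]) : 0 <= normc z.
Proof. by case: z => u v; exact: sqrtr_ge0. Qed.

Lemma coef_le_liouville (a K : R) (G : 'rV[R]_N -> R[i]) n : 0 <= a ->
  (liouville_norm2 a G <= K%:E)%E -> normc (fourier_coef G n) <= K + 1.
Proof.
move=> a0 GK; set c := normc _.
have c0 : 0 <= c by exact: normc_pos.
have w1 : 1 <= (1 + sqnorm n : R) `^ a.
  have := ge0_ler_powR a0; move=> /(_ 1 (1 + sqnorm n)); rewrite powR1; apply.
  - by rewrite nnegrE.
  - by rewrite nnegrE addr_ge0// sqnorm_ge0.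
  - by rewrite lerDl sqnorm_ge0.
have := fset_sum_le_esum _ GK [fset n]%fset; rewrite big_seq_fset1 -/c => h.
have {h} : (1 + sqnorm n) `^ a * c ^+ 2 <= K.
  by apply: h => m; rewrite mulr_ge0 ?powR_ge0 ?sqr_ge0.
have : c ^+ 2 <= (1 + sqnorm n) `^ a * c ^+ 2 by rewrite ler_peMl// sqr_ge0.
move: (_ * _) => z; have := sqr_ge0 (c - 1); rewrite !expr2; lra.
Qed.

End FourierData.

(** * Fourier coefficients of the source *)

Section SourceCoefficients.
Context {R : realType} {N : nat}.
Local Notation TI := (@torus_integral R N).
Local Open Scope complex_scope.
Implicit Types (n : 'rV[int]_N) (x : 'rV[R]_N).
Variables (T a e : R) (f : 'rV[R]_N -> R -> R[i]).
Hypotheses (N1 : (1 <= N)%N) (T0 : 0 < T) (a0 : 0 <= a) (e0 : 0 < e) (hae : N%:R / 2 < a - 2 * e).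
Hypothesis hf_cont : torus_continuous_on `[0, T] f.
Hypothesis hf : forall t, 0 <= t <= T -> in_liouville a (f ^~ t).
Hypothesis hf_norm : {within `[0, T],
  continuous (fun t => fine (liouville_norm2 a (f ^~ t)))}.
Local Notation D0 := [set t : R | 0 <= t <= T].

Lemma liouville_norm2_ge0 (b : R) (g : 'rV[R]_N -> R[i]) : (0 <= liouville_norm2 b g)%E.
Proof. by apply: esum_ge0 => n _; rewrite lee_fin mulr_ge0 ?powR_ge0 ?sqr_ge0. Qed.

Lemma source_norm_bounded : exists K : R, forall t, 0 <= t <= T ->
  (liouville_norm2 a (f ^~ t) <= K%:E)%E.
Proof.
have [c _ Hc] := EVT_max (ltW T0) hf_norm.
exists (fine (liouville_norm2 a (f ^~ c))) => t tT.
rewrite -[leLHS]fineK; first by rewrite lee_fin; apply: Hc; rewrite in_itv.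
by rewrite ge0_fin_numE ?liouville_norm2_ge0//; exact: hf.
Qed.

Lemma source_slice t : 0 <= t <= T -> torus_continuous (f ^~ t).
Proof.
move=> tT; have It : `[0, T]%classic t by rewrite /= in_itv.
have [pf [cR cI]] := hf_cont; split; first exact: pf.
have nI (y : 'rV[R]_N) : \forall z \near nbhs y, `[0, T]%classic t by exact: filterE.
split=> y.
  exact: (joint_comp (nbhs_filter y) (qx := id) (qt := fun=> t) cR It (fun P h => h)
    (cvg_cst _) (nI y)).
exact: (joint_comp (nbhs_filter y) (qx := id) (qt := fun=> t) cI It (fun P h => h)
  (cvg_cst _) (nI y)).
Qed.

Lemma source_tails :
  small_tails D0 (fun=> 1) (fun n t => (1 + sqnorm n) `^ e * normc (fourier_coef (f ^~ t) n)).
Proof.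
have [K HK] := source_norm_bounded.
exact: (liouville_tails (D := D0) (g := fun t => f ^~ t) N1 hae HK).
Qed.

Lemma normc_le_weighted (z : R[i]) n : normc z <= `|(1 + sqnorm n) `^ e * normc z|.
Proof.
rewrite normrM (ger0_norm (powR_ge0 _ _)) (ger0_norm (normc_pos z)).
apply: ler_peMl; first exact: normc_pos.
have := ge0_ler_powR (ltW e0); move=> /(_ 1 (1 + sqnorm n)); rewrite powR1; apply.
- by rewrite nnegrE.
- by rewrite nnegrE addr_ge0// sqnorm_ge0.
- by rewrite lerDl sqnorm_ge0.
Qed.

Lemma source_coef_summable : exists B : R, forall t, 0 <= t <= T ->
  forall F : {fset 'rV[int]_N}, \sum_(n <- F) (`|complex.Re (fourier_coef (f ^~ t) n)| +
    `|complex.Im (fourier_coef (f ^~ t) n)|) <= B.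
Proof.
have [K HK] := source_norm_bounded.
have st : small_tails D0 (fun=> 1) (fun n t => normc (fourier_coef (f ^~ t) n)).
  apply: (small_tails_le ltr01 _ source_tails) => n t _.
  by rewrite mul1r (ger0_norm (normc_pos _)); exact: normc_le_weighted.
have cb n t : D0 t -> `|normc (fourier_coef (f ^~ t) n)| <= K + 1.
  by move=> tT; rewrite (ger0_norm (normc_pos _)); apply: coef_le_liouville a0 _; exact: HK.
have [B HB] := small_tails_ubounded st cb.
exists (2 * B) => t tT F; apply: le_trans (ler_wpM2l _ (HB t tT F)); last by [].
rewrite mulr_sumr; apply: ler_sum => n _; rewrite (ger0_norm (normc_pos _)).
by have := normRe_le (fourier_coef (f ^~ t) n); have := normIm_le (fourier_coef (f ^~ t) n); lra.
Qed.

(** Fourier inversion bounds [f] by the sum of its coefficients. *)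
Lemma source_bounded : exists B : R, forall t x, 0 <= t <= T ->
  `|complex.Re (f x t)| <= B /\ `|complex.Im (f x t)| <= B.
Proof.
have [B HB] := source_coef_summable; exists B => t x tT.
have st := source_slice tT; have hB := HB t tT; split.
  by have /= -> := Re_inversion st hB x; exact: wave_sum_bound.
have /= -> := Im_inversion st hB x; apply: wave_sum_bound => F.
by apply: le_trans (hB F); apply: ler_sum => n _; rewrite normrN addrC.
Qed.

(** Dominated convergence under the integral over the torus. *)
Lemma source_coef_continuous n :
  {within `[0, T], continuous (fun t => complex.Re (fourier_coef (f ^~ t) n))} /\
  {within `[0, T], continuous (fun t => complex.Im (fourier_coef (f ^~ t) n))}.
Proof.
have [B HB] := source_bounded; have [_ [cR cI]] := hf_cont.
have cosb : forall y, `|cos (dotn n y)| <= 1 :> R.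
  by move=> y; rewrite ler_norml cos_geN1 cos_le1.
have sinb : forall y, `|sin (dotn n y)| <= 1 :> R.
  by move=> y; rewrite ler_norml sin_geN1 sin_le1.
have mb (u v : R) : `|u| <= B -> `|v| <= 1 -> `|u * v| <= B.
  by move=> hu hv; rewrite normrM; apply: (le_trans _ hu); rewrite ler_piMr.
have cc := @continuous_cos_dotn0 R N n; have cs := @continuous_sin_dotn R N n.
have tl t (s : R^nat) (y : 'rV[R]_N) : `[0, T]%classic t -> (forall k, `[0, T]%classic (s k)) ->
    s k @[k --> \oo] --> t ->
    complex.Re (f y (s k)) @[k --> \oo] --> complex.Re (f y t) /\
    complex.Im (f y (s k)) @[k --> \oo] --> complex.Im (f y t).
  move=> tT sT st.
  have nI : \forall k \near \oo, `[0, T]%classic (s k) by exact: nearW.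
  split.
    exact: (joint_comp _ (qx := fun=> y) (qt := s) cR tT (cvg_cst _) st nI).
  exact: (joint_comp _ (qx := fun=> y) (qt := s) cI tT (cvg_cst _) st nI).
have tT' t : `[0, T]%classic t -> 0 <= t <= T by rewrite /= in_itv.
split; apply/subspace_continuousP => t tT; rewrite /from_subspace;
  apply: cvg_within_seq => // s sT st.
  rewrite Re_fourier_coef; under eq_fun do rewrite Re_fourier_coef.
  apply: cvgMl_tmp; apply: (torus_integral_dct (M := B + B)).
  - move=> k; have [_ [c1 c2]] := source_slice (tT' _ (sT k)).
    exact: row_continuousD (row_continuousM c1 cc) (row_continuousM c2 cs).
  - have [_ [c1 c2]] := source_slice (tT' _ tT).
    exact: row_continuousD (row_continuousM c1 cc) (row_continuousM c2 cs).
  - move=> k y; have [h1 h2] := HB (s k) y (tT' _ (sT k)).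
    by apply: (le_trans (ler_normD _ _)); apply: lerD; exact: mb.
  - move=> y; have [h1 h2] := HB t y (tT' _ tT).
    by apply: (le_trans (ler_normD _ _)); apply: lerD; exact: mb.
  - move=> y; have [l1 l2] := tl t s y tT sT st.
    exact: cvgD (cvgMr_tmp l1) (cvgMr_tmp l2).
rewrite Im_fourier_coef; under eq_fun do rewrite Im_fourier_coef.
apply: cvgMl_tmp; apply: (torus_integral_dct (M := B + B)).
- move=> k; have [_ [c1 c2]] := source_slice (tT' _ (sT k)).
  have := row_continuousD (row_continuousM c2 cc) (row_continuousZ (c := -1) (row_continuousM c1 cs)).
  by apply: row_continuous_ext => y; rewrite mulN1r.
- have [_ [c1 c2]] := source_slice (tT' _ tT).
  have := row_continuousD (row_continuousM c2 cc) (row_continuousZ (c := -1) (row_continuousM c1 cs)).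
  by apply: row_continuous_ext => y; rewrite mulN1r.
- move=> k y; have [h1 h2] := HB (s k) y (tT' _ (sT k)).
  by apply: (le_trans (ler_normB _ _)); apply: lerD; exact: mb.
- move=> y; have [h1 h2] := HB t y (tT' _ tT).
  by apply: (le_trans (ler_normB _ _)); apply: lerD; exact: mb.
- move=> y; have [l1 l2] := tl t s y tT sT st.
  exact: cvgB (cvgMr_tmp l2) (cvgMr_tmp l1).
Qed.

End SourceCoefficients.

(** * The solution *)

Lemma complex_ReD (R : realType) (z w : R[i]) :
  complex.Re (z + w) = complex.Re z + complex.Re w.
Proof. by case: z; case: w. Qed.

Lemma complex_ImD (R : realType) (z w : R[i]) :
  complex.Im (z + w) = complex.Im z + complex.Im w.
Proof. by case: z; case: w. Qed.

Section Assembly.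
Context {R : realType} {N : nat}.
Local Notation mu := (@lebesgue_measure R).
Local Open Scope complex_scope.
Variables (rho T a e B : R) (phi : 'rV[R]_N -> R[i]) (f : 'rV[R]_N -> R -> R[i]).
Hypotheses (N1 : (1 <= N)%N) (rho01 : 0 < rho < 1) (T0 : 0 < T) (a0 : 0 <= a)
  (e01 : 0 < e <= 1) (hae : N%:R / 2 < a - 2 * e).
Hypotheses (hphi_cont : torus_continuous phi) (hphi : in_liouville a phi).
Hypothesis hf_cont : torus_continuous_on `[0, T] f.
Hypothesis hf : forall t, 0 <= t <= T -> in_liouville a (f ^~ t).
Hypothesis hf_norm : {within `[0, T],
  continuous (fun t => fine (liouville_norm2 a (f ^~ t)))}.
Hypothesis hB : forall t, 0 <= t <= T -> forall F : {fset 'rV[int]_N},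
  \sum_(n <- F) (`|complex.Re (fourier_coef (f ^~ t) n)| +
    `|complex.Im (fourier_coef (f ^~ t) n)|) <= B.

Local Opaque mittag_leffler Gamma powR integral Rintegral ml_kernel rl_kernel frac_integral.

Let e0 : 0 < e. Proof. by case/andP: e01. Qed.
Let T0' : 0 <= T. Proof. exact: ltW. Qed.

Definition init_re n := complex.Re (fourier_coef phi n).
Definition init_im n := complex.Im (fourier_coef phi n).
(** The time is clamped so that the coefficients are continuous on the line. *)
Definition src_re n s := complex.Re (fourier_coef (f ^~ (clamp T s)) n).
Definition src_im n s := complex.Im (fourier_coef (f ^~ (clamp T s)) n).
Local Notation p1 := init_re.
Local Notation p2 := init_im.
Local Notation g1 := src_re.
Local Notation g2 := src_im.
Local Notation p3 := (fun n => - init_re n).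
Local Notation g3 := (fun n s => - src_re n s).

Let cg1 n : continuous (g1 n).
Proof.
have [c _] := source_coef_continuous N1 T0 a0 e0 hae hf_cont hf hf_norm n.
exact: (continuous_comp_clamp T0' c).
Qed.
Let cg2 n : continuous (g2 n).
Proof.
have [_ c] := source_coef_continuous N1 T0 a0 e0 hae hf_cont hf hf_norm n.
exact: (continuous_comp_clamp T0' c).
Qed.
Let cg3 n : continuous (g3 n).
Proof. by move=> s; apply: cvgN; exact: (@cg1 n). Qed.

Let coefB n s : `|g1 n s| + `|g2 n s| <= B.
Proof. by have := hB (clamp_itv s T0') [fset n]%fset; rewrite big_seq_fset1. Qed.
Let gM1 n s : `|g1 n s| <= B.
Proof. by apply: le_trans (coefB n s); rewrite lerDl. Qed.
Let gM2 n s : `|g2 n s| <= B.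
Proof. by apply: le_trans (coefB n s); rewrite lerDr. Qed.
Let gM3 n s : `|g3 n s| <= B.
Proof. by rewrite normrN. Qed.

Let st := source_tails N1 T0 hae hf hf_norm.

Let clamp_tails (h : 'rV[int]_N -> R -> R) :
  (forall n s, `|h n s| <= normc (fourier_coef (f ^~ (clamp T s)) n)) ->
  small_tails [set: R] (fun=> 1) (fun n s => (1 + sqnorm n) `^ e * h n s).
Proof.
move=> hh d d0; have [F0 H] := st d0; exists F0 => F dF s _.
apply: le_trans (H F dF _ (clamp_itv s T0')); apply: ler_sum => n _.
rewrite !normrM; apply: ler_wpM2l => //.
by rewrite (ger0_norm (normc_pos _)); exact: hh.
Qed.

Let tg1 : small_tails [set: R] (fun=> 1) (fun n s => (1 + sqnorm n) `^ e * g1 n s).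
Proof. by apply: clamp_tails => n s; exact: normRe_le. Qed.
Let tg2 : small_tails [set: R] (fun=> 1) (fun n s => (1 + sqnorm n) `^ e * g2 n s).
Proof. by apply: clamp_tails => n s; exact: normIm_le. Qed.
Let tg3 : small_tails [set: R] (fun=> 1) (fun n s => (1 + sqnorm n) `^ e * g3 n s).
Proof. by apply: clamp_tails => n s; rewrite normrN; exact: normRe_le. Qed.

Lemma init_tails : small_tails [set: R] (fun=> 1) (fun n _ => normc (fourier_coef phi n)).
Proof.
have fin : liouville_norm2 a phi \is a fin_num.
  by rewrite ge0_fin_numE ?liouville_norm2_ge0.
have h (x : R) : [set: R] x ->
    (liouville_norm2 a ((fun=> phi) x) <= (fine (liouville_norm2 a phi))%:E)%E.
  by move=> _; rewrite fineK.
have := liouville_tails (D := [set: R]) (g := fun=> phi) N1 hae h.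
apply: (small_tails_le ltr01) => n t _.
by rewrite mul1r (ger0_norm (normc_pos _)); exact: normc_le_weighted.
Qed.

Let init_tails_le (q : 'rV[int]_N -> R) :
  (forall n, `|q n| <= normc (fourier_coef phi n)) ->
  small_tails [set: R] (fun=> 1) (fun n _ => q n).
Proof.
move=> hq; apply: (small_tails_le ltr01 _ init_tails) => n t _.
by rewrite mul1r (ger0_norm (normc_pos _)).
Qed.
Let tp1 : small_tails [set: R] (fun=> 1) (fun n _ => p1 n).
Proof. by apply: init_tails_le => n; exact: normRe_le. Qed.
Let tp2 : small_tails [set: R] (fun=> 1) (fun n _ => p2 n).
Proof. by apply: init_tails_le => n; exact: normIm_le. Qed.
Let tp3 : small_tails [set: R] (fun=> 1) (fun n _ => p3 n).
Proof. by apply: init_tails_le => n; rewrite normrN; exact: normRe_le. Qed.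

Local Notation lam := (@sqnorm R N).
Local Notation A1 := (mode rho lam p1 g1).
Local Notation A2 := (mode rho lam p2 g2).
Local Notation A3 := (mode rho lam p3 g3).

Let l0 n : 0 <= lam n. Proof. exact: sqnorm_ge0. Qed.
Let mg1 n : measurable_fun [set: R] (g1 n). Proof. exact: continuous_measurable_fun. Qed.
Let mg2 n : measurable_fun [set: R] (g2 n). Proof. exact: continuous_measurable_fun. Qed.

Lemma mode_opp n t : A3 n t = - A1 n t.
Proof.
have k1 := kconv_integrable rho01 (mg1 n) (gM1 n) t (l0 n).
have kE : kconv rho (lam n) (g3 n) t = -1 * kconv rho (lam n) (g1 n) t.
  rewrite !kconvE -(rRintegralZ (measurable_itv _) _ k1).
  by apply: eq_Rintegral => s _; rewrite mulNr mulN1r.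
by rewrite /mode /mode_sol kE mulN1r mulNr opprD.
Qed.

Lemma kconv_coef (h : R[i] -> R) n t : 0 <= t <= T ->
  (forall (z : R[i]) (k : R), h (z * k%:C) = h z * k) ->
  \int[mu]_(xi in `[0, t]) h (fourier_coef (f ^~ (t - xi)) n *
     (xi `^ (rho - 1) * mittag_leffler rho rho (- sqnorm n * xi `^ rho))%:C) =
  kconv rho (lam n) (fun s => h (fourier_coef (f ^~ (clamp T s)) n)) t.
Proof.
move=> /andP[t0 tT] hh; rewrite kconvE; apply: eq_Rintegral => xi.
move=> /set_mem; rewrite /= in_itv/= => /andP[x0 xt].
rewrite hh ml_kernelE clampE//; apply/andP; split; first by rewrite subr_ge0.
by apply: le_trans tT; rewrite gerBl.
Qed.

Let amplitude n t : R[i] := fourier_coef phi n *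
     (mittag_leffler rho 1 (- sqnorm n * t `^ rho))%:C +
   cintegral `[0, t] (fun xi =>
     fourier_coef (f ^~ (t - xi)) n *
     (xi `^ (rho - 1) * mittag_leffler rho rho (- sqnorm n * xi `^ rho))%:C).

Let Re_scale (z : R[i]) (k : R) : complex.Re (z * k%:C) = complex.Re z * k.
Proof. by rewrite complex_ReM /= mulr0 subr0. Qed.

Let Im_scale (z : R[i]) (k : R) : complex.Im (z * k%:C) = complex.Im z * k.
Proof. by rewrite complex_ImM /= mulr0 add0r. Qed.

Let Re_amplitude n t : 0 <= t <= T -> complex.Re (amplitude n t) = A1 n t.
Proof.
move=> tT; rewrite /amplitude complex_ReD Re_scale /mode /mode_sol; congr (_ + _).
exact: (kconv_coef (h := @complex.Re R) n tT Re_scale).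
Qed.

Let Im_amplitude n t : 0 <= t <= T -> complex.Im (amplitude n t) = A2 n t.
Proof.
move=> tT; rewrite /amplitude complex_ImD Im_scale /mode /mode_sol; congr (_ + _).
exact: (kconv_coef (h := @complex.Im R) n tT Im_scale).
Qed.

Lemma Re_series_term n x t : 0 <= t <= T ->
  complex.Re (series_term rho phi f n x t) = wave (A1 ^~ t) (A2 ^~ t) n x.
Proof.
move=> tT; rewrite -[series_term _ _ _ _ _ _]/(amplitude n t * expi (dotn n x)).
by rewrite complex_ReM (Re_amplitude n tT) (Im_amplitude n tT).
Qed.

Lemma Im_series_term n x t : 0 <= t <= T ->
  complex.Im (series_term rho phi f n x t) = wave (A2 ^~ t) (A3 ^~ t) n x.
Proof.
move=> tT; rewrite -[series_term _ _ _ _ _ _]/(amplitude n t * expi (dotn n x)).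
rewrite complex_ImM (Re_amplitude n tT) (Im_amplitude n tT) /wave mode_opp mulNr opprK.
exact: addrC.
Qed.

Local Notation wsolR := (wsol rho p1 p2 g1 g2).
Local Notation wsolI := (wsol rho p2 p3 g2 g3).
Local Notation wcapR := (wcap rho p1 p2 g1 g2).
Local Notation wcapI := (wcap rho p2 p3 g2 g3).
Local Notation wlapR := (wlap rho p1 p2 g1 g2).
Local Notation wlapI := (wlap rho p2 p3 g2 g3).

(** The second component is the real solution for the data - i phi and - i f. *)
Definition solution (x : 'rV[R]_N) (t : R) : R[i] := wsolR x t +i* wsolI x t.

Let dT t : 0 < t <= T -> 0 <= t <= T. Proof. by case/andP => /ltW ->. Qed.

Lemma solution_caputo x t : 0 < t <= T ->
  caputo_derivable rho T (solution x) t /\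
  caputo rho T (solution x) t = wcapR x t +i* wcapI x t.
Proof.
move=> tT; apply: (caputo_value tT (hR := wsolR x) (hI := wsolI x)) => //.
  exact: (wsol_caputo rho01 T0 e01 cg1 cg2 gM1 gM2 tp1 tp2 tg1 tg2 tT).
exact: (wsol_caputo rho01 T0 e01 cg2 cg3 gM2 gM3 tp2 tp3 tg2 tg3 tT).
Qed.

Let b (q : 'rV[int]_N -> R) (g : 'rV[int]_N -> R -> R) n t :=
  g n t - lam n * mode rho lam q g n t.

Lemma series_term_caputo n x t : 0 < t <= T ->
  caputo_derivable rho T (series_term rho phi f n x) t /\
  caputo rho T (series_term rho phi f n x) t =
    wave (b p1 g1 ^~ t) (b p2 g2 ^~ t) n x +i* wave (b p2 g2 ^~ t) (b p3 g3 ^~ t) n x.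
Proof.
move=> tT; apply: (caputo_value tT (hR := fun s => wave (A1 ^~ s) (A2 ^~ s) n x)
  (hI := fun s => wave (A2 ^~ s) (A3 ^~ s) n x)).
- by move=> s; exact: Re_series_term.
- by move=> s; exact: Im_series_term.
- exact: (wave_caputo rho01 T0 e01 cg1 cg2 gM1 gM2 tT).
- exact: (wave_caputo rho01 T0 e01 cg2 cg3 gM2 gM3 tT).
Qed.

Lemma solution_opA x t : 0 < t <= T ->
  opA (solution ^~ t) x = wlapR x t +i* wlapI x t.
Proof.
move=> tT; rewrite /opA /=.
rewrite (wsol_laplacian rho01 T0 e01 cg1 cg2 gM1 gM2 tp1 tp2 tg1 tg2 x tT).
rewrite (wsol_laplacian rho01 T0 e01 cg2 cg3 gM2 gM3 tp2 tp3 tg2 tg3 x tT).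
by apply: complex_eqP => /=; rewrite opprK.
Qed.

Lemma series_term_opA n x t : 0 < t <= T ->
  opA (fun y => series_term rho phi f n y t) x =
    wave (fun m => lam m * A1 m t) (fun m => lam m * A2 m t) n x +i*
    wave (fun m => lam m * A2 m t) (fun m => lam m * A3 m t) n x.
Proof.
move=> /dT tT; rewrite /opA.
rewrite (_ : (fun y => complex.Re _) = wave (A1 ^~ t) (A2 ^~ t) n); last first.
  by apply/funext => y; exact: Re_series_term.
rewrite (_ : (fun y => complex.Im _) = wave (A2 ^~ t) (A3 ^~ t) n); last first.
  by apply/funext => y; exact: Im_series_term.
by rewrite !wave_laplacian; apply: complex_eqP => /=; rewrite opprK.
Qed.

Lemma series_term_C2 n t : 0 <= t <= T ->
  torus_C2 (fun x => series_term rho phi f n x t).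
Proof.
move=> tT; split.
- move=> x j; apply: complex_eqP; rewrite ?Re_series_term// ?Im_series_term//.
    exact: rperiodic_wave.
  exact: rperiodic_wave.
- rewrite (_ : (fun y => complex.Re _) = wave (A1 ^~ t) (A2 ^~ t) n); last first.
    by apply/funext => y; exact: Re_series_term.
  exact: wave_C2.
- rewrite (_ : (fun y => complex.Im _) = wave (A2 ^~ t) (A3 ^~ t) n); last first.
    by apply/funext => y; exact: Im_series_term.
  exact: wave_C2.
Qed.

Let fix_time (D : set R) (w : R -> R) (c : 'rV[int]_N -> 'rV[R]_N * R -> R) t : D t -> 0 < w t ->
  small_tails ([set: 'rV[R]_N] `*` D) (fun q => w q.2) c ->
  small_tails [set: 'rV[R]_N] (fun=> 1) (fun n x => c n (x, t)).
Proof.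
move=> Dt wt tc d d0; have [F0 H] := tc _ (divr_gt0 d0 wt); exists F0 => F dF x _.
have Dx : ([set: 'rV[R]_N] `*` D) (x, t) by [].
by apply: (le_trans (H F dF (x, t) Dx)); rewrite mulfVK ?gt_eqF// mulr1.
Qed.

Lemma solution_series t : 0 <= t <= T ->
  cvg_abs_unif_to (fun n x => series_term rho phi f n x t) (solution ^~ t).
Proof.
move=> tT.
have eR n : (fun x => complex.Re (series_term rho phi f n x t)) = wave (A1 ^~ t) (A2 ^~ t) n.
  by apply/funext => y; exact: Re_series_term.
have eI n : (fun x => complex.Im (series_term rho phi f n x t)) = wave (A2 ^~ t) (A3 ^~ t) n.
  by apply/funext => y; exact: Im_series_term.
apply: complex_cvg_abs_unif.
- rewrite (funext eR).
  exact: (fix_time (w := fun=> 1) tT ltr01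
    (wsol_term_tails T rho01 e01 cg1 cg2 gM1 gM2 tp1 tp2 tg1 tg2)).
- rewrite (funext eI).
  exact: (fix_time (w := fun=> 1) tT ltr01
    (wsol_term_tails T rho01 e01 cg2 cg3 gM2 gM3 tp2 tp3 tg2 tg3)).
- move=> x; rewrite -[LHS]/(wsolR x t) /wsol /wave_sum; congr rsum; apply/funext => n.
  by rewrite Re_series_term.
- move=> x; rewrite -[LHS]/(wsolI x t) /wsol /wave_sum; congr rsum; apply/funext => n.
  by rewrite Im_series_term.
Qed.

Let weight_pos (t : R) : 0 < 1 + t `^ (- rho).
Proof. by apply: ltr_pwDl => //; exact: powR_ge0. Qed.

Lemma caputo_series t : 0 < t <= T ->
  cvg_abs_unif_to (fun n x => caputo rho T (series_term rho phi f n x) t)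
    (fun x => wcapR x t +i* wcapI x t).
Proof.
move=> tT.
have E n x := (series_term_caputo n x tT).2.
rewrite (funext (fun n => funext (E n))).
apply: complex_cvg_abs_unif => //=.
- exact: (fix_time (w := fun s => 1 + s `^ (- rho)) tT (weight_pos t)
    (wcap_term_tails rho01 T0 e01 cg1 cg2 gM1 gM2 tp1 tp2 tg1 tg2)).
- exact: (fix_time (w := fun s => 1 + s `^ (- rho)) tT (weight_pos t)
    (wcap_term_tails rho01 T0 e01 cg2 cg3 gM2 gM3 tp2 tp3 tg2 tg3)).
Qed.

Lemma opA_series t : 0 < t <= T ->
  cvg_abs_unif_to (fun n x => opA (fun y => series_term rho phi f n y t) x)
    (fun x => wlapR x t +i* wlapI x t).
Proof.
move=> tT.
have E n x := series_term_opA n x tT.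
rewrite (funext (fun n => funext (E n))).
apply: complex_cvg_abs_unif => //=.
- exact: (fix_time (w := fun s => 1 + s `^ (- rho)) tT (weight_pos t)
    (wlap_term_tails rho01 T0 e01 cg1 cg2 gM1 gM2 tp1 tp2 tg1 tg2)).
- exact: (fix_time (w := fun s => 1 + s `^ (- rho)) tT (weight_pos t)
    (wlap_term_tails rho01 T0 e01 cg2 cg3 gM2 gM3 tp2 tp3 tg2 tg3)).
Qed.

Let joint_continuous (D : set R) (g : 'rV[R]_N -> R -> R[i]) (W1 W2 : 'rV[R]_N -> R -> R) :
  (forall t, rperiodic (W1 ^~ t)) -> (forall t, rperiodic (W2 ^~ t)) ->
  (forall x t, D t -> g x t = W1 x t +i* W2 x t) ->
  (forall x t, D t -> W1 q.1 q.2 @[q --> within ([set: 'rV[R]_N] `*` D) (nbhs (x, t))] -->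
    W1 x t) ->
  (forall x t, D t -> W2 q.1 q.2 @[q --> within ([set: 'rV[R]_N] `*` D) (nbhs (x, t))] -->
    W2 x t) ->
  torus_continuous_on D g.
Proof.
move=> per1 per2 gW c1 c2; split.
  move=> t Dt x j; rewrite !(gW _ _ Dt).
  by rewrite [W1 _ t](per1 t x j) [W2 _ t](per2 t x j).
have tr (h W : 'rV[R]_N * R -> R) q : ([set: 'rV[R]_N] `*` D) q ->
    (forall q, ([set: 'rV[R]_N] `*` D) q -> h q = W q) ->
    W r @[r --> within ([set: 'rV[R]_N] `*` D) (nbhs q)] --> W q ->
    h r @[r --> within ([set: 'rV[R]_N] `*` D) (nbhs q)] --> h q.
  move=> Dq hW cW; rewrite (hW q Dq); apply: cvg_trans cW; apply: near_eq_cvg.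
  near=> r; apply/esym/hW; near: r; exact: withinT.
split; apply/subspace_continuousP => -[x t] Dxt; have [_ /= Dt] := Dxt.
  apply: (tr (fun q => complex.Re (g q.1 q.2)) (fun q => W1 q.1 q.2) (x, t) Dxt).
    by move=> [y s] [_ /= Ds]; rewrite (gW _ _ Ds).
  exact: c1.
apply: (tr (fun q => complex.Im (g q.1 q.2)) (fun q => W2 q.1 q.2) (x, t) Dxt).
  by move=> [y s] [_ /= Ds]; rewrite (gW _ _ Ds).
exact: c2.
Unshelve. all: by end_near. Qed.

Lemma solution_continuous : torus_continuous_on `[0, T] solution.
Proof.
apply: (joint_continuous (W1 := wsolR) (W2 := wsolI)) => //.
- by move=> t; exact: rperiodic_wave_sum.
- by move=> t; exact: rperiodic_wave_sum.
- move=> x t; rewrite /= in_itv/= => tT.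
  exact: (wsol_joint_cvg rho01 e01 cg1 cg2 gM1 gM2 tp1 tp2 tg1 tg2 tT).
- move=> x t; rewrite /= in_itv/= => tT.
  exact: (wsol_joint_cvg rho01 e01 cg2 cg3 gM2 gM3 tp2 tp3 tg2 tg3 tT).
Qed.

Lemma solution_caputo_continuous :
  torus_continuous_on `]0, T] (fun x t => caputo rho T (solution x) t).
Proof.
apply: (joint_continuous (W1 := wcapR) (W2 := wcapI)).
- by move=> t; exact: rperiodic_wave_sum.
- by move=> t; exact: rperiodic_wave_sum.
- by move=> x t; rewrite /= in_itv/= => tT; have [] := solution_caputo x tT.
- move=> x t; rewrite /= in_itv/= => tT.
  exact: (wcap_joint_cvg rho01 T0 e01 cg1 cg2 gM1 gM2 tp1 tp2 tg1 tg2 tT).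
- move=> x t; rewrite /= in_itv/= => tT.
  exact: (wcap_joint_cvg rho01 T0 e01 cg2 cg3 gM2 gM3 tp2 tp3 tg2 tg3 tT).
Qed.

Lemma solution_opA_continuous :
  torus_continuous_on `]0, T] (fun x t => opA (solution ^~ t) x).
Proof.
apply: (joint_continuous (W1 := wlapR) (W2 := wlapI)).
- by move=> t; exact: rperiodic_wave_sum.
- by move=> t; exact: rperiodic_wave_sum.
- by move=> x t; rewrite /= in_itv/= => tT; exact: solution_opA.
- move=> x t; rewrite /= in_itv/= => tT.
  exact: (wlap_joint_cvg rho01 T0 e01 cg1 cg2 gM1 gM2 tp1 tp2 tg1 tg2 tT).
- move=> x t; rewrite /= in_itv/= => tT.
  exact: (wlap_joint_cvg rho01 T0 e01 cg2 cg3 gM2 gM3 tp2 tp3 tg2 tg3 tT).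
Qed.

Lemma solution_C2 t : 0 < t <= T -> torus_C2 (solution ^~ t).
Proof.
move=> tT; split.
- move=> x j; apply: complex_eqP; exact: rperiodic_wave_sum.
- exact: (wsol_C2 rho01 T0 e01 cg1 cg2 gM1 gM2 tp1 tp2 tg1 tg2 tT).
- exact: (wsol_C2 rho01 T0 e01 cg2 cg3 gM2 gM3 tp2 tp3 tg2 tg3 tT).
Qed.

(** The terms of the modes cancel, and the waves of the source sum to [f] by
    inversion. *)
Lemma solution_equation x t : 0 < t <= T ->
  caputo rho T (solution x) t + opA (solution ^~ t) x = f x t.
Proof.
move=> tT; have [_ ->] := solution_caputo x tT; rewrite (solution_opA x tT).
have slice := source_slice hf_cont (dT tT); have hBt := hB (dT tT).
have eR := Re_inversion slice hBt x; have eI := Im_inversion slice hBt x.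
have cE : clamp T t = t by apply: clampE; exact: dT.
have g1E : g1 ^~ t = (fun n => complex.Re (fourier_coef (f ^~ t) n)).
  by apply/funext => n; rewrite /src_re cE.
have g2E : g2 ^~ t = (fun n => complex.Im (fourier_coef (f ^~ t) n)).
  by apply/funext => n; rewrite /src_im cE.
apply: complex_eqP.
  rewrite complex_ReD.
  rewrite -[LHS]/(wcapR x t + wlapR x t).
  rewrite (wsol_equation rho01 T0 e01 cg1 cg2 gM1 gM2 tp1 tp2 tg1 tg2 x tT).
  rewrite -[RHS]/(complex.Re ((f ^~ t) x)) eR.
  by rewrite g1E g2E.
rewrite complex_ImD.
rewrite -[LHS]/(wcapI x t + wlapI x t).
rewrite (wsol_equation rho01 T0 e01 cg2 cg3 gM2 gM3 tp2 tp3 tg2 tg3 x tT).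
rewrite -[RHS]/(complex.Im ((f ^~ t) x)) eI g2E.
have g3E : (g3 ^~ t) = (fun n => - complex.Re (fourier_coef (f ^~ t) n)).
  by apply/funext => n; rewrite /src_re cE.
exact: (f_equal (fun q => wave_sum _ q x) g3E).
Qed.

Lemma solution_initial x : solution x 0 = phi x.
Proof.
have [S HS] : exists S, forall F : {fset 'rV[int]_N},
    \sum_(n <- F) (`|complex.Re (fourier_coef phi n)| + `|complex.Im (fourier_coef phi n)|) <= S.
  have [S1 H1] := small_tails_bounded tp1 (I : [set: R] 0).
  have [S2 H2] := small_tails_bounded tp2 (I : [set: R] 0).
  by exists (S1 + S2) => F; rewrite big_split/=; exact: lerD (H1 F) (H2 F).
apply: complex_eqP.
  rewrite (Re_inversion hphi_cont HS) -[LHS]/(wsolR x 0).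
  exact: wsol_init.
rewrite (Im_inversion hphi_cont HS) -[LHS]/(wsolI x 0).
exact: wsol_init.
Qed.

Lemma solution_classical : classical_solution rho T phi f solution.
Proof.
split.
- exact: solution_continuous.
- by move=> x t tT; have [] := solution_caputo x tT.
- exact: solution_C2.
- exact: solution_caputo_continuous.
- exact: solution_opA_continuous.
- exact: solution_equation.
- exact: solution_initial.
Qed.

End Assembly.

Theorem theorem1p2 (R : realType) (N : nat) (rho T a : R)
    (phi : 'rV[R]_N -> R[i]) (f : 'rV[R]_N -> R -> R[i])
    (hN : (1 <= N)%N) (hrho : 0 < rho < 1) (hT : 0 < T) (ha : N%:R / 2 < a)
    (hphi_cont : torus_continuous phi)
    (hphi : in_liouville a phi)
    (hf_cont : torus_continuous_on `[0, T] f)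
    (hf : forall t, 0 <= t <= T -> in_liouville a (f ^~ t))
    (hf_norm : {within `[0, T],
       continuous (fun t => fine (liouville_norm2 a (f ^~ t)))}) :
  exists u : 'rV[R]_N -> R -> R[i],
    [/\ classical_solution rho T phi f u,
        forall x t, 0 <= t <= T ->
          has_sum (fun n => series_term rho phi f n x t) (u x t)
      & forall t, 0 < t <= T ->
        [/\ cvg_abs_unif_to (fun n x => series_term rho phi f n x t) (u ^~ t),
            forall n x, caputo_derivable rho T (series_term rho phi f n x) t,
            cvg_abs_unif (fun n x =>
              caputo rho T (series_term rho phi f n x) t),
            forall n, torus_C2 (fun x => series_term rho phi f n x t)
          & cvg_abs_unif (fun n x =>
              opA (fun y => series_term rho phi f n y t) x)]].
Proof.
(* e is the part of the smoothness spent on the factor l^e of the kernel bound *)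
have [e e01 hae] : exists2 e : R, 0 < e <= 1 & N%:R / 2 < a - 2 * e.
  pose d := (a - N%:R / 2) / 4; have d0 : 0 < d by rewrite divr_gt0// subr_gt0.
  have h1 : Num.min 1 d <= d by rewrite ge_min lexx orbT.
  exists (Num.min 1 d); first by rewrite lt_min ltr01 d0 ge_min lexx.
  by move: h1; rewrite /d; move: (Num.min _ _) => m; lra.
have e0 : 0 < e by case/andP: e01.
have a0 : 0 <= a by apply/ltW; apply: le_lt_trans ha; rewrite divr_ge0.
have [B hB] := source_coef_summable hN hT a0 e0 hae hf hf_norm.
have ser := solution_series hN hrho hT a0 e01 hae hphi hf_cont hf hf_norm hB.
exists (solution rho T phi f); split.
- exact: (solution_classical hN hrho hT a0 e01 hae hphi_cont hphi hf_cont hf hf_norm hB).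
- by move=> x t tT; exact: (cvg_abs_unif_has_sum x (ser t tT)).
- move=> t tT; have tT0 : 0 <= t <= T by case/andP: tT => /ltW ->.
  have cap := fun n x => series_term_caputo phi hN hrho hT a0 e01 hae hf_cont hf hf_norm hB n x tT.
  split.
  + exact: ser.
  + by move=> n x; have [] := cap n x.
  + by eexists; exact: (caputo_series hN hrho hT a0 e01 hae hphi hf_cont hf hf_norm hB tT).
  + by move=> n; exact: (series_term_C2 phi hN hrho hT a0 e01 hae hf_cont hf hf_norm hB n tT0).
  + by eexists; exact: (opA_series hN hrho hT a0 e01 hae hphi hf_cont hf hf_norm hB tT).
Qed.
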